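(* Let $n\ge2$, let $Q$ be the star-shaped quiver with one central vertex $0$ and $n$ outer vertices $1,\dots,n$, with exactly one edge from each outer vertex to the central vertex, and let $\mathbf{v}$ be the dimension vector with dimension $2$ at the central vertex and dimension $1$ at each outer vertex. Let $\alpha=(\alpha_0,\alpha_1,\dots,\alpha_n)$ with $\alpha_j<0$ real for $j=1,\dots,n$ and $\alpha_0=-\frac12\sum_{j=1}^n\alpha_j$. (1) If $\alpha$ is $2$-strictly short then - $\pi_j\left(\mathrm{Rep}(Q,\mathbf{v})^{\alpha\text{-}st}\right)=0$ for $j\le2$; - $\pi_j\left(\mathcal{M}_\alpha(Q,\mathbf{v})^{st}\right)\cong\pi_{j-1}\left(\mathsf{U}(2)\times\mathsf{U}(1)^{n-1}\right)$ for $1\le j\le2$. (2) If $\alpha$ is $1$-strictly short then $\mathcal{M}_\alpha(Q,\mathbf{v})^{st}$ and $\mathrm{Rep}(Q,\mathbf{v})^{\alpha\text{-}st}$ are both connected.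
   Context: With $V_0=\mathbb{C}^2$ and $V_j=\mathbb{C}$ for $1\le j\le n$, $\mathrm{Rep}(Q,\mathbf{v})=\bigoplus_{j=1}^n\mathrm{Hom}(V_j,V_0)$. The group $G_{\mathbf{v}}^{\mathbb{C}}=\mathsf{GL}(2,\mathbb{C})\times\mathsf{GL}(1,\mathbb{C})^n$ acts by $g\cdot(A_j)_{j=1}^n=(g_0A_jg_j^{-1})_{j=1}^n$. A subrepresentation of $A=(A_j)$ is a choice of subspaces $V_j'\subseteq V_j$ ($0\le j\le n$) with $A_j(V_j')\subseteq V_0'$ for $1\le j\le n$; its dimension vector is $\mathbf{v'}=(\dim_{\mathbb{C}}V_j')_{0\le j\le n}$. For $\mathbf{v'}\neq\mathbf{0}$ set $\mathrm{slope}_\alpha(\mathbf{v'})=\left(\sum_{j=0}^n-\alpha_jv_j'\right)/\sum_{j=0}^nv_j'$ (so $\mathrm{slope}_\alpha(\mathbf{v})=0$). $A$ is $\alpha$-stable if every subrepresentation with $\mathbf{v'}\ne\mathbf{0},\mathbf{v}$ satisfies $\mathrm{slope}_\alpha(\mathbf{v'})<\mathrm{slope}_\alpha(\mathbf{v})$. $\mathrm{Rep}(Q,\mathbf{v})^{\alpha\text{-}st}$ is the set of $\alpha$-stable representations, and $\mathcal{M}_\alpha(Q,\mathbf{v})^{st}=\mathrm{Rep}(Q,\mathbf{v})^{\alpha\text{-}st}/G_{\mathbf{v}}^{\mathbb{C}}$ with the quotient topology (this is the moduli space of non-degenerate $n$-sided polygons in $\mathbb{R}^3$ with sidelengths $s_j=-\alpha_j$).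 A subset $J\subset\{1,\dots,n\}$ is strictly short if $-\sum_{j\in J}\alpha_j<-\sum_{j\notin J}\alpha_j$. For a positive integer $\ell$, $\alpha$ is $\ell$-strictly short if every subset $J\subset\{1,\dots,n\}$ with $\ell$ elements is strictly short. Here $\pi_0=0$ means path-connected, and for $j=1$ the isomorphism is a bijection of pointed sets. *)

(* Defs.v *)
From HB Require Import structures.
From mathcomp Require Import all_boot all_order all_algebra.
From mathcomp Require Import finmap complex spectral ring lra.
From mathcomp Require Import all_classical all_reals all_analysis.

Set Implicit Arguments.
Unset Strict Implicit.
Unset Printing Implicit Defensive.

Import Order.TTheory GRing.Theory Num.Theory.
Import numFieldNormedType.Exports.

Local Open Scope classical_set_scope.
Local Open Scope ring_scope.
Local Open Scope quotient_scope.

(* R[i] has the topology of its norm, i.e. that of R^2. *)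
HB.instance Definition _ (R : rcfType) := NormedModule.copy R[i] (R[i]^o).

Lemma within_comp (S T U : topologicalType) (A : set S) (B : set T)
    (p : S -> T) (g : T -> U) :
  continuous p -> (forall x, A x -> B (p x)) ->
  {within B, continuous g} -> {within A, continuous (g \o p)}.
Proof.
move=> cp AB /subspace_continuousP cg; apply/subspace_continuousP => x Ax W gW.
have := cg _ (AB _ Ax) W gW; rewrite /= /nbhs /= /within /= => cgW.
have := cp x _ cgW; rewrite /= /nbhs /=.
by apply: filterS => y /= By Ay; apply: By; exact: AB.
Qed.

Lemma continuous_pairing (S T U : topologicalType) (f : S -> T) (g : S -> U) :
  continuous f -> continuous g -> continuous (fun z => (f z, g z)).
Proof. by move=> cf cg z; apply: cvg_pair; [exact: cf|exact: cg]. Qed.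

Section Glue.
Context (R : realType) (S U : topologicalType) (D : set S) (p : S -> R) (c : R).

Definition glue (f g : S -> U) (z : S) := if p z <= c then f z else g z.

Lemma glue_continuous (f g : S -> U) :
  closed D -> continuous p ->
  {within D `&` [set z | p z <= c], continuous f} ->
  {within D `&` [set z | c <= p z], continuous g} ->
  (forall z, D z -> p z = c -> f z = g z) ->
  {within D, continuous (glue f g)}.
Proof.
move=> cD cp cf cg fg.
have -> : D = (D `&` [set z | p z <= c]) `|` (D `&` [set z | c <= p z]).
  rewrite -setIUr; apply/esym/setIidPl => z _ /=.
  by case: (lerP (p z) c) => [|/ltW]; [left|right].
apply: withinU_continuous.
- apply: closedI => //.
  by apply: (closed_comp (f := p) (D := [set u | u <= c])) => //; exact: closed_le.
- apply: closedI => //.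
  by apply: (closed_comp (f := p) (D := [set u | c <= u])) => //; exact: closed_ge.
- apply: subspace_eq_continuous cf => z; rewrite inE => -[_ /= pz].
  by rewrite /from_subspace /glue pz.
- apply: subspace_eq_continuous cg => z; rewrite inE => -[Dz /= pz].
  rewrite /from_subspace /glue; case: ifPn => // pz'.
  by rewrite fg//; apply/eqP; rewrite eq_le pz pz'.
Qed.

End Glue.

(* The set pi_n(X, x) is the set of homotopy classes, relative to the boundary,
  of maps of pairs from the n-cube and its boundary to (X, x).  A map on the
  cube is a total function on 'rV_n of which only the values on the cube
  matter.  For n = 0 the cube is a point with empty boundary, so that
  pi_0(X, x) is the set of path components of X, pointed by that of x. *)

Definition cube (R : realType) (n : nat) : set 'rV[R]_n :=
  [set t | forall i, 0 <= t ord0 i <= 1].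
Arguments cube : clear implicits.

Definition cube_boundary (R : realType) (n : nat) : set 'rV[R]_n :=
  [set t | cube R n t /\ exists i, t ord0 i = 0 \/ t ord0 i = 1].
Arguments cube_boundary : clear implicits.

Definition cylinder (R : realType) (n : nat) : set (R * 'rV[R]_n) :=
  [set st | 0 <= st.1 <= 1 /\ cube R n st.2].
Arguments cylinder : clear implicits.

Record spheroid (R : realType) (n : nat) (X : topologicalType) (x : X) :=
  Spheroid {
    spheroid_fun :> 'rV[R]_n -> X;
    spheroid_continuous : {within cube R n, continuous spheroid_fun};
    spheroid_boundary : forall t, cube_boundary R n t -> spheroid_fun t = x
  }.
Arguments spheroid R n X x : clear implicits.

HB.instance Definition _ (R : realType) n (X : topologicalType) (x : X) :=
  gen_eqMixin (spheroid R n X x).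
HB.instance Definition _ (R : realType) n (X : topologicalType) (x : X) :=
  gen_choiceMixin (spheroid R n X x).

Definition homotopic (R : realType) (n : nat) (X : topologicalType) (x : X)
    (f g : spheroid R n X x) : Prop :=
  exists H : R * 'rV[R]_n -> X,
    [/\ {within cylinder R n, continuous H},
        forall t, cube R n t -> H (0, t) = f t,
        forall t, cube R n t -> H (1, t) = g t &
        forall s t, 0 <= s <= 1 -> cube_boundary R n t -> H (s, t) = x].

Section CubeTopology.
Context (R : realType).

Lemma continuous_row (S : topologicalType) n (p : S -> 'rV[R]_n) :
  (forall i, continuous (fun z => p z ord0 i)) -> continuous p.
Proof.
move=> cp z W [P PW WP].
suff : nbhs z (\bigcap_(i in [set k | k \in [fset k in 'I_n]%fset])
    [set y | P ord0 i (p y ord0 i)]).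
  rewrite /nbhs /=; apply: filterS => y Py; apply: WP => i j /=.
  by rewrite ord1; apply: Py; rewrite /= !inE.
by apply: filter_bigI => i _; apply: (cp i z); exact: PW.
Qed.

Lemma closed_cube n : closed (cube R n).
Proof.
have -> : cube R n = \bigcap_(i in [set: 'I_n])
    ([set t | 0 <= t ord0 i] `&` [set t | t ord0 i <= 1]).
  by apply/seteqP; split=> t /= ct i; [move=> _; apply/andP/ct|apply/andP/ct].
apply: closed_bigI => i _; apply: closedI.
  apply: (closed_comp (f := fun t : 'rV[R]_n => t ord0 i)
    (D := [set u | 0 <= u])); last exact: closed_ge.
  by move=> t _; exact: coord_continuous.
apply: (closed_comp (f := fun t : 'rV[R]_n => t ord0 i)
  (D := [set u | u <= 1])); last exact: closed_le.
by move=> t _; exact: coord_continuous.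
Qed.

Lemma closed_cylinder n : closed (cylinder R n).
Proof.
have -> : cylinder R n = ([set st | 0 <= st.1] `&` [set st | st.1 <= 1])
    `&` (snd @^-1` cube R n).
  apply/seteqP; split=> -[s t] /=; first by move=> [/andP[s0 s1] ct].
  by move=> [[/= s0 s1] ct]; split=> //; apply/andP.
apply: closedI; first apply: closedI.
- apply: (closed_comp (f := fst) (D := [set u : R | 0 <= u])).
    by move=> t _; exact: cvg_fst.
  exact: closed_ge.
- apply: (closed_comp (f := fst) (D := [set u : R | u <= 1])).
    by move=> t _; exact: cvg_fst.
  exact: closed_le.
- apply: (closed_comp (f := snd)); last exact: closed_cube.
  by move=> t _; exact: cvg_snd.
Qed.

End CubeTopology.

Section HomotopyRelation.
Context (R : realType) (n : nat) (X : topologicalType) (x : X).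
Implicit Types f g h : spheroid R n X x.

Lemma homotopic_ext f g :
  (forall t, cube R n t -> f t = g t) -> homotopic f g.
Proof.
move=> fg; exists (fun st => f st.2); split=> //.
- apply: (within_comp (p := snd) (B := cube R n)) => [|[s t] []//|].
    by move=> ?; exact: cvg_snd.
  exact: spheroid_continuous.
- by move=> s t _ /spheroid_boundary.
Qed.

Lemma homotopic_refl f : homotopic f f.
Proof. exact: homotopic_ext. Qed.

Lemma homotopic_sym f g : homotopic f g -> homotopic g f.
Proof.
move=> [H [cH H0 H1 Hb]].
exists (H \o (fun st => (1 - st.1, st.2))); split.
- apply: within_comp cH; last first.
    by move=> [s t] [/= s01 ?]; split=> //=; lra.
  apply: continuous_pairing => st; last exact: cvg_snd.
  by apply: cvgB; [exact: cvg_cst|exact: cvg_fst].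
- by move=> t ct; rewrite /= subr0 H1.
- by move=> t ct; rewrite /= subrr H0.
- by move=> s t s01 bt /=; apply: Hb => //; lra.
Qed.

Lemma homotopic_trans f g h : homotopic f g -> homotopic g h -> homotopic f h.
Proof.
move=> [H [cH H0 H1 Hb]] [K [cK K0 K1 Kb]].
exists (glue fst 2^-1 (H \o (fun st => (2 * st.1, st.2)))
                      (K \o (fun st => (2 * st.1 - 1, st.2)))); split.
- apply: glue_continuous; first exact: closed_cylinder.
  + by move=> ?; exact: cvg_fst.
  + apply: within_comp cH; last first.
      by move=> [s t] [[/= s01 ct] sc]; split=> //=; lra.
    apply: continuous_pairing => st; last exact: cvg_snd.
    by apply: cvgM; [exact: cvg_cst|exact: cvg_fst].
  + apply: within_comp cK; last first.
      by move=> [s t] [[/= s01 ct] sc]; split=> //=; lra.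
    apply: continuous_pairing => st; last exact: cvg_snd.
    apply: cvgB; last exact: cvg_cst.
    by apply: cvgM; [exact: cvg_cst|exact: cvg_fst].
  + move=> [s t] [_ ct] /= ->.
    by rewrite mulfV ?pnatr_eq0// subrr H1 ?K0.
- move=> t ct; rewrite /glue/= ifT ?mulr0 ?H0//; lra.
- move=> t ct; rewrite /glue/= ifF; last by apply/negbTE; lra.
  by rewrite (_ : 2 * 1 - 1 = 1) ?K1//; lra.
- move=> s t s01 bt; rewrite /glue/=; case: ifPn => sc.
    by apply: Hb => //; lra.
  by apply: Kb => //; move: sc; rewrite -ltNge; lra.
Qed.

Definition homotopicb f g : bool := `[< homotopic f g >].

Fact homotopicb_equiv : equiv_class_of homotopicb.
Proof.
split.
- by move=> f; apply/asboolP; exact: homotopic_refl.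
- move=> f g; apply/idP/idP => /asboolP fg; apply/asboolP; exact: homotopic_sym.
- move=> g f h /asboolP fg /asboolP gh; apply/asboolP.
  exact: homotopic_trans fg gh.
Qed.

Canonical homotopic_rel := EquivRelPack homotopicb_equiv.

Definition homotopy_group := {eq_quot homotopic_rel}.
HB.instance Definition _ := Quotient.on homotopy_group.
HB.instance Definition _ := Choice.on homotopy_group.

Lemma eq_homotopy_class f g :
  \pi_homotopy_group f = \pi_homotopy_group g <-> homotopic f g.
Proof. by split=> [/eqmodP/asboolP//|fg]; apply/eqmodP/asboolP. Qed.

Fact cst_spheroid_continuous :
  {within cube R n, continuous (fun=> x : X)}.
Proof. by apply: continuous_subspaceT; exact: cst_continuous. Qed.

Definition cst_spheroid : spheroid R n X x :=
  Spheroid cst_spheroid_continuous (fun _ _ => erefl).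

Definition homotopy_one : homotopy_group := \pi_homotopy_group cst_spheroid.

End HomotopyRelation.
Arguments homotopy_group R n X x : clear implicits.
Arguments homotopy_one {R n X x}.

Section HomotopyProduct.
Context (R : realType) (n : nat) (X : topologicalType) (x : X).
Implicit Types f g : spheroid R n.+1 X x.

(* (t_0, t_1, ..., t_n) is sent to (2 t_0 - b, t_1, ..., t_n). *)
Definition double (b : R) (t : 'rV[R]_n.+1) : 'rV[R]_n.+1 :=
  \row_i (if i == ord0 then 2 * t ord0 ord0 - b else t ord0 i).

Lemma double_continuous b : continuous (double b).
Proof.
apply: continuous_row => i; case: (altP (i =P ord0)) => [->|i0].
  have -> : (fun t => double b t ord0 ord0) = (fun t => 2 * t ord0 ord0 - b).
    by apply/funext => t; rewrite mxE eqxx.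
  move=> t; apply: (continuous_comp (f := fun t : 'rV[R]_n.+1 => t ord0 ord0)
    (g := fun u => 2 * u - b)); first exact: coord_continuous.
  apply: cvgB; last exact: cvg_cst.
  by apply: cvgM; [exact: cvg_cst|exact: cvg_id].
have -> : (fun t => double b t ord0 i) = (fun t => t ord0 i).
  by apply/funext => t; rewrite mxE (negbTE i0).
exact: coord_continuous.
Qed.

Lemma double_cube b t :
  cube R n.+1 t -> 0 <= 2 * t ord0 ord0 - b <= 1 -> cube R n.+1 (double b t).
Proof. by move=> ct tb i; rewrite mxE; case: ifP. Qed.

Lemma double_boundary b t : b = 0 \/ b = 1 ->
  cube_boundary R n.+1 t -> 0 <= 2 * t ord0 ord0 - b <= 1 ->
  cube_boundary R n.+1 (double b t).
Proof.
move=> b01 [ct [i ti]] tb; split; first exact: double_cube.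
case: (altP (i =P ord0)) ti => [->|i0] ti; [exists ord0|exists i].
- rewrite mxE eqxx; case: b01 tb => ->; case: ti => ->; lra.
- by rewrite mxE (negbTE i0).
Qed.

Lemma double_face b t : cube R n.+1 t ->
  2 * t ord0 ord0 - b = 0 \/ 2 * t ord0 ord0 - b = 1 ->
  cube_boundary R n.+1 (double b t).
Proof.
move=> ct tb; split; last by exists ord0; rewrite mxE eqxx.
by apply: double_cube => //; case: tb => ->; rewrite ?lexx ler01.
Qed.

Definition concat_fun (f g : 'rV[R]_n.+1 -> X) : 'rV[R]_n.+1 -> X :=
  glue (fun t : 'rV[R]_n.+1 => t ord0 ord0) 2^-1 (f \o double 0) (g \o double 1).

Fact concat_continuous f g : {within cube R n.+1, continuous (concat_fun f g)}.
Proof.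
apply: glue_continuous; first exact: closed_cube.
- exact: coord_continuous.
- apply: (within_comp (B := cube R n.+1) (p := double 0) (g := f)).
  + exact: double_continuous.
  + move=> t [ct /= tc]; apply: double_cube => //.
    by move: (ct ord0); lra.
  + exact: spheroid_continuous.
- apply: (within_comp (B := cube R n.+1) (p := double 1) (g := g)).
  + exact: double_continuous.
  + move=> t [ct /= tc]; apply: double_cube => //.
    by move: (ct ord0); lra.
  + exact: spheroid_continuous.
- move=> t ct tc /=; rewrite !spheroid_boundary//; apply: double_face => //.
  + by left; rewrite tc; lra.
  + by right; rewrite tc; lra.
Qed.

Fact concat_boundary f g t :
  cube_boundary R n.+1 t -> concat_fun f g t = x.
Proof.
move=> bt; have [ct _] := bt; have := ct ord0.
rewrite /concat_fun /glue; case: ifPn => /= tc t01;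
  apply/spheroid_boundary/double_boundary => //; [by left|lra|by right|].
by move: tc; rewrite -ltNge; lra.
Qed.

Definition concat f g : spheroid R n.+1 X x :=
  Spheroid (@concat_continuous f g) (@concat_boundary f g).

Lemma concat_homotopic f f' g g' :
  homotopic f f' -> homotopic g g' -> homotopic (concat f g) (concat f' g').
Proof.
move=> [H [cH H0 H1 Hb]] [K [cK K0 K1 Kb]].
exists (glue (fun st : R * 'rV[R]_n.+1 => st.2 ord0 ord0) 2^-1
  (H \o (fun st => (st.1, double 0 st.2)))
  (K \o (fun st => (st.1, double 1 st.2)))).
have cd b : continuous (fun st : R * 'rV[R]_n.+1 => (st.1, double b st.2)).
  apply: continuous_pairing => st; first exact: cvg_fst.
  apply: (continuous_comp (f := snd) (g := double b)); first exact: cvg_snd.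
  exact: double_continuous.
split.
- apply: glue_continuous; first exact: closed_cylinder.
  + move=> st; apply: (continuous_comp (f := snd)
      (g := fun t : 'rV[R]_n.+1 => t ord0 ord0)); first exact: cvg_snd.
    exact: coord_continuous.
  + apply: within_comp cH => // -[s t] [[/= s01 ct] tc]; split=> //=.
    by apply: double_cube => //; move: (ct ord0); lra.
  + apply: within_comp cK => // -[s t] [[/= s01 ct] tc]; split=> //=.
    by apply: double_cube => //; move: (ct ord0); lra.
  + move=> [s t] [/= s01 ct] tc; rewrite Hb ?Kb//.
      by apply: double_face => //; left; rewrite tc; lra.
    by apply: double_face => //; right; rewrite tc; lra.
- move=> t ct; rewrite /= /concat_fun /glue /=; have := ct ord0.
  case: ifPn => tc t01; [rewrite H0//|rewrite K0//]; apply: double_cube => //.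
    by lra.
  by move: tc; rewrite -ltNge; lra.
- move=> t ct; rewrite /= /concat_fun /glue /=; have := ct ord0.
  case: ifPn => tc t01; [rewrite H1//|rewrite K1//]; apply: double_cube => //.
    by lra.
  by move: tc; rewrite -ltNge; lra.
- move=> s t s01 bt; rewrite /glue /=; have [ct _] := bt; have := ct ord0.
  case: ifPn => tc t01; [apply: Hb => //|apply: Kb => //];
    apply: double_boundary => //; [by left|lra|by right|].
  by move: tc; rewrite -ltNge; lra.
Qed.

Definition homotopy_mul (a b : homotopy_group R n.+1 X x) :
    homotopy_group R n.+1 X x :=
  \pi_(homotopy_group R n.+1 X x) (concat (repr a) (repr b)).

Lemma homotopy_mulE f g :
  homotopy_mul (\pi f) (\pi g) = \pi_(homotopy_group R n.+1 X x) (concat f g).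
Proof.
apply/eq_homotopy_class/concat_homotopic.
  by apply/eq_homotopy_class; rewrite reprK.
by apply/eq_homotopy_class; rewrite reprK.
Qed.

End HomotopyProduct.

Section HomotopyStatements.
Context (R : realType).

Definition path_connected (X : topologicalType) : Prop :=
  [set: X] !=set0 /\
  forall x y : X, exists p : R -> X,
    [/\ {within `[0, 1]%classic, continuous p}, p 0 = x & p 1 = y].

Definition homotopy_group_trivial (n : nat) (X : topologicalType) : Prop :=
  if n is 0 then path_connected X
  else forall (x : X) (a : homotopy_group R n X x), a = homotopy_one.

End HomotopyStatements.

(* The vertices 0, 1, ..., n are the elements of 'I_n.+1; the outer vertices
  are indexed by 'I_n through [outer].  The spaces attached to the vertices are
  the column spaces 'cV_2 (central vertex) and 'cV_1 (outer vertices). *)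

Definition outer (n : nat) (j : 'I_n) : 'I_n.+1 := lift ord0 j.

Definition quiver_rep (R : realType) (n : nat) := {ptws 'I_n -> 'M[R[i]]_(2, 1)}.

Definition dim_vector (n : nat) := {ffun 'I_n.+1 -> nat}.

Definition star_dim (d0 : nat) (n : nat) (d : 'I_n -> nat) : dim_vector n :=
  [ffun k => if unlift ord0 k is Some j then d j else d0].

(* The dimension vector v = (2, 1, ..., 1). *)
Definition full_dim (n : nat) : dim_vector n := star_dim 2 (fun _ : 'I_n => 1%N).

Definition subrepresentation (R : realType) (n : nat) (A : quiver_rep R n)
    (W0 : {vspace 'cV[R[i]]_2}) (W : 'I_n -> {vspace 'cV[R[i]]_1}) : Prop :=
  forall (j : 'I_n) (w : 'cV[R[i]]_1), w \in W j -> A j *m w \in W0.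

Definition slope (R : realType) (n : nat) (alpha : 'I_n.+1 -> R)
    (v : dim_vector n) : R :=
  (\sum_k - alpha k * (v k)%:R) / (\sum_k v k)%N%:R.

Definition stable (R : realType) (n : nat) (alpha : 'I_n.+1 -> R)
    : set (quiver_rep R n) :=
  [set A | forall W0 W, subrepresentation A W0 W ->
    let v' := star_dim (\dim W0) (fun j => \dim (W j)) in
    v' != [ffun=> 0%N] -> v' != full_dim n ->
    slope alpha v' < slope alpha (full_dim n)].

Definition stable_rep (R : realType) (n : nat) (alpha : 'I_n.+1 -> R) :=
  set_type (stable alpha).
HB.instance Definition _ (R : realType) n (alpha : 'I_n.+1 -> R) :=
  Topological.on (stable_rep alpha).

(* B = g . A for some g = (g_0, ..., g_n) in GL(2) x GL(1)^n. *)
Definition gauge_equiv (R : realType) (n : nat) (A B : quiver_rep R n) : Prop :=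
  exists (g0 : 'M[R[i]]_2) (g : 'I_n -> 'M[R[i]]_1),
    [/\ g0 \in unitmx, forall j, g j \in unitmx &
        forall j, B j = g0 *m A j *m invmx (g j)].

Section ModuliSpace.
Context (R : realType) (n : nat) (alpha : 'I_n.+1 -> R).

Definition same_orbit (A B : stable_rep alpha) : bool :=
  `[< gauge_equiv (val A) (val B) >].

Fact same_orbit_equiv : equiv_class_of same_orbit.
Proof.
have symP (A B : quiver_rep R n) : gauge_equiv A B -> gauge_equiv B A.
  move=> [g0 [g [Ug0 Ug AB]]]; exists (invmx g0), (fun j => invmx (g j)).
  split=> [|j|j]; rewrite ?unitmx_inv// AB invmxK !mulmxA mulVmx// mul1mx.
  by rewrite mulmxKV.
split.
- move=> A; apply/asboolP; exists 1%:M, (fun=> 1%:M).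
  by split=> [|j|j]; rewrite ?unitmx1// invmx1 mulmx1 mul1mx.
- by move=> A B; apply/idP/idP => /asboolP AB; apply/asboolP; exact: symP.
- move=> B A C /asboolP[g0 [g [Ug0 Ug AB]]] /asboolP[h0 [h [Uh0 Uh BC]]].
  apply/asboolP; exists (h0 *m g0), (fun j => h j *m g j).
  split=> [|j|j]; rewrite ?unitmx_mul ?Ug0 ?Uh0 ?Ug ?Uh// BC AB.
  have -> : invmx (h j *m g j) = invmx (g j) *m invmx (h j).
    exact: (invrM (Uh j) (Ug j)).
  by rewrite !mulmxA.
Qed.

Canonical same_orbit_rel := EquivRelPack same_orbit_equiv.

Definition moduli_space := quotient_topology {eq_quot same_orbit_rel}.
HB.instance Definition _ := Topological.on moduli_space.

End ModuliSpace.

Definition unitary_group (R : realType) (m : nat) : set 'M[R[i]]_m :=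
  [set M | M \is unitarymx].
Arguments unitary_group : clear implicits.

(* U(2) x U(1)^(n-1) *)
Definition unitary_product (R : realType) (n : nat) : topologicalType :=
  (unitary_group R 2 * {ptws 'I_n.-1 -> unitary_group R 1})%type.

Definition strictly_short (R : realType) (n : nat) (alpha : 'I_n.+1 -> R)
    (J : {set 'I_n}) : Prop :=
  - \sum_(j in J) alpha (outer j) < - \sum_(j | j \notin J) alpha (outer j).

Definition level_strictly_short (R : realType) (n : nat) (alpha : 'I_n.+1 -> R)
    (l : nat) : Prop :=
  forall J : {set 'I_n}, #|J| = l -> strictly_short alpha J.

(* Main.v *)
(* A representation is stable iff all the vectors [A j] are nonzero and no line
  contains the vectors [A j], [j \in J], of a set [J] that is not short. When all
  sets of [l] elements are short, the unstable representations thus lie in the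
  union of the sets where some [A j] vanishes or some [l + 1] vectors are
  collinear, of real codimension 4 and [2 l] respectively. A counting argument on
  fine grids shows that a generic translate of a Lipschitz map defined on a cube
  of smaller dimension avoids this union; hence a map from the boundary of the
  cube of dimension [m <= 3], [m < 2 l], to the stable representations extends to
  the whole cube.

  Modulo scalars, the gauge group acts freely on the stable representations, and
  the group element relating two points of an orbit is a continuous function of
  these points, because determinants of pairs of vectors determine it. This also
  gives local sections of the quotient map, hence lifts of maps defined on cubes.
  The isomorphism is the connecting map of this principal bundle: a lift [F] of a
  spheroid of dimension [d + 1] that is constant on all the faces of the cube but
  one restricts on the last one to a spheroid of dimension [d] in the gauge group,
  which is deformed into the unitary group by Gram-Schmidt. *)
Require Import Defs.
From HB Require Import structures.
From mathcomp Require Import all_boot all_order all_algebra.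
From mathcomp Require Import finmap complex spectral ring lra zify.
From mathcomp Require Import all_classical all_reals all_analysis.

Set Implicit Arguments.
Unset Strict Implicit.
Unset Printing Implicit Defensive.

Import Order.TTheory GRing.Theory Num.Theory.
Import numFieldNormedType.Exports.

Local Open Scope classical_set_scope.
Local Open Scope ring_scope.
Local Open Scope quotient_scope.

(** * Continuity *)

(** Counting needs Lipschitz maps: a merely continuous map may fill more dimensions than its source
    has. A map to be extended keeps its values on the boundary, where they are already stable, and
    is perturbed only inside; a bump function interpolates between the two regimes. Neither an exact
    sequence nor a theory of fibrations is set up. Surjectivity of the connecting map onto the
    homotopy set of degree [d] extends a map from the boundary of a cube of dimension [d + 1], and
    injectivity does so in dimension [d + 2]. The bound [d + 2 <= 3], forced for [l = 2] by both
    codimensions being 4, is what limits the isomorphism to degrees 1 and 2. Lifts are never unique,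
    and every correction of a lift follows one pattern: two maps into the stable representations
    with the same orbits differ by a continuous gauge-valued map, and acting by that map changes the
    lift without changing its projection. Gluing lifts, prescribing values on faces and passing to
    unitary values are all instances. Fixing the scalar at one outer vertex represents the gauge
    group modulo scalars by [GL(2) x GL(1)^(n-1)], which explains the exponent in
    [U(2) x U(1)^(n-1)]. *)

Section MatrixAndFunctionLimits.
Context {T : Type} {F : set_system T} {FF : Filter F}.

Lemma ptws_cvg (I : eqType) (Y : topologicalType) (f : T -> {ptws I -> Y})
    (l : {ptws I -> Y}) :
  (forall i, f x i @[x --> F] --> l i) -> f x @[x --> F] --> l.
Proof.
move=> fl; apply/cvg_sup => i W.
rewrite nbhsE => -[_ [[V oV <-] Vl]] VW; rewrite /nbhs /=.
have := fl i V (open_nbhs_nbhs (conj oV Vl)).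
by rewrite /nbhs /=; apply: filterS => x Vx; exact: VW.
Qed.

Lemma mx_cvg (Y : topologicalType) m n (f : T -> 'M[Y]_(m, n)) (l : 'M[Y]_(m, n)) :
  (forall i j, f x i j @[x --> F] --> l i j) -> f x @[x --> F] --> l.
Proof.
move=> fl W [P PW WP].
suff : F (\bigcap_(k in [set k | k \in [fset k in {: 'I_m * 'I_n}]%fset])
    [set y | P k.1 k.2 (f y k.1 k.2)]).
  rewrite /nbhs /=; apply: filterS => y Py; apply: WP => i j /=.
  by apply: (Py (i, j)); rewrite /= !inE.
by apply: filter_bigI => k _; apply: (fl k.1 k.2); exact: PW.
Qed.

End MatrixAndFunctionLimits.

Section ContinuityToolkit.
Context {X : topologicalType}.

Lemma ptws_continuous (I : eqType) (Y : topologicalType) (f : X -> {ptws I -> Y}) :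
  (forall i, continuous (fun x => f x i)) -> continuous f.
Proof.
by move=> cf x; apply: ptws_cvg => i; exact: cf.
Qed.

Lemma ptws_coord_continuous (I : eqType) (Y : topologicalType)
    (f : X -> {ptws I -> Y}) i :
  continuous f -> continuous (fun x => f x i).
Proof.
move=> cf x; apply: (continuous_comp (f := f) (g := fun M => M i)).
  exact: cf.
exact: proj_continuous.
Qed.

Lemma mx_continuous (Y : topologicalType) m n (f : X -> 'M[Y]_(m, n)) :
  (forall i j, continuous (fun x => f x i j)) -> continuous f.
Proof.
by move=> cf x; apply: mx_cvg => i j; exact: cf.
Qed.

Lemma mx_coord_continuous (K : numFieldType) m n (f : X -> 'M[K]_(m, n)) i j :
  continuous f -> continuous (fun x => f x i j).
Proof.
move=> cf x; apply: (continuous_comp (f := f) (g := fun M => M i j)).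
  exact: cf.
exact: coord_continuous.
Qed.

Lemma set_type_continuous (Y : topologicalType) (A : set Y) (f : X -> A) :
  continuous (fun x => val (f x)) -> continuous f.
Proof. exact: continuous_comp_initial. Qed.

Lemma val_continuous (Y : topologicalType) (A : set Y) (f : X -> A) :
  continuous f -> continuous (fun x => val (f x)).
Proof.
move=> cf x; apply: (continuous_comp (f := f) (g := val)); first exact: cf.
exact: (@initial_continuous _ _ (val : A -> Y)).
Qed.

Lemma mulr_fun_continuous (K : numFieldType) (f g : X -> K) :
  continuous f -> continuous g -> continuous (fun x => f x * g x).
Proof. by move=> cf cg x; apply: cvgM; [exact: cf|exact: cg]. Qed.

Lemma invr_fun_continuous (K : numFieldType) (f : X -> K) :
  (forall x, f x != 0) -> continuous f -> continuous (fun x => (f x)^-1).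
Proof. by move=> f0 cf x; apply: cvgV; [exact: f0|exact: cf]. Qed.

Lemma addr_fun_continuous (K : numFieldType) (V : normedModType K) (f g : X -> V) :
  continuous f -> continuous g -> continuous (fun x => f x + g x).
Proof. by move=> cf cg x; apply: cvgD; [exact: cf|exact: cg]. Qed.

Lemma subr_fun_continuous (K : numFieldType) (V : normedModType K) (f g : X -> V) :
  continuous f -> continuous g -> continuous (fun x => f x - g x).
Proof. by move=> cf cg x; apply: cvgB; [exact: cf|exact: cg]. Qed.

Lemma scaler_fun_continuous (K : numFieldType) (V : normedModType K)
    (c : X -> K) (f : X -> V) :
  continuous c -> continuous f -> continuous (fun x => c x *: f x).
Proof. by move=> cc cf x; apply: cvgZ; [exact: cc|exact: cf]. Qed.

Context {R : realType}.
Local Open Scope complex_scope.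

Lemma Re_continuous (f : X -> R[i]) : continuous f ->
  continuous (fun x => complex.Re (f x) : R).
Proof.
move=> cf x; have := cf x => /cvgrPdist_lt H; apply/cvgrPdist_lt => e e0.
have := H e%:C; rewrite ltcR => /(_ e0); apply: filterS => y.
rewrite -ltcR; apply: le_lt_trans.
rewrite -raddfB; case: (f x - f y) => a b /=.
by rewrite normc_def lecR /= -sqrtr_sqr ler_sqrt ?lerDl ?sqr_ge0// addr_ge0 ?sqr_ge0.
Qed.

Lemma Im_continuous (f : X -> R[i]) : continuous f ->
  continuous (fun x => complex.Im (f x) : R).
Proof.
move=> cf x; have := cf x => /cvgrPdist_lt H; apply/cvgrPdist_lt => e e0.
have := H e%:C; rewrite ltcR => /(_ e0); apply: filterS => y.
rewrite -ltcR; apply: le_lt_trans.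
rewrite -raddfB; case: (f x - f y) => a b /=.
by rewrite normc_def lecR /= -sqrtr_sqr ler_sqrt ?lerDr ?sqr_ge0// addr_ge0 ?sqr_ge0.
Qed.

Lemma Complex_continuous (f g : X -> R) : continuous f -> continuous g ->
  continuous (fun x => f x +i* g x : R[i]).
Proof.
(* The radius is an element of [R[i]]; being positive forces its imaginary part to vanish, so it is
   a real number. *)
move=> cf cg x; apply/cvgrPdist_lt => -[e e'] /[dup]; rewrite {1}ltcE /= => /andP[/eqP -> e0] _.
have /cvgrPdist_lt Hf := cf x; have /cvgrPdist_lt Hg := cg x.
have e20 : 0 < e / 2 by rewrite divr_gt0.
near=> y.
have -> : (f x +i* g x) - (f y +i* g y) = (f x - f y) +i* (g x - g y) by simpc.
rewrite normc_def ltcR /=; apply: (@le_lt_trans _ _ (`|f x - f y| + `|g x - g y|)).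
  rewrite -[leRHS]ger0_norm ?addr_ge0// -sqrtr_sqr ler_sqrt ?sqr_ge0//.
  rewrite -(real_normK (num_real (f x - f y))) -(real_normK (num_real (g x - g y))) [leRHS]sqrrD.
  by have := mulr_ge0 (normr_ge0 (f x - f y)) (normr_ge0 (g x - g y)); lra.
have h1 : `|f x - f y| < e / 2 by near: y; exact: Hf.
have h2 : `|g x - g y| < e / 2 by near: y; exact: Hg.
lra.
Unshelve. all: by end_near. Qed.

Lemma conjc_continuous (f : X -> R[i]) : continuous f ->
  continuous (fun x => (f x)^*).
Proof.
move=> cf.
have -> : (fun x => (f x)^*) = fun x => complex.Re (f x) +i* (- complex.Im (f x)).
  by apply/funext => x; case: (f x).
apply: Complex_continuous; first exact: Re_continuous.
by move=> x; apply: cvgN; exact: Im_continuous.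
Qed.

Lemma if_continuous (Y : topologicalType) (p : X -> R) (c : R) (f g : X -> Y) :
  continuous p -> continuous f -> continuous g ->
  (forall z, p z = c -> f z = g z) ->
  continuous (fun z => if p z <= c then f z else g z).
Proof.
move=> cp cf cg fg; apply/continuous_subspace_setT.
apply: (@glue_continuous R X Y setT p c f g).
- exact: closedT.
- exact: cp.
- exact: continuous_subspaceT.
- exact: continuous_subspaceT.
- by move=> z _; exact: fg.
Qed.

Lemma maxr_continuous (f g : X -> R) : continuous f -> continuous g ->
  continuous (fun x => Num.max (f x) (g x)).
Proof. by move=> cf cg; exact: (max_fun_continuous cf cg). Qed.

Lemma minr_continuous (f g : X -> R) : continuous f -> continuous g ->
  continuous (fun x => Num.min (f x) (g x)).
Proof. by move=> cf cg; exact: (min_fun_continuous cf cg). Qed.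

End ContinuityToolkit.

(** * General position by counting *)

(** The pair formed by the code and the coordinates outside [S] determines an element of [B]; the
    bound is the number of such pairs. *)
Lemma card_code_le (K Q : finType) (M N : nat) (S : {set K})
    (B : {set {ffun K -> 'I_M}}) (code : {ffun K -> 'I_M} -> {ffun Q -> 'I_N}) :
  {in B &, forall f g, code f = code g -> (forall k, k \notin S -> f k = g k) ->
    f = g} ->
  (#|B| <= N ^ #|Q| * M ^ (#|K| - #|S|))%N.
Proof.
move=> inj; pose K' := {k : K | k \notin S}.
pose F f := (code f, [ffun k : K' => f (val k)]).
have injF : {in B &, injective F}.
  move=> f g fB gB [cfg /ffunP fg]; apply: inj => // k kS.
  by have := fg (Sub k kS); rewrite !ffunE.
rewrite -(card_in_imset injF) (leq_trans (max_card _))// card_prod !card_ffun !card_ord.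
rewrite card_sig (_ : #|_| = #|~: S|); last by apply: eq_card => k; rewrite !inE.
by rewrite cardsCs finset.setCK.
Qed.

Section GeneralPosition.
Context (R : realType).

(** The cells are the closed intervals from [k / (N + 1)] to [(k + 1) / (N + 1)]. They overlap at
    endpoints, so one of them is picked for each point. *)
Lemma unit_cells (N : nat) : exists cell : R -> 'I_N.+1,
  forall x y, 0 <= x <= 1 -> 0 <= y <= 1 -> cell x = cell y ->
    `|x - y| <= N.+1%:R^-1.
Proof.
have cellP (x : R) : 0 <= x <= 1 ->
    exists k : 'I_N.+1, k%:R <= N.+1%:R * x <= k.+1%:R.
  move=> /andP[x0 x1]; have Nx0 : 0 <= N.+1%:R * x by rewrite mulr_ge0.
  have /andP[tl tu] := truncn_itv Nx0.
  have [tN|tN] := ltnP (Num.truncn (N.+1%:R * x)) N.+1.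
    by exists (Ordinal tN) => /=; rewrite tl ltW.
  have Nx : N.+1%:R * x <= N.+1%:R by rewrite ler_piMr.
  (* Only the right end [x = 1] gets here; it is put into the last cell. *)
  exists ord_max; rewrite /= Nx andbT (le_trans _ tl)// ler_nat.
  exact: leq_trans (leqnSn _) tN.
exists (fun x => odflt ord0 [pick k : 'I_N.+1 | k%:R <= N.+1%:R * x <= k.+1%:R]).
move=> x y /cellP[kx Hx] /cellP[ky Hy].
case: pickP => [k /= Hkx|/(_ kx)]; last by rewrite Hx.
case: pickP => [k' /= Hky|/(_ ky)]; last by rewrite Hy.
move=> kk'; rewrite -{}kk' in Hky.
have N0 : 0 < N.+1%:R :> R by rewrite ltr0n.
rewrite -(ler_pM2l N0) mulfV ?gt_eqF// -[X in X * _](ger0_norm (ltW N0)) -normrM mulrBr.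
by rewrite ler_norml; move: Hkx Hky; rewrite -[k.+1]addn1 natrD; lra.
Qed.

(* The grid of mesh [e / M] on the box has [M ^ #|K|] points. If all of them are
  bad, then coding a bad point by its family, the cell of its parameters in a
  grid of mesh [1 / (c M)], and its coordinates outside [S] shows that
  [M ^ #|K| <= C' * M ^ (#|K| - 1)], which fails for large [M]. *)
Lemma general_position (K T : finType) (Q : T -> finType) (S : T -> {set K})
    (bad : forall t, (Q t -> R) -> (K -> R) -> Prop) (C e : R) :
  0 < e <= 1 ->
  (forall t, #|Q t| < #|S t|)%N ->
  (forall t w w' p p' d, 0 <= d -> bad t w p -> bad t w' p' ->
     (forall q, 0 <= w q <= 1) -> (forall q, 0 <= w' q <= 1) ->
     (forall k, `|p k| <= 1) -> (forall k, `|p' k| <= 1) ->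
     (forall k, k \notin S t -> p k = p' k) ->
     (forall q, `|w q - w' q| <= d) ->
     forall k, k \in S t -> `|p k - p' k| <= C * d) ->
  exists p : K -> R, (forall k, `|p k| <= e) /\
    forall t w, (forall q, 0 <= w q <= 1) -> ~ bad t w p.
Proof.
move=> /andP[e0 e1] QS lip; apply: contrapT => allbad.
(* With [C / e < c], two parameters in a common cell of width [1 / (c M)] move the bound coordinates
   by less than the mesh [e / M] of the grid. *)
pose c := (Num.truncn (C / e)).+1.
have cC : C < e * c%:R by rewrite mulrC -ltr_pdivrMr// truncnS_gt.
(* The count ends with [M ^ #|K| * M <= M' * M ^ #|K|], which is false as soon as [M] exceeds
   [M']. *)
pose M' := (\sum_t c ^ #|Q t|)%N; pose M := M'.+1; pose N := (c * M)%N.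
have M0 : 0 < M%:R :> R by rewrite ltr0n.
have N0 : 0 < N%:R :> R by rewrite ltr0n.
pose pt (f : {ffun K -> 'I_M}) (k : K) : R := e * (f k)%:R / M%:R.
have pt_ge0 f k : 0 <= pt f k by rewrite !mulr_ge0// ?invr_ge0 ltW.
have pt_le f k : `|pt f k| <= e.
  rewrite ger0_norm// ler_pdivrMr// ler_wpM2l ?ltW// ltr_nat; exact: ltn_ord.
have pt_inj f g k : `|pt f k - pt g k| < e / M%:R -> f k = g k.
  rewrite -mulrBl -mulrBr !normrM (gtr0_norm e0) (@gtr0_norm _ M%:R^-1) ?invr_gt0//.
  rewrite ltr_pM2r ?invr_gt0// -[ltRHS]mulr1 ltr_pM2l// => fg.
  apply/val_inj/eqP; rewrite eqn_leq -[(f k <= _)%N]ltnS -[(g k <= _)%N]ltnS -!(ltr_nat R) -!natr1.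
  by move: fg; rewrite ltr_norml; lra.
have [cell cellP] := unit_cells N.-1.
have NE : N.-1.+1 = N by rewrite prednK// muln_gt0.
rewrite NE in cell cellP.
pose bads t : {set {ffun K -> 'I_M}} :=
  [set f | `[< exists w, (forall q, 0 <= w q <= 1) /\ bad t w (pt f) >]]%SET.
have cover : ([set: {ffun K -> 'I_M}] \subset \bigcup_t bads t)%SET.
  apply/fintype.subsetP => f _; apply/finset.bigcupP; apply: contrapT => nf; apply: allbad.
  exists (pt f); split=> // t w w01 btw; apply: nf; exists t => //.
  by rewrite inE; apply/asboolP; exists w.
have card_bads t : (#|bads t| * M <= c ^ #|Q t| * M ^ #|K|)%N.
  (* The default value 0 is taken only at grid points that are not bad. *)
  pose wit f : Q t -> R := xget (fun=> 0) [set w | (forall q, 0 <= w q <= 1) /\ bad t w (pt f)].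
  have witP f : f \in bads t -> (forall q, 0 <= wit f q <= 1) /\ bad t (wit f) (pt f).
    by rewrite inE => /asboolP ex; exact: (xgetPex (fun=> 0) ex).
  pose code f := [ffun q => cell (wit f q)].
  have SK : (#|S t| <= #|K|)%N by exact: max_card.
  have := @card_code_le K (Q t) M N (S t) (bads t) code.
  move=> /(_ _)/leq_trans Hc.
  (* The strict inequality [#|Q t| < #|S t|] provides the extra factor [M]. *)
  have le1 : (c ^ #|Q t| * M ^ #|Q t| * M ^ (#|K| - #|S t|) * M <= c ^ #|Q t| * M ^ #|K|)%N.
    rewrite -!mulnA leq_mul2l; apply/orP; right.
    rewrite -expnSr -expnD leq_pexp2l//; move: (QS t) SK; lia.
  apply: leq_trans le1; rewrite leq_mul2r -expnMn; apply/orP; right; apply: Hc => //.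
  move=> f g fB gB /ffunP cfg fgS; apply/ffunP => k.
  have [kS|/fgS//] := boolP (k \in S t).
  have [wf bf] := witP f fB; have [wg bg] := witP g gB.
  have := lip t _ _ _ _ N%:R^-1 _ bf bg wf wg.
  move=> /(_ _ _ _ _ _ k kS) H; apply: pt_inj; apply: (le_lt_trans (H _ _ _ _ _)).
  - by rewrite invr_ge0 ltW.
  - by move=> k'; exact: le_trans (pt_le _ _) e1.
  - by move=> k'; exact: le_trans (pt_le _ _) e1.
  - by move=> k' k'S; rewrite /pt fgS.
  - by move=> q; apply: cellP => //; have := cfg q; rewrite !ffunE.
  by rewrite /N natrM invfM mulrA ltr_pM2r ?invr_gt0// ltr_pdivrMr//.
have : (M ^ #|K| * M <= M' * M ^ #|K|)%N.
  have -> : (M ^ #|K|)%N = #|[set: {ffun K -> 'I_M}]%SET|.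
    by rewrite cardsT card_ffun card_ord.
  apply: (@leq_trans ((\sum_t #|bads t|) * M)%N).
    rewrite leq_mul2r; apply/orP; right; apply: leq_trans (subset_leq_card cover) _.
    elim/big_ind2 : _ => [|A1 n1 A2 n2 h1 h2|//]; first by rewrite cards0.
    by rewrite cardsU (leq_trans (leq_subr _ _))// leq_add.
  rewrite /M' !big_distrl/=; apply: leq_sum => t _; rewrite cardsT card_ffun card_ord.
  exact: card_bads.
have MK : (0 < M ^ #|K|)%N by rewrite expn_gt0.
by rewrite mulnC leq_pmul2r// ltnn.
Qed.

End GeneralPosition.

(** * Lipschitz approximation on the cube *)

Section MatrixNorm.
Context {R : realType} {m n : nat}.
Implicit Types A : 'M[R]_(m, n).

Lemma mx_norm_entry A i j : `|A i j| <= `|A|.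
Proof.
by rewrite [leRHS]/Num.Def.normr /= mx_normrE; apply/bigmax_geP; right => /=; exists (i, j).
Qed.

Lemma mx_norm_le A (e : R) : 0 <= e -> (forall i j, `|A i j| <= e) -> `|A| <= e.
Proof.
by move=> e0 Ae; rewrite [leLHS]/Num.Def.normr /= mx_normrE; apply/bigmax_leP; split.
Qed.

End MatrixNorm.

Section LipschitzApproximation.
Context (R : realType).

Lemma cube_compact m : compact (cube R m).
Proof.
have := @rV_compact R m (fun=> `[0, 1]%classic) (fun=> @segment_compact R 0 1).
congr compact; apply/funext => v; apply/propext; split => /= vi i; have := vi i;
  by rewrite /= in_itv.
Qed.

(** Near a point of the diagonal, continuity gives the bound for every [k >= 0]; near any other
    point [|t - u|] is bounded below, so a large [k] suffices. Compactness of the square of the cube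
    makes [k] uniform. The bound keeps the infimal convolution of [phi] from falling more than [e]
    below [phi]. *)
Lemma coercive_bound m (phi : 'rV[R]_m -> R) (e : R) : continuous phi -> 0 < e ->
  exists k : R, 0 <= k /\
    forall t u, cube R m t -> cube R m u -> phi t - e <= phi u + k * `|t - u|.
Proof.
move=> cphi e0.
have /compact_near_coveringP cov := compact_setX (@cube_compact m) (@cube_compact m).
pose P (k : R) (tu : 'rV[R]_m * 'rV[R]_m) := 0 <= k /\
  phi tu.1 - e <= phi tu.2 + k * `|tu.1 - tu.2|.
have : (pinfty_nbhs R) [set k | cube R m `*` cube R m `<=` P k].
  apply: (cov R (pinfty_nbhs R) P) => -[t0 u0] _.
  have e20 : 0 < e / 2 by rewrite divr_gt0.
  have ct : \forall z \near nbhs (t0, u0), `|phi t0 - phi z.1| < e / 2.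
    have : (fun z : 'rV[R]_m * 'rV[R]_m => phi z.1) @ (t0, u0) --> phi t0.
      by apply: (continuous_comp (f := fst)); [exact: cvg_fst|exact: cphi].
    by move=> /cvgrPdist_lt; apply.
  have cu : \forall z \near nbhs (t0, u0), `|phi u0 - phi z.2| < e / 2.
    have : (fun z : 'rV[R]_m * 'rV[R]_m => phi z.2) @ (t0, u0) --> phi u0.
      by apply: (continuous_comp (f := snd)); [exact: cvg_snd|exact: cphi].
    by move=> /cvgrPdist_lt; apply.
  have [tu|tu] := eqVneq t0 u0.
    rewrite -{}tu in ct cu *.
    exists ([set z | `|phi t0 - phi z.1| < e / 2 /\ `|phi t0 - phi z.2| < e / 2], [set k | 0 <= k]).
      by split=> /=; [exact: filterI|exact: nbhs_pinfty_ge].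
    move=> [[t u] k] /= [[ht hu] k0]; split=> //=.
    have := mulr_ge0 k0 (normr_ge0 (t - u)).
    by move: ht hu; rewrite !ltr_norml; lra.
  pose r := `|t0 - u0|; have r0 : 0 < r by rewrite normr_gt0 subr_eq0.
  have cr : \forall z \near nbhs (t0, u0), r / 2 < `|z.1 - z.2|.
    have : (fun z : 'rV[R]_m * 'rV[R]_m => `|z.1 - z.2|) @ (t0, u0) --> r.
      by apply: cvg_norm; apply: cvgB; [exact: cvg_fst|exact: cvg_snd].
    by move=> /cvgr_gt; apply; rewrite ltr_pdivrMr// ltr_pMr// ltr1n.
  exists ([set z | [/\ `|phi t0 - phi z.1| < e / 2, `|phi u0 - phi z.2| < e / 2 &
      r / 2 < `|z.1 - z.2|]], [set k | 0 <= k /\ `|phi t0 - phi u0| / (r / 2) <= k]).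
    split=> /=; first by apply: filterS (filterI ct (filterI cu cr)) => z [? []]; split.
    apply: filterI; first exact: nbhs_pinfty_ge.
    exact/nbhs_pinfty_ge/num_real.
  move=> [[t u] k] /= [[ht hu hr] [k0 hk]]; split=> //=.
  have : `|phi t0 - phi u0| <= k * `|t - u|.
    rewrite ler_pdivrMr ?divr_gt0// in hk; apply: (le_trans hk).
    by rewrite ler_wpM2l// ltW.
  by have := ler_norm (phi t0 - phi u0); move: ht hu; rewrite !ltr_norml; lra.
move=> /filter_ex[k Pk].
have [k0 _] : P `|k| (0, 0).
  by split; rewrite //= subr0; rewrite normr0 mulr0 addr0 gerBl ltW.
have [km|km] := leP 0 k; last first.
  exists 0; split=> // t u ct cu; have [] := Pk (t, u) (conj ct cu).
  by rewrite leNgt km.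
by exists k; split=> // t u ct cu; have [] := Pk (t, u) (conj ct cu).
Qed.

(* The infimal convolution of [phi] with a large multiple of the norm. *)
Lemma lipschitz_approximation m (phi : 'rV[R]_m -> R) (e : R) :
  continuous phi -> 0 < e ->
  exists (psi : 'rV[R]_m -> R) (C : R),
    [/\ 0 <= C, forall t u, `|psi t - psi u| <= C * `|t - u| &
        forall t, cube R m t -> `|phi t - psi t| <= e].
Proof.
move=> cphi e0; have [k [k0 kP]] := coercive_bound cphi e0.
pose S t := [set phi u + k * `|t - u| | u in cube R m].
have c0 : cube R m 0 by move=> i; rewrite mxE lexx ler01.
have S0 t : S t !=set0 by exists (phi 0 + k * `|t - 0|), 0.
have Slb t : has_lbound (S t).
  exists (phi 0 - e - k * `|t - 0|) => _ [u cu <-].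
  have := kP 0 u c0 cu.
  have : k * `|0 - u| <= k * `|t - 0| + k * `|t - u|.
    by rewrite -mulrDr ler_wpM2l// (distrC t 0) ler_distD.
  lra.
exists (fun t => inf (S t)), k; split=> //.
  have half t u : inf (S t) <= inf (S u) + k * `|t - u|.
    rewrite -lerBlDr; apply: lb_le_inf => // _ [v cv <-].
    rewrite lerBlDr; apply: (@le_trans _ _ (phi v + k * `|t - v|)).
      by apply: ge_inf => //; exists v.
    by rewrite -addrA lerD2l -mulrDr ler_wpM2l// [leRHS]addrC ler_distD.
  move=> t u; rewrite ler_norml; have := half t u; have := half u t.
  by rewrite (distrC u t); lra.
move=> t ct; have le1 : inf (S t) <= phi t.
  by apply: ge_inf => //; exists t => //; rewrite subrr normr0 mulr0 addr0.
have : phi t - e <= inf (S t).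
  by apply: lb_le_inf => // _ [u cu <-]; exact: kP.
by rewrite ler_norml; lra.
Qed.

Lemma lipschitz_continuous (V : normedModType R) (psi : V -> R) (C : R) :
  0 <= C -> (forall t u, `|psi t - psi u| <= C * `|t - u|) -> continuous psi.
Proof.
move=> C0 lip t; apply/cvgrPdist_le => d d0.
(* Dividing by [C + 1] keeps the radius positive when [C = 0]. *)
have dC : 0 < d / (C + 1) by rewrite divr_gt0// ltr_wpDl.
have := nbhsx_ballx t _ dC; rewrite -ball_normE.
apply: filterS => u /= /ltW tu; apply: (le_trans (lip _ _)).
have := ler_wpM2l C0 tu; move=> /le_trans; apply.
by rewrite mulrCA ler_piMr ?(ltW d0)// ler_pdivrMr ?mul1r ?lerDl// ltr_wpDl.
Qed.

Lemma lipschitz_approximation_mx m p q (phi : 'rV[R]_m -> 'M[R]_(p, q)) (e : R) :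
  continuous phi -> 0 < e ->
  exists (psi : 'rV[R]_m -> 'M[R]_(p, q)) (C : R),
    [/\ 0 <= C, continuous psi,
        forall t u i j, `|psi t i j - psi u i j| <= C * `|t - u| &
        forall t, cube R m t -> `|phi t - psi t| <= e].
Proof.
move=> cphi e0.
have : forall ij : 'I_p * 'I_q, exists psiC : ('rV[R]_m -> R) * R,
    [/\ 0 <= psiC.2, forall t u, `|psiC.1 t - psiC.1 u| <= psiC.2 * `|t - u| &
        forall t, cube R m t -> `|phi t ij.1 ij.2 - psiC.1 t| <= e].
  move=> [i j].
  have [psi [C ?]] := lipschitz_approximation (@mx_coord_continuous _ R p q phi i j cphi) e0.
  by exists (psi, C).
move=> /choice[g gP]; pose C := \sum_ij (g ij).2.
have gC ij : (g ij).2 <= C.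
  by rewrite /C (bigD1 ij)//= lerDl sumr_ge0// => k _; have [] := gP k.
have C0 : 0 <= C by rewrite sumr_ge0// => ij _; have [] := gP ij.
have lip ij t u : `|(g ij).1 t - (g ij).1 u| <= C * `|t - u|.
  by have [_ H _] := gP ij; apply: le_trans (H t u) _; rewrite ler_wpM2r.
exists (fun t => \matrix_(i, j) (g (i, j)).1 t), C; split=> //.
- apply: mx_continuous => i j; under eq_fun do rewrite mxE.
  by apply: (lipschitz_continuous C0) => t u; exact: lip.
- by move=> t u i j; rewrite !mxE.
- move=> t ct; apply: mx_norm_le; first exact: ltW.
  by move=> i j; rewrite !mxE; have [_ _] := gP (i, j); apply.
Qed.

End LipschitzApproximation.

(** * Extending maps from the boundary of the cube *)

Section Boxes.
Context {R : realType} {m : nat}.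
Implicit Types a b t : 'rV[R]_m.

Definition box a b : set 'rV[R]_m :=
  [set t | forall i, a ord0 i <= t ord0 i <= b ord0 i].

(** A retraction of the whole space onto a nonempty box. Composing with it turns maps continuous
    within a box into total continuous maps, so that later constructions can avoid subspace
    topologies. *)
Definition box_clamp a b t : 'rV[R]_m :=
  \row_i Num.max (a ord0 i) (Num.min (b ord0 i) (t ord0 i)).

Lemma box_clamp_continuous a b : continuous (box_clamp a b).
Proof.
apply: continuous_row => i; under eq_fun do rewrite mxE.
apply: maxr_continuous; first exact: cst_continuous.
apply: minr_continuous; first exact: cst_continuous.
exact: coord_continuous.
Qed.

Lemma box_clamp_in a b t : (forall i, a ord0 i <= b ord0 i) ->
  box a b (box_clamp a b t).
Proof.
by move=> ab i; rewrite mxE le_max lexx /= ge_max ab ge_min lexx.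
Qed.

Lemma box_clamp_id a b t : box a b t -> box_clamp a b t = t.
Proof.
move=> abt; apply/rowP => i; rewrite mxE; have /andP[at_ tb] := abt i.
by rewrite (min_idPr tb) (max_idPr at_).
Qed.

Definition clamp := box_clamp 0 (const_mx 1).

Lemma clamp_continuous : continuous clamp.
Proof. exact: box_clamp_continuous. Qed.

Lemma clamp_cube t : cube R m (clamp t).
Proof.
by move=> i; have := @box_clamp_in 0 (const_mx 1) t; move=> /(_ _ i);
  rewrite !mxE; apply=> j; rewrite !mxE.
Qed.

Lemma clamp_id t : cube R m t -> clamp t = t.
Proof. by move=> ct; apply: box_clamp_id => i; rewrite !mxE. Qed.

Lemma within_cube_clamp (Y : topologicalType) (f : 'rV[R]_m -> Y) :
  {within cube R m, continuous f} -> continuous (f \o clamp).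
Proof.
move=> cf; apply/continuous_subspace_setT.
by apply: within_comp cf; [exact: clamp_continuous|move=> t _; exact: clamp_cube].
Qed.

(** On the cube this is nonnegative and vanishes exactly on the boundary. For [m = 0] the empty
    product is 1, in accordance with the boundary being empty. *)
Definition bump t : R := \prod_i (t ord0 i * (1 - t ord0 i)).

Lemma bump_continuous : continuous bump.
Proof.
apply: (@continuous_big R 'I_m *%R 1 xpredT) => [|i _].
  exact: mul_continuous.
have ci := @coord_continuous R 1 m ord0 i.
apply: mulr_fun_continuous => //.
by apply: (@subr_fun_continuous _ R R) => //; exact: cst_continuous.
Qed.

Lemma bump_ge0 t : cube R m t -> 0 <= bump t.
Proof.
by move=> ct; apply: prodr_ge0 => i _; have := ct i; move=> /andP[? ?]; rewrite mulr_ge0// subr_ge0.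
Qed.

Lemma bump_boundary t : cube R m t -> bump t = 0 <-> cube_boundary R m t.
Proof.
move=> ct; split.
  move/eqP/prodf_eq0 => [i _]; rewrite mulf_eq0 subr_eq0.
  by move=> /orP[/eqP|/eqP/esym] ti; split=> //; exists i; [left|right].
move=> [_ [i [ti|ti]]]; apply/eqP/prodf_eq0; exists i => //.
  by rewrite ti mul0r.
by rewrite ti subrr mulr0.
Qed.

End Boxes.

Section Extension.
Context {R : realType} {m p q : nat}.
Variables (O : set 'M[R]_(p, q)) (f : 'rV[R]_m -> 'M[R]_(p, q)).

(** At a boundary point the openness of [O] gives a radius valid nearby; at an interior point any
    [e] below half the value of [bump] makes the premise void nearby. Compactness yields a common
    [e]. *)
Lemma boundary_margin : open O -> continuous f ->
  (forall t, cube_boundary R m t -> O (f t)) ->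
  exists2 e : R, 0 < e & forall t, cube R m t -> bump t < e ->
    forall a, `|f t - a| < e -> O a.
Proof.
move=> oO cf fO; have /compact_near_coveringP cov := @cube_compact R m.
pose P (e : R) t := 0 < e /\ (cube R m t -> bump t < e ->
    forall a, `|f t - a| < e -> O a).
have : (0^'+ : set_system R) [set e | cube R m `<=` P e].
  apply: (cov R (0^'+) P) => t0 ct0.
  have [b0|b0] := eqVneq (bump t0) 0.
    have /(proj1 (bump_boundary ct0))/fO Oft0 := b0.
    have /nbhs_ballP[r /= r0 rO] : nbhs (f t0) O by exact: open_nbhs_nbhs.
    have r20 : 0 < r / 2 by rewrite divr_gt0.
    exists ([set t | `|f t0 - f t| < r / 2], [set e | 0 < e < r / 2]).
      split=> /=.
        by have /cvgrPdist_lt := cf t0; apply.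
      by near=> e; apply/andP; split; near: e; [exact: nbhs_right_gt|exact: nbhs_right_lt].
    move=> [t e] /= [ht /andP[e0 er]]; split=> // ct _ a ha.
    apply: rO; rewrite -ball_normE /=.
    by have := ler_distD (f t) (f t0) a; lra.
  have bt0 : 0 < bump t0 by rewrite lt_neqAle eq_sym b0 bump_ge0.
  have r20 : 0 < bump t0 / 2 by rewrite divr_gt0.
  exists ([set t | bump t0 / 2 < bump t], [set e | 0 < e < bump t0 / 2]).
    split=> /=.
      by have /cvgr_gt := @bump_continuous R m t0; apply; lra.
    by near=> e; apply/andP; split; near: e; [exact: nbhs_right_gt|exact: nbhs_right_lt].
  by move=> [t e] /= [ht /andP[e0 er]]; split=> // ct; lra.
(* Positivity of [e] is part of a statement about the points of the cube; the default 1 makes it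
   unconditional. *)
move=> /filter_ex[e Pe]; exists (if 0 < e then e else 1); first by case: ifPn.
move=> t ct; have [e0 H] := Pe t ct.
by rewrite e0; exact: H.
Unshelve. all: by end_near. Qed.

(** The extension is [f + s (psi + a - f)] with [s = min(1, bump / e)]. It is [f] on the boundary
    and the generic map [psi + a] where [bump >= e]; in between it stays within [e] of [f], so
    [boundary_margin] applies. *)
Lemma extension_of_general_position : open O -> continuous f ->
  (forall t, cube_boundary R m t -> O (f t)) ->
  (forall (psi : 'rV[R]_m -> 'M[R]_(p, q)) (C e : R), 0 <= C -> 0 < e ->
    (forall t u i j, `|psi t i j - psi u i j| <= C * `|t - u|) ->
    exists2 a, `|a| <= e & forall t, cube R m t -> O (psi t + a)) ->
  exists F : 'rV[R]_m -> 'M[R]_(p, q),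
    [/\ continuous F, forall t, O (F t) &
        forall t, cube_boundary R m t -> F t = f t].
Proof.
move=> oO cf fO gp; have [e e0 eO] := boundary_margin oO cf fO.
(* One quarter for the approximation and one for the translation keep [psi + a] at distance less
   than [e] from [f]. *)
have e40 : 0 < e / 4 by rewrite divr_gt0.
have [psi [C [C0 cpsi lip psif]]] := lipschitz_approximation_mx cf e40.
have [a ae aO] := gp psi C (e / 4) C0 e40 lip.
pose s (t : 'rV[R]_m) := Num.min 1 (bump t / e).
pose F (t : 'rV[R]_m) := f t + s t *: (psi t + a - f t).
have cs : continuous s.
  apply: minr_continuous; first exact: cst_continuous.
  by apply: mulr_fun_continuous; [exact: bump_continuous|exact: cst_continuous].
have cF : continuous F.
  apply: addr_fun_continuous => //; apply: scaler_fun_continuous => //.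
  apply: subr_fun_continuous => //; apply: addr_fun_continuous => //.
  exact: cst_continuous.
have FO t : cube R m t -> O (F t).
  move=> ct; have [be|be] := leP e (bump t).
    rewrite /F /s (min_idPl _) ?scale1r; first by rewrite addrC subrK; exact: aO.
    by rewrite ler_pdivlMr// mul1r.
  apply: (eO t ct be); rewrite /F opprD addrA subrr sub0r normrN normrZ.
  have s01 : 0 <= s t <= 1.
    by rewrite /s le_min ler01 /= divr_ge0 ?bump_ge0 ?(ltW e0)// ge_min lexx.
  rewrite ger0_norm; last by case/andP: s01.
  have h : `|psi t + a - f t| < e.
    rewrite -addrA addrC addrAC -addrA; have := ler_normD a (psi t - f t).
    by rewrite (distrC (psi t)); have := psif t ct; rewrite addrC; lra.
  apply: le_lt_trans h; rewrite ler_piMl//; by case/andP: s01.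
(* Clamping makes the values lie in [O] at all points, not only on the cube. *)
exists (F \o clamp); split.
- by move=> t; apply: continuous_comp; [exact: clamp_continuous|exact: cF].
- by move=> t; apply: FO; exact: clamp_cube.
- move=> t bt; rewrite /= clamp_id; last by case: bt.
  have [ct _] := bt; rewrite /F /s (proj2 (bump_boundary ct) bt) mul0r.
  by rewrite (min_idPr _)// scale0r addr0.
Qed.

End Extension.

(** * Stability *)

Section Stability.
Context {R : realType} {n : nat}.
Implicit Type A B : quiver_rep R n.

Definition det2 A (i j : 'I_n) : R[i] :=
  A i 0 ord0 * A j 1 ord0 - A i 1 ord0 * A j 0 ord0.

Lemma ord2_cases (a : 'I_2) : a = 0 \/ a = 1.
Proof. by case: a => -[|[|//]] p; [left|right]; exact/val_inj. Qed.

Lemma cV2P (K : Type) (v w : 'M[K]_(2, 1)) :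
  v 0 ord0 = w 0 ord0 -> v 1 ord0 = w 1 ord0 -> v = w.
Proof.
move=> v0 v1; apply/matrixP => a b; rewrite (ord1 b).
by case: a => -[|[|//]] p; [have -> : Ordinal p = 0 by apply/val_inj|
  have -> : Ordinal p = 1 by apply/val_inj].
Qed.

Lemma cV2_neq0 (v : 'cV[R[i]]_2) : v != 0 -> (v 0 ord0 != 0) || (v 1 ord0 != 0).
Proof.
apply: contraR; rewrite negb_or !negbK => /andP[/eqP v0 /eqP v1].
by apply/eqP/cV2P; rewrite mxE.
Qed.

Lemma det2_colinear A i j : A i != 0 -> det2 A i j = 0 ->
  exists c, A j = c *: A i.
Proof.
rewrite /det2 => /cV2_neq0/orP[a0|a0] /eqP; rewrite subr_eq0 => /eqP dA.
  exists (A j 0 ord0 / A i 0 ord0); apply: cV2P; rewrite !mxE; first by rewrite divfK.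
  by rewrite mulrAC [A j 0 _ * _]mulrC -dA mulrAC mulfV// mul1r.
exists (A j 1 ord0 / A i 1 ord0); apply: cV2P; rewrite !mxE; last by rewrite divfK.
by rewrite mulrAC [A j 1 _ * _]mulrC dA mulrAC mulfV// mul1r.
Qed.

Variable alpha : 'I_n.+1 -> R.

(** When [alpha ord0] is half the total of the side lengths [- alpha (outer j)], the inequality says
    that [J] is not strictly short. Collinearity is excluded by a nonzero [det2], a condition that
    is visibly open and transforms by a scalar factor under the group. *)
Definition nondegenerate A := (forall j, A j != 0) /\
  forall J : {set 'I_n}, alpha ord0 <= \sum_(j in J) - alpha (outer j) ->
    exists i j, [/\ i \in J, j \in J & det2 A i j != 0].

Hypothesis n_gt0 : (0 < n)%N.
Hypothesis alpha_lt0 : forall j : 'I_n, alpha (outer j) < 0.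
Hypothesis alpha0E : alpha ord0 = - (2^-1 * \sum_(j < n) alpha (outer j)).

Lemma alpha0_gt0 : 0 < alpha ord0.
Proof.
have : \sum_(j < n) alpha (outer j) < 0.
  rewrite -oppr_gt0 -sumrN (bigD1 (Ordinal n_gt0))//= ltr_pwDl ?oppr_gt0//.
  by apply: sumr_ge0 => j _; rewrite oppr_ge0 ltW.
by rewrite alpha0E; lra.
Qed.

Lemma slope_numE d0 (d : 'I_n -> nat) :
  \sum_k - alpha k * (star_dim d0 d k)%:R =
  - alpha ord0 * d0%:R + \sum_(j < n) - alpha (outer j) * (d j)%:R.
Proof.
rewrite big_ord_recl ffunE unlift_none; congr (_ + _).
by apply: eq_bigr => j _; rewrite ffunE liftK.
Qed.

Lemma slope_ltE d0 (d : 'I_n -> nat) : star_dim d0 d != [ffun=> 0%N] ->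
  (slope alpha (star_dim d0 d) < slope alpha (full_dim n)) =
  (\sum_(j < n) - alpha (outer j) * (d j)%:R < alpha ord0 * d0%:R).
Proof.
move=> v0; have -> : slope alpha (full_dim n) = 0.
  rewrite /slope slope_numE (_ : _ + _ = 0) ?mul0r//.
  under eq_bigr do rewrite mulr1.
  by rewrite sumrN alpha0E; lra.
rewrite /slope pmulr_llt0; last first.
  rewrite invr_gt0 ltr0n lt0n; apply: contra v0 => /eqP s0.
  apply/eqP/ffunP => k; rewrite [RHS]ffunE; apply/eqP.
  by move/eqP: s0; rewrite sum_nat_eq0 => /forallP/(_ k)/implyP; apply.
by rewrite slope_numE mulNr addrC subr_lt0.
Qed.

Lemma sum_alpha_in (J : {set 'I_n}) (d : 'I_n -> nat) :
  (forall j, d j = (j \in J) :> nat) ->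
  \sum_(j < n) - alpha (outer j) * (d j)%:R = \sum_(j in J) - alpha (outer j).
Proof.
move=> dJ; rewrite [RHS]big_mkcond/=; apply: eq_bigr => j _.
by rewrite dJ; case: ifP; rewrite ?mulr1 ?mulr0.
Qed.

Lemma mulmx_cV1 (v : 'cV[R[i]]_2) (w : 'cV[R[i]]_1) : v *m w = w ord0 ord0 *: v.
Proof. by apply/matrixP => a b; rewrite !mxE big_ord1 (ord1 b) mulrC. Qed.

(** Two kinds of test subrepresentations are enough: a single outer vertex [j] with nothing at the
    centre when [A j = 0], and the line through some [A i] together with all outer vertices of [J]
    when the vectors of [J] are collinear. *)
Lemma stable_nondegenerate A : stable alpha A -> nondegenerate A.
Proof.
have fulldim : \dim {: 'cV[R[i]]_1} = 1%N by rewrite dimvf /dim /= mul1n.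
have dimW (J : {set 'I_n}) j :
    \dim (if j \in J then fullv else 0%VS : {vspace 'cV[R[i]]_1}) = (j \in J) :> nat.
  by case: ifP; rewrite ?fulldim ?dimv0.
move=> stA; have A0 j : A j != 0.
  apply/negP => /eqP Aj.
  have := stA 0%VS (fun k => if k \in [set j]%SET then fullv else 0%VS).
  (* Rewriting with this equivalence discharges the premise that the chosen subspaces form a
     subrepresentation. *)
  have -> P : (subrepresentation A 0%VS
      (fun k => if k \in [set j]%SET then fullv else 0%VS) -> P) <-> P.
    split=> [|//]; apply => k w; rewrite inE; case: eqP => [->|_] wk.
      by rewrite Aj mul0mx mem0v.
    by move: wk; rewrite memv0 => /eqP ->; rewrite mulmx0 mem0v.
  have v0 : star_dim 0 (fun k => \dim (if k \in [set j]%SET then fullv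
      else 0%VS : {vspace 'cV[R[i]]_1})) != [ffun=> 0%N].
    apply/eqP => /ffunP/(_ (outer j)); rewrite !ffunE liftK.
    by rewrite dimW inE eqxx.
  rewrite /= dimv0 slope_ltE// (sum_alpha_in (dimW _)) big_set1 mulr0 => H.
  have : ~~ (- alpha (outer j) < 0) by rewrite -leNgt oppr_ge0 ltW.
  by rewrite H//; apply/eqP => /ffunP/(_ ord0); rewrite !ffunE !unlift_none.
split=> // J aJ; apply: contrapT => nJ.
have dJ i j : i \in J -> j \in J -> det2 A i j = 0.
  by move=> iJ jJ; apply/eqP; apply: contrapT => /negP ij; apply: nJ; exists i, j.
(* A vector [A i] is needed to span the line; the empty set is short because [alpha ord0] is
   positive. *)
have [J0|[i iJ]] := set_0Vmem J.
  by move: aJ; rewrite J0 big_set0 leNgt alpha0_gt0.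
have := stA <[A i]>%VS (fun k => if k \in J then fullv else 0%VS).
have -> P : (subrepresentation A <[A i]>%VS
    (fun k => if k \in J then fullv else 0%VS) -> P) <-> P.
  split=> [|//]; apply => k w; case: ifP => [kJ _|_].
    have [c ->] := det2_colinear (A0 i) (dJ i k iJ kJ).
    by rewrite mulmx_cV1 memvZ// memvZ// memv_line.
  by rewrite memv0 => /eqP ->; rewrite mulmx0 mem0v.
have v0 : star_dim 1 (fun k => \dim (if k \in J then fullv
    else 0%VS : {vspace 'cV[R[i]]_1})) != [ffun=> 0%N].
  by apply/eqP => /ffunP/(_ ord0); rewrite !ffunE unlift_none.
rewrite /= dim_vline A0 slope_ltE// (sum_alpha_in (dimW _)) mulr1 => H.
have : ~~ (\sum_(j in J) - alpha (outer j) < alpha ord0) by rewrite -leNgt.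
by rewrite H//; apply/eqP => /ffunP/(_ ord0); rewrite !ffunE !unlift_none.
Qed.

(** Let [J] be the set of outer vertices carrying a nonzero subspace. If [W0 = 0], then [J] is empty
    because no [A j] vanishes. If [W0] is a line, it contains the vectors of [J], so [J] is short.
    If [W0] is everything, some outer vertex is missing and its positive weight gives strictness. *)
Lemma nondegenerate_stable A : nondegenerate A -> stable alpha A.
Proof.
move=> [A0 AJ] W0 W sub /=; set d := fun j => \dim (W j) => v0 vfull.
have dim1 j : (\dim (W j) <= 1)%N.
  by rewrite (leq_trans (dimvS (subvf _)))// dimvf /dim /= mul1n.
have dim2 : (\dim W0 <= 2)%N.
  by rewrite (leq_trans (dimvS (subvf _)))// dimvf /dim /= muln1.
pose J := [set j | W j != 0%VS]%SET.
have dJ j : d j = (j \in J) :> nat.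
  rewrite /d inE -dimv_eq0; move: (dim1 j).
  by case: (\dim (W j)) => [|[|]].
have JW0 j : j \in J -> A j \in W0.
  rewrite inE => Wj; have := sub j _ (memv_pick (W j)).
  rewrite mulmx_cV1 => AW.
  have w0 : vpick (W j) ord0 ord0 != 0.
    apply: contra Wj => /eqP w0; rewrite -vpick0; apply/eqP/matrixP => a b.
    by rewrite (ord1 a) (ord1 b) w0 mxE.
  by have := memvZ (vpick (W j) ord0 ord0)^-1 AW; rewrite scalerA mulVf// scale1r.
rewrite slope_ltE// (sum_alpha_in dJ).
case: (ltngtP (\dim W0) 1%N) => [|W02|W01].
- rewrite ltnS leqn0 dimv_eq0 => /eqP W00.
  case/negP: v0; apply/eqP/ffunP => k; rewrite !ffunE W00 dimv0.
  case: unliftP => [j _|//]; rewrite dJ; case: (boolP (j \in J)) => // /JW0.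
  by rewrite W00 memv0 (negbTE (A0 j)).
- have {}W02 : \dim W0 = 2%N by apply/eqP; rewrite eqn_leq dim2.
  have [JT|] := eqVneq J [set: 'I_n]%SET.
    case/negP: vfull; apply/eqP/ffunP => k; rewrite !ffunE W02.
    by case: unliftP => [j _|//]; rewrite dJ JT inE.
  rewrite -finset.subTset => /fintype.subsetPn[j _ jJ].
  rewrite W02 alpha0E; have : 0 < \sum_(k | k \notin J) - alpha (outer k).
    rewrite (bigD1 j)//= ltr_pwDl ?oppr_gt0//.
    by apply: sumr_ge0 => k _; rewrite oppr_ge0 ltW.
  have -> : \sum_(j < n) alpha (outer j) =
      - (\sum_(j in J) - alpha (outer j)) - \sum_(j | j \notin J) - alpha (outer j).
    by rewrite !sumrN !opprK (bigID (mem J)).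
  by lra.
- rewrite W01 mulr1 ltNge; apply/negP => /AJ[i [j [iJ jJ]]] /negP; apply.
  have /eqP W0E : (<[A i]> == W0)%VS by rewrite eqEdim -memvE JW0//= dim_vline A0 W01.
  have := JW0 j jJ; rewrite -W0E => /vlineP[c Aj].
  by apply/eqP; rewrite /det2 Aj !mxE; ring.
Qed.

Lemma stableP A : stable alpha A <-> nondegenerate A.
Proof.
by split; [exact: stable_nondegenerate|exact: nondegenerate_stable].
Qed.

End Stability.

(** * Extending maps into the set of stable representations *)

Lemma subset_of_card (T : finType) (J : {set T}) k : (k <= #|J|)%N ->
  exists2 J' : {set T}, J' \subset J & #|J'| = k.
Proof.
move=> /card_geqP[s [us ss sJ]]; exists [set x in s]%SET; last by rewrite cardsE (card_uniqP us).
by apply/fintype.subsetP => x; rewrite inE => /sJ.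
Qed.

Section RepresentationCoordinates.
Context {R : realType} {n : nat}.
Local Open Scope complex_scope.

(* The columns [lshift 2 a] and [rshift 2 a] hold the real and the imaginary
  parts of the coordinates [A j a]. *)
Definition rep_of_real (v : 'M[R]_(n, 2 + 2)) : quiver_rep R n :=
  fun j => \matrix_(a, _) (v j (lshift 2 a) +i* v j (rshift 2 a)).

Definition real_of_rep (A : quiver_rep R n) : 'M[R]_(n, 2 + 2) :=
  \matrix_(j, b) match fintype.split b with
    | inl a => complex.Re (A j a ord0)
    | inr a => complex.Im (A j a ord0)
    end.

Lemma real_of_repK : cancel real_of_rep rep_of_real.
Proof.
move=> A; apply/funext => j; apply/matrixP => a b; rewrite !mxE (ord1 b).
have -> : fintype.split (lshift 2 a) = inl a by exact: (@unsplitK 2 2 (inl a)).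
have -> : fintype.split (rshift 2 a) = inr a by exact: (@unsplitK 2 2 (inr a)).
by case: (A j a ord0).
Qed.

Lemma rep_of_real_continuous (X : topologicalType) (f : X -> 'M[R]_(n, 2 + 2)) :
  continuous f -> continuous (fun x => rep_of_real (f x)).
Proof.
move=> cf; apply: ptws_continuous => j; apply: mx_continuous => a b.
under eq_fun do rewrite mxE.
by apply: Complex_continuous; exact: mx_coord_continuous.
Qed.

Lemma rep_coord_continuous (X : topologicalType) (f : X -> quiver_rep R n) j a b :
  continuous f -> continuous (fun x => f x j a b).
Proof.
move=> cf; apply: (@mx_coord_continuous X R[i] 2 1 (fun x => f x j) a b).
exact: ptws_coord_continuous.
Qed.

Lemma real_of_rep_continuous (X : topologicalType) (f : X -> quiver_rep R n) :
  continuous f -> continuous (fun x => real_of_rep (f x)).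
Proof.
move=> cf; apply: mx_continuous => j b; under eq_fun do rewrite mxE.
case: (fintype.split b) => a.
  by apply: Re_continuous; exact: rep_coord_continuous.
by apply: Im_continuous; exact: rep_coord_continuous.
Qed.

Lemma det2_continuous (X : topologicalType) (f : X -> quiver_rep R n) i j :
  continuous f -> continuous (fun x => det2 (f x) i j).
Proof.
move=> cf; apply: (@subr_fun_continuous _ R[i] R[i]);
  by apply: mulr_fun_continuous; exact: rep_coord_continuous.
Qed.

Lemma nondegenerate_open (alpha : 'I_n.+1 -> R) : open [set A | nondegenerate alpha A].
Proof.
rewrite openE => A [A0 AJ]; rewrite /interior.
have cid_ : continuous (fun B : quiver_rep R n => B) by move=> ?; exact: cvg_id.
near=> B.
split.
  near: B; apply: filter_forall => j.
  have /cV2_neq0/orP[a0|a0] := A0 j.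
    have /cvgr_neq0/(_ a0) := @rep_coord_continuous _ _ j 0 ord0 cid_ A.
    by apply: filterS => B; apply: contraNneq => ->; rewrite mxE.
  have /cvgr_neq0/(_ a0) := @rep_coord_continuous _ _ j 1 ord0 cid_ A.
  by apply: filterS => B; apply: contraNneq => ->; rewrite mxE.
near: B; apply: filter_forall => J.
have [aJ|aJ] := boolP (alpha ord0 <= \sum_(j in J) - alpha (outer j)); last exact: nearW.
have [i [j [iJ jJ ij]]] := AJ J aJ.
have /cvgr_neq0/(_ ij) := @det2_continuous _ _ i j cid_ A.
by apply: filterS => B Bij _; exists i, j.
Unshelve. all: by end_near. Qed.

End RepresentationCoordinates.

Section GenericRepresentations.
Context {R : realType} {n : nat} (alpha : 'I_n.+1 -> R).
Local Open Scope complex_scope.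
Hypothesis alpha_lt0 : forall j : 'I_n, alpha (outer j) < 0.
Hypothesis alpha0E : alpha ord0 = - (2^-1 * \sum_(j < n) alpha (outer j)).
Variable l : nat.
Hypothesis l_le_n : (l <= n)%N.
Hypothesis l_short : level_strictly_short alpha l.

(** A set with at most [l] elements is contained in one with exactly [l], obtained as the complement
    of [n - l] elements outside it; enlarging a set only increases its weight, which stays below
    half the total. *)
Lemma long_card (J : {set 'I_n}) :
  alpha ord0 <= \sum_(j in J) - alpha (outer j) -> (l < #|J|)%N.
Proof.
move=> aJ; rewrite ltnNge; apply/negP => Jl.
have [|J' J'J cJ'] := @subset_of_card _ (~: J)%SET (n - l).
  by rewrite cardsCs finset.setCK card_ord leq_sub2l.
have /l_short : #|(~: J')%SET| = l by rewrite cardsCs finset.setCK card_ord cJ' subKn.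
rewrite /strictly_short -!sumrN => sh.
have JJ' : J \subset (~: J')%SET by rewrite finset.subsetC.
have : \sum_(j in J) - alpha (outer j) <= \sum_(j in (~: J')%SET) - alpha (outer j).
  rewrite [leRHS](big_setID J)/= (finset.setIidPr JJ') lerDl.
  by apply: sumr_ge0 => j _; rewrite oppr_ge0 ltW.
move: aJ; rewrite alpha0E (bigID (mem (~: J')%SET))/=.
rewrite !sumrN in sh *; move: sh.
by set u := \sum_(_ in (~: J')%SET) _; set v := \sum_(_ | _ \notin _) _; lra.
Qed.

(** The factor 2 in the bound on [x - x'] comes from the substitution [x = 2 w - 1], with [w] a
    parameter in the unit interval. *)
Lemma real_mul_lip (x x' u u' B C d : R) : `|x| <= 1 -> `|u'| <= B ->
  `|x - x'| <= 2 * d -> `|u - u'| <= C * d -> 0 <= d ->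
  `|x * u - x' * u'| <= (C + 2 * B) * d.
Proof.
move=> x1 uB xx uu d0; have -> : x * u - x' * u' = x * (u - u') + (x - x') * u' by ring.
apply: (le_trans (ler_normD _ _)); rewrite !normrM mulrDl; apply: lerD.
  by apply: le_trans uu; rewrite ler_piMl.
by rewrite -mulrA [B * d]mulrC mulrA; apply: ler_pM.
Qed.

Variables (m : nat) (psi : 'rV[R]_m -> 'M[R]_(n, 2 + 2)) (C : R).
Hypothesis C_ge0 : 0 <= C.
Hypothesis psi_lip :
  forall t u i j, `|psi t i j - psi u i j| <= C * `|t - u|.
Hypothesis m_le3 : (m <= 3)%N.
Hypothesis m_lt2l : (m < 2 * l)%N.

Definition long_sets := {J : {set 'I_n} | #|J| == l.+1}.

Definition family : finType := ('I_n + long_sets * 'I_2)%type.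

Definition params (t : family) : finType :=
  match t with inl _ => 'I_m | inr _ => ('I_m + 'I_2)%type end.

(* In the family [inr (J, a)] the vectors [A i], [i \in J], lie on the line
  where the coordinate [a] is [z] times the other one. *)
Definition bound_coords (t : family) : {set 'I_n * 'I_(2 + 2)} :=
  match t with
  | inl j => finset.setX [set j]%SET [set: 'I_(2 + 2)]%SET
  | inr (J, a) => finset.setX (val J) [set lshift 2 a; rshift 2 a]%SET
  end.

(** The unit square of parameters is mapped onto the square of side 2 centred at 0, which contains
    the closed unit disc, where the slopes of lines are found. *)
Definition disc_param (w : 'I_2 -> R) : R[i] := (2 * w 0 - 1) +i* (2 * w 1 - 1).

Definition translate (t : 'rV[R]_m) (p : 'I_n * 'I_(2 + 2) -> R) : quiver_rep R n :=
  rep_of_real (psi t + \matrix_(i, j) p (i, j)).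

Definition bad (t : family) : (params t -> R) -> ('I_n * 'I_(2 + 2) -> R) -> Prop :=
  match t with
  | inl j => fun w p => translate (\row_i w i) p j = 0
  | inr (J, a) => fun w p => forall i, i \in val J ->
      translate (\row_i w (inl i)) p i a ord0 =
      disc_param (fun b => w (inr b)) * translate (\row_i w (inl i)) p i (1 - a) ord0
  end.

(** This is the dimension count. A vanishing vector has [m] parameters against 4 real coordinates,
    which needs [m <= 3]; a collinear family has [m + 2] parameters against [2 (l + 1)] real
    coordinates, which needs [m < 2 l]. *)
Lemma card_params t : (#|params t| < #|bound_coords t|)%N.
Proof.
case: t => [j|[J a]] /=.
  by rewrite cardsX cards1 cardsT !card_ord mul1n ltnS.
rewrite card_sum !card_ord cardsX (eqP (valP J)) cards2.
by rewrite (_ : lshift 2 a != rshift 2 a) ?eq_lrshift//; move: m_lt2l; lia.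
Qed.

Lemma translate_coord t p i a : translate t p i a ord0 =
  (psi t i (lshift 2 a) + p (i, lshift 2 a)) +i*
  (psi t i (rshift 2 a) + p (i, rshift 2 a)).
Proof. by rewrite mxE !mxE. Qed.

(** The inner sum bounds the translated coordinates of [psi] on the cube. A bound coordinate is a
    value of [psi], contributing [C], plus in the collinear case two products estimated by
    [real_mul_lip]. *)
Definition bad_lip : R := C + (C + 2 * (\sum_i \sum_j `|psi 0 i j| + C + 1)) *+ 2.

Lemma row_param_norm (w : 'I_m -> R) (d : R) : 0 <= d -> (forall i, `|w i| <= d) ->
  `|\row_i w i| <= d.
Proof. by move=> d0 wd; apply: mx_norm_le => // a b; rewrite mxE. Qed.

(** The equation defining a bad family can be solved for the bound coordinates of [p]: they are
    [- psi] for a vanishing vector, and [z] times the other complex coordinate minus [psi] for a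
    collinear family. Both are Lipschitz functions of the parameters. *)
Lemma bad_lipschitz t w w' p p' d : 0 <= d -> bad (t := t) w p -> bad (t := t) w' p' ->
  (forall q, 0 <= w q <= 1) -> (forall q, 0 <= w' q <= 1) ->
  (forall k, `|p k| <= 1) -> (forall k, `|p' k| <= 1) ->
  (forall k, k \notin bound_coords t -> p k = p' k) ->
  (forall q, `|w q - w' q| <= d) ->
  forall k, k \in bound_coords t -> `|p k - p' k| <= bad_lip * d.
Proof.
pose B := \sum_i \sum_j `|psi 0 i j| + C + 1.
have B0 : 0 <= B.
  by rewrite !addr_ge0// sumr_ge0// => i _; rewrite sumr_ge0.
have psiB (u : 'rV[R]_m) i j : `|u| <= 1 -> `|psi u i j| + 1 <= B.
  move=> u1; rewrite lerD2r.
  have : `|psi 0 i j| <= \sum_i \sum_j `|psi 0 i j|.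
    rewrite (bigD1 i)//= (bigD1 j)//= -addrA lerDl addr_ge0//.
      by rewrite sumr_ge0.
    by rewrite sumr_ge0// => i' _; rewrite sumr_ge0.
  have : `|psi u i j - psi 0 i j| <= C.
    by apply: le_trans (psi_lip _ _ _ _) _; rewrite subr0 ler_piMr.
  by have := ler_normD (psi u i j - psi 0 i j) (psi 0 i j); rewrite subrK; lra.
have dist (u u' : 'I_m -> R) i j : 0 <= d -> (forall q, `|u q - u' q| <= d) ->
    `|psi (\row_q u q) i j - psi (\row_q u' q) i j| <= C * d.
  move=> d0 uu; apply: (le_trans (psi_lip _ _ _ _)); rewrite ler_wpM2l//.
  rewrite (_ : _ - _ = \row_q (u q - u' q)); first exact: row_param_norm.
  by apply/rowP => q; rewrite !mxE.
move=> d0; case: t w w' => [j|[J a]] /= w w' bw bw' w01 w'01 p1 p'1 pp' ww'.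
  have Bd : 0 <= (C + 2 * B) *+ 2 * d.
    by rewrite mulr_ge0// mulrn_wge0// addr_ge0// mulr_ge0.
  move=> [i b]; rewrite finset.in_setX !inE => /andP[/eqP -> _].
  have coord (u : 'I_m -> R) q : translate (\row_i u i) q j = 0 ->
      q (j, b) = - psi (\row_i u i) j b.
    move=> tr0; rewrite -(splitK b); case: (fintype.split b) => a /=;
      have := congr1 (fun v : 'cV_2 => v a ord0) tr0;
      by rewrite translate_coord mxE => -[]; lra.
  rewrite (coord _ _ bw) (coord _ _ bw') opprK addrC distrC.
  apply: (le_trans (dist _ _ j b d0 ww')); rewrite /bad_lip -/B mulrDl; lra.
(* The coordinate [1 - a] on the right-hand side is not bound, so [p] and [p'] agree there. *)
have notJ (i : 'I_n) (e : 'I_2 -> 'I_(2 + 2)) : (e = lshift 2 \/ e = rshift 2 (n:=2)) ->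
    p (i, e (1 - a)) = p' (i, e (1 - a)).
  move=> ee; apply: pp'; rewrite finset.in_setX !inE negb_and; apply/orP; right.
  have a1 : (1 - a == a) = false by case: (a) => -[|[|//]].
  by case: ee => ->; rewrite negb_or ?eq_lshift ?eq_rshift ?eq_lrshift ?eq_rlshift a1.
have unit_norm (u : 'I_m + 'I_2 -> R) : (forall q, 0 <= u q <= 1) ->
    `|\row_q u (inl q)| <= 1.
  by move=> u01; apply: row_param_norm => // q; have := u01 (inl q);
    rewrite ler_norml; lra.
have wx c : `|2 * w (inr c) - 1| <= 1.
  by have := w01 (inr c); rewrite ler_norml; lra.
have wxx c : `|2 * w (inr c) - 1 - (2 * w' (inr c) - 1)| <= 2 * d.
  rewrite (_ : _ - _ = 2 * (w (inr c) - w' (inr c))); last by ring.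
  by rewrite normrM ger0_norm// ler_wpM2l.
have term c i (e : 'I_2 -> 'I_(2 + 2)) : (e = lshift 2 \/ e = rshift 2 (n:=2)) ->
    `|(2 * w (inr c) - 1) * (psi (\row_q w (inl q)) i (e (1 - a)) + p (i, e (1 - a))) -
      (2 * w' (inr c) - 1) * (psi (\row_q w' (inl q)) i (e (1 - a)) + p' (i, e (1 - a)))|
    <= (C + 2 * B) * d.
  move=> ee; apply: real_mul_lip => //.
    apply: (le_trans (ler_normD _ _)); apply: le_trans (psiB _ i (e (1 - a)) (unit_norm _ w'01)).
    by rewrite lerD2l.
  rewrite (notJ i e ee) opprD addrACA subrr addr0.
  by apply: (dist (fun q => w (inl q)) (fun q => w' (inl q))).
have coord (u : 'I_m + 'I_2 -> R) q i : translate (\row_q u (inl q)) q i a ord0 =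
      disc_param (fun b => u (inr b)) * translate (\row_q u (inl q)) q i (1 - a) ord0 ->
    let x c := 2 * u (inr c) - 1 in
    let U e := psi (\row_q u (inl q)) i (e (1 - a)) + q (i, e (1 - a)) in
    q (i, lshift 2 a) = x 0 * U (lshift 2) - x 1 * U (rshift 2 (n:=2)) - psi (\row_q u (inl q)) i (lshift 2 a) /\
    q (i, rshift 2 a) = x 0 * U (rshift 2 (n:=2)) + x 1 * U (lshift 2) - psi (\row_q u (inl q)) i (rshift 2 a).
  by rewrite !translate_coord => -[h1 h2] /=; split; lra.
move=> [i b]; rewrite finset.in_setX !inE => /= /andP[iJ].
have [pl pr] := coord w p i (bw i iJ); have [p'l p'r] := coord w' p' i (bw' i iJ).
have dl := dist (fun q => w (inl q)) (fun q => w' (inl q)) i (lshift 2 a) d0 (fun q => ww' (inl q)).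
have dr := dist (fun q => w (inl q)) (fun q => w' (inl q)) i (rshift 2 a) d0 (fun q => ww' (inl q)).
have t1 := term 0 i (lshift 2) (or_introl erefl).
have t2 := term 1 i (lshift 2) (or_introl erefl).
have t3 := term 0 i (rshift 2 (n:=2)) (or_intror erefl).
have t4 := term 1 i (rshift 2 (n:=2)) (or_intror erefl).
rewrite /bad_lip -/B [X in _ <= X]mulrDl mulrnAl.
move=> /orP[/eqP ->|/eqP ->]; [rewrite pl p'l|rewrite pr p'r];
  move: dl dr t1 t2 t3 t4; rewrite !ler_norml mulr2n; lra.
Qed.

Lemma generic_stable e : (0 < n)%N -> 0 < e ->
  exists2 a, `|a| <= e & forall t, cube R m t -> stable alpha (rep_of_real (psi t + a)).
Proof.
move=> n0 e0.
(* Translations are kept of norm at most 1, as the Lipschitz estimate for bad families assumes. *)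
have e1 : 0 < Num.min 1 e <= 1 by rewrite lt_min ltr01 e0 ge_min lexx.
have [p [pe pbad]] := general_position e1 card_params bad_lipschitz.
exists (\matrix_(i, j) p (i, j)).
  apply: mx_norm_le => [|i j]; first exact: ltW.
  by rewrite mxE; apply: le_trans (pe _) _; rewrite ge_min lexx orbT.
move=> t ct; apply/stableP => //; set A := rep_of_real _.
have tE (w : 'I_m -> R) : (forall i, w i = t ord0 i) -> translate (\row_i w i) p = A.
  by move=> wt; rewrite /translate (_ : \row_i w i = t)//; apply/rowP => i; rewrite mxE wt.
have A0 j : A j != 0.
  by apply/eqP => Aj; apply: (pbad (inl j) (fun i => t ord0 i)) => //=; rewrite tE.
split=> // J /long_card/subset_of_card[J' /fintype.subsetP J'J /eqP cJ'].
apply: contrapT => nJ.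
have dJ i j : i \in J' -> j \in J' -> det2 A i j = 0.
  move=> /J'J iJ /J'J jJ; apply/eqP; apply: contrapT => /negP ij.
  by apply: nJ; exists i, j.
have [i iJ'] : exists i, i \in J'.
  by apply/card_gt0P; rewrite (eqP cJ').
(* Taking for [a] the coordinate of smaller modulus puts the slope in the closed unit disc. Moduli
   are compared through their real parts, since the order of [R[i]] is partial. *)
have [a aA] : exists a : 'I_2, `|A i a ord0| <= `|A i (1 - a) ord0|.
  have := le_total (complex.Re `|A i 0 ord0|) (complex.Re `|A i 1 ord0|).
  have rn (z : R[i]) : `|z| = (complex.Re `|z|)%:C by rewrite normc_def.
  rewrite -!lecR -!rn => /orP[h|h]; [exists 0|exists 1].
    by rewrite subr0.
  by rewrite subrr.
have Ai0 : A i (1 - a) ord0 != 0.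
  apply: contra (A0 i) => /eqP b0; move: aA; rewrite b0 normr0 normr_le0 => /eqP a0.
  by apply/eqP/cV2P; rewrite [RHS]mxE; move: a0 b0; have [->|->] := ord2_cases a; rewrite ?subr0 ?subrr.
pose z := A i a ord0 / A i (1 - a) ord0.
have z1 : `|z| <= 1 by rewrite normf_div ler_pdivrMr ?normr_gt0// mul1r.
have zr : `|complex.Re z| <= 1 /\ `|complex.Im z| <= 1.
  move: z1; case: (z) => x y; rewrite normc_def lecR /= => z1.
  by split; apply: le_trans z1; rewrite -sqrtr_sqr ler_wsqrtr// ?lerDl ?lerDr sqr_ge0.
(* The values [(x + 1) / 2] invert the substitution [2 w - 1] of [disc_param]. *)
pose w (q : 'I_m + 'I_2) : R := match q with
  | inl i => t ord0 i
  | inr b => if b == 0 then (complex.Re z + 1) / 2 else (complex.Im z + 1) / 2 end.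
apply: (pbad (inr (Sub J' cJ', a)) w).
  case=> [i'|b] /=; first exact: ct.
  by case: ifP => _; move: zr; rewrite !ler_norml => -[]; lra.
move=> j /= jJ'; rewrite tE//.
have -> : disc_param (fun b => w (inr b)) = z.
  have h (x : R) : 2 * ((x + 1) / 2) - 1 = x by lra.
  by rewrite /disc_param /= !h; case: (z).
rewrite /z mulrAC; apply/esym/(canLR (mulfK Ai0)); have /eqP := dJ i j iJ' jJ'.
rewrite /det2 subr_eq0 => /eqP; have [->|->] := ord2_cases a; rewrite ?subr0 ?subrr => dA.
  by rewrite dA mulrC.
by rewrite -dA mulrC.
Qed.
End GenericRepresentations.

Section Connectivity.
Context {R : realType} {n : nat} (alpha : 'I_n.+1 -> R).

(** Shortness enters the homotopy arguments only through this property. For [m = 0] the boundary is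
    empty, and it states that stable representations exist. *)
Lemma stable_extension (l m : nat) (f : 'rV[R]_m -> 'M[R]_(n, 2 + 2)) :
  (0 < n)%N -> (forall j : 'I_n, alpha (outer j) < 0) ->
  alpha ord0 = - (2^-1 * \sum_(j < n) alpha (outer j)) ->
  (l <= n)%N -> level_strictly_short alpha l -> (m <= 3)%N -> (m < 2 * l)%N ->
  continuous f ->
  (forall t, cube_boundary R m t -> stable alpha (rep_of_real (f t))) ->
  exists F : 'rV[R]_m -> stable_rep alpha, continuous F /\
    forall t, cube_boundary R m t -> val (F t) = rep_of_real (f t).
Proof.
move=> n0 alpha_lt0 alpha0E ln short m3 ml cf fst.
have oO : open [set v | stable alpha (rep_of_real v)].
  have -> : [set v | stable alpha (rep_of_real v)] =
      rep_of_real @^-1` [set A | nondegenerate alpha A].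
    by apply/seteqP; split => v /=; rewrite stableP.
  apply: open_comp; last exact: nondegenerate_open.
  by move=> v _; apply: (@rep_of_real_continuous R n _ id) => ?; exact: cvg_id.
have gp (psi : 'rV[R]_m -> 'M[R]_(n, 2 + 2)) (C e : R) : 0 <= C -> 0 < e ->
    (forall t u i j, `|psi t i j - psi u i j| <= C * `|t - u|) ->
    exists2 a, `|a| <= e & forall t, cube R m t -> stable alpha (rep_of_real (psi t + a)).
  by move=> C0 e0 lip; apply: (generic_stable alpha_lt0 alpha0E ln short C0 lip).
have [F [cF FO Ff]] := extension_of_general_position oO cf fst gp.
exists (fun t => exist _ (rep_of_real (F t)) (mem_set (FO t))); split.
  by apply: set_type_continuous; exact: rep_of_real_continuous.
by move=> t bt /=; rewrite Ff.
Qed.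

End Connectivity.

(** * The action of the normalised gauge group *)

(** The identity behind [transport_invariant], for one row and the two columns of the matrix part.
    The [a]'s are the entries of [g.1], [d] is [g.2 p], the vectors [(x0, y0)] and [(xp, yp)] are
    [A ord0] and [A p], [D] is their determinant, [u] and [v] are entries of [B ord0] and [B p], and
    [c] is the scalar of the transport at [p]. *)
Lemma frame_change (F : fieldType) (a00 a01 a10 a11 xp yp x0 y0 u v c d D : F) :
  a00 * a11 - a01 * a10 != 0 -> d != 0 ->
  ((u * (d * (a10 * xp + a11 * yp)) - v / (c / d) * (1 * (a10 * x0 + a11 * y0))) /
     ((a00 * a11 - a01 * a10) * 1 * d * D) * a00 +
   (u * - (d * (a00 * xp + a01 * yp)) - v / (c / d) * - (1 * (a00 * x0 + a01 * y0))) /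
     ((a00 * a11 - a01 * a10) * 1 * d * D) * a10 = (u * yp - v / c * y0) / D) *
  ((u * (d * (a10 * xp + a11 * yp)) - v / (c / d) * (1 * (a10 * x0 + a11 * y0))) /
     ((a00 * a11 - a01 * a10) * 1 * d * D) * a01 +
   (u * - (d * (a00 * xp + a01 * yp)) - v / (c / d) * - (1 * (a00 * x0 + a01 * y0))) /
     ((a00 * a11 - a01 * a10) * 1 * d * D) * a11 = (u * - xp - v / c * - x0) / D).
Proof.
move=> d0 p0; have -> : v / (c / d) = v / c * d by rewrite invf_div mulrA mulrAC.
move: (v / c) => e; set Dt := a00 * a11 - a01 * a10 in d0 *.
have cancel N M : N = Dt * d * M -> N / (Dt * 1 * d * D) = M / D.
  move=> ->; rewrite mulr1 [in LHS]invfM [_ * (_^-1 * D^-1)]mulrA [_ * M]mulrC.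
  by rewrite mulfK// mulf_neq0.
by split; rewrite mulrAC [X in _ + X]mulrAC -mulrDl; apply: cancel; rewrite /Dt; ring.
Qed.

(** A row [(a0, a1)] is recovered from its values on two independent vectors; this gives the matrix
    part of [transport_act]. *)
Lemma frame_act (F : fieldType) (a0 a1 xp yp x0 y0 d D : F) :
  d != 0 -> D = x0 * yp - y0 * xp -> D != 0 ->
  (((1 * (a0 * x0 + a1 * y0)) * yp - d * (a0 * xp + a1 * yp) / d * y0) / D = a0) *
  (((1 * (a0 * x0 + a1 * y0)) * - xp - d * (a0 * xp + a1 * yp) / d * - x0) / D = a1).
Proof.
move=> d0 DE D0; split; rewrite [d * _ / d]mulrAC mulfV// mul1r;
  by apply: (canLR (mulfK D0)); rewrite DE; ring.
Qed.

(** Multiplicativity of determinants for the matrix taking the basis [(x0, y0)], [(xp, yp)] to [u]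
    and [w / c]. *)
Lemma frame_det (F : fieldType) (u0 u1 w0 w1 xp yp x0 y0 c D : F) :
  D = x0 * yp - y0 * xp -> D != 0 ->
  ((u0 * yp - w0 / c * y0) / D) * ((u1 * - xp - w1 / c * - x0) / D) -
  ((u0 * - xp - w0 / c * - x0) / D) * ((u1 * yp - w1 / c * y0) / D) =
  (u0 * w1 - u1 * w0) / c / D.
Proof.
move=> DE D0; move: (c^-1) => e; have {}DE : x0 * yp - y0 * xp = D by [].
have E : (u0 * yp - w0 * e * y0) * (u1 * - xp - w1 * e * - x0) -
    (u0 * - xp - w0 * e * - x0) * (u1 * yp - w1 * e * y0) =
    (u0 * w1 - u1 * w0) * e * (x0 * yp - y0 * xp) by ring.
rewrite DE in E; rewrite [LHS](_ : _ = (u0 * w1 - u1 * w0) * e * D / D / D).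
  by rewrite mulfK.
by rewrite -E; ring.
Qed.

Section Gauge.
Context {R : realType} {k : nat}.
Local Notation C := R[i].
Local Notation rep := (quiver_rep R k.+1).
Implicit Types A B : rep.

(* Since scalars act trivially, we normalise [g] by [g.2 ord0 = 1]; [g.2 j] is the
  inverse of the component [g_j]. *)
Definition gauge : topologicalType := ('M[C]_2 * {ptws 'I_k.+1 -> C})%type.

Lemma gauge_cvg (T : Type) (F : set_system T) {FF : Filter F} (g : T -> gauge) (l : gauge) :
  (g x).1 @[x --> F] --> l.1 -> (g x).2 @[x --> F] --> l.2 -> g x @[x --> F] --> l.
Proof.
case: l => l1 l2 /= h1 h2.
have -> : g = fun x => ((g x).1, (g x).2) by apply/funext => x; case: (g x).
exact: (cvg_pair h1 h2).
Qed.

Definition gauge_ok (g : gauge) : bool :=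
  [&& g.1 \in unitmx, [forall j, g.2 j != 0] & g.2 ord0 == 1].

Definition act (g : gauge) A : rep := fun j => g.2 j *: (g.1 *m A j).

Definition gauge1 : gauge := (1%:M, fun=> 1).

Lemma gauge1_ok : gauge_ok gauge1.
Proof. by rewrite /gauge_ok unitmx1 eqxx andbT; apply/forallP => j; exact: oner_neq0. Qed.

Lemma act1 A : act gauge1 A = A.
Proof. by apply/funext => j; rewrite /act scale1r mul1mx. Qed.

Lemma gauge_okP (g : gauge) : reflect [/\ g.1 \in unitmx, forall j, g.2 j != 0 & g.2 ord0 = 1]
  (gauge_ok g).
Proof.
apply: (iffP and3P) => [[? /forallP ? /eqP ?]|[? ? ?]]; split=> //.
  exact/forallP.
exact/eqP.
Qed.

Lemma lift_ord2 : (lift 0 0 = 1 :> 'I_2) * (lift 1 0 = 0 :> 'I_2).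
Proof. by split; exact/val_inj. Qed.

Lemma det_mx2 (M : 'M[C]_2) : \det M = M 0 0 * M 1 1 - M 0 1 * M 1 0.
Proof.
rewrite (expand_det_row _ 0) big_ord_recl big_ord1 /cofactor !det_mx11 !mxE.
have -> : lift ord0 ord0 = 1 :> 'I_2 by exact/val_inj.
by rewrite !lift_ord2 /= expr0 expr1; ring.
Qed.

Lemma mulmx2_cV (M : 'M[C]_2) (v : 'cV[C]_2) a :
  (M *m v) a ord0 = M a 0 * v 0 ord0 + M a 1 * v 1 ord0.
Proof.
rewrite mxE big_ord_recl big_ord1.
by have -> : lift ord0 ord0 = 1 :> 'I_2 by exact/val_inj.
Qed.

Lemma act_coord g A j a : act g A j a ord0 =
  g.2 j * (g.1 a 0 * A j 0 ord0 + g.1 a 1 * A j 1 ord0).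
Proof. by rewrite /act mxE mulmx2_cV. Qed.

Lemma det2_act g A i j :
  det2 (act g A) i j = \det g.1 * g.2 i * g.2 j * det2 A i j.
Proof. by rewrite /det2 !act_coord det_mx2; ring. Qed.

Lemma actM g h A : act g (act h A) = act (g.1 *m h.1, fun j => g.2 j * h.2 j) A.
Proof.
by apply/funext => j; rewrite /act /= -scalemxAr scalerA mulmxA.
Qed.

Lemma gauge_equiv_act g A : gauge_ok g -> gauge_equiv A (act g A).
Proof.
move=> /gauge_okP[g1 g2 _]; exists g.1, (fun j => (g.2 j)^-1%:M); split=> // j.
  by rewrite unitmxE det_scalar1 unitfE invr_eq0.
by rewrite invmx_scalar invrK /act mul_mx_scalar.
Qed.

(** The scalar of the vertex [ord0] is moved into the matrix, and all the other scalars are divided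
    by it. *)
Lemma gauge_equivP A B : gauge_equiv A B -> exists g, gauge_ok g /\ B = act g A.
Proof.
move=> [g0 [g [Ug0 Ug BE]]]; pose c j := invmx (g j) ord0 ord0.
have c0 j : c j != 0.
  by have := Ug j; rewrite -unitmx_inv unitmxE det_mx11 unitfE.
exists (c ord0 *: g0, fun j => c j / c ord0); split.
  apply/gauge_okP; split=> /=.
  - by rewrite unitmxZ// unitfE.
  - by move=> j; rewrite mulf_neq0 ?invr_eq0.
  - by rewrite divff.
apply/funext => j; rewrite BE mulmx_cV1 /act /= -scalemxAl scalerA divfK//.
Qed.

Definition perp (v : 'cV[C]_2) : 'rV[C]_2 :=
  \row_b (if b == 0 then v 1 ord0 else - v 0 ord0).

Lemma perpE (v : 'cV[C]_2) : (perp v ord0 0 = v 1 ord0) * (perp v ord0 1 = - v 0 ord0).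
Proof. by rewrite !mxE. Qed.

Section Chart.
Variables (p q : 'I_k.+1) (s : 'I_k.+1 -> bool).

(** Three pairwise independent vectors, at [ord0], [p] and [q], determine the determinant of a gauge
    element; each other scalar is then read off from a vector independent of [A l], which [s l]
    selects among [A ord0] and [A p]. *)
Definition chart A : bool := [&& det2 A ord0 p != 0, det2 A ord0 q != 0,
  det2 A p q != 0 & [forall l, det2 A (if s l then ord0 else p) l != 0]].

Lemma chartP A : reflect [/\ det2 A ord0 p != 0, det2 A ord0 q != 0,
  det2 A p q != 0 & forall l, det2 A (if s l then ord0 else p) l != 0] (chart A).
Proof.
by apply: (iffP and4P) => -[? ? ? H]; split=> //; exact/forallP.
Qed.

(* If [B = act g A], then the ratios [det2 B i j / det2 A i j] are
  [\det g.1 * g.2 i * g.2 j], from which [g] can be recovered. *)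
Definition ratio A B i j := det2 B i j / det2 A i j.

(** With [g.2 ord0 = 1] the scalars of [p] and [q] cancel in this quotient of ratios, which leaves
    [\det g.1]. *)
Definition transport_det A B := ratio A B ord0 p * ratio A B ord0 q / ratio A B p q.

Definition transport_scal A B l :=
  if s l then ratio A B ord0 l / transport_det A B
  else ratio A B p l / ratio A B ord0 p.

(** The matrix taking [A ord0] to [B ord0] and [A p] to [B p / transport_scal A B p]: divided by
    [det2 A ord0 p], the rows [perp (A p)] and [- perp (A ord0)] form the dual basis of these two
    vectors. *)
Definition transport_mx A B : 'M[C]_2 := \matrix_(a, b)
  ((B ord0 a ord0 * perp (A p) ord0 b -
    B p a ord0 / transport_scal A B p * perp (A ord0) ord0 b) / det2 A ord0 p).

Lemma transport_mxE A B a b : transport_mx A B a b =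
  (B ord0 a ord0 * perp (A p) ord0 b -
    B p a ord0 / transport_scal A B p * perp (A ord0) ord0 b) / det2 A ord0 p.
Proof. by rewrite mxE. Qed.

(** The formula makes sense for any two points of the chart. It carries [A] to [B] when they lie in
    one orbit, and provides a normalisation of [A] relative to [B] otherwise. *)
Definition transport A B : gauge := (transport_mx A B, transport_scal A B).

Lemma det2xx A i : det2 A i i = 0.
Proof. by rewrite /det2; ring. Qed.

Lemma det2C A i j : det2 A i j = - det2 A j i.
Proof. by rewrite /det2; ring. Qed.

Lemma chart_p A : chart A -> s p.
Proof.
by move=> /chartP[_ _ _ /(_ p)]; case: (s p) => //; rewrite det2xx eqxx.
Qed.

Lemma chart_0 A : chart A -> s ord0 = false.
Proof.
by move=> /chartP[_ _ _ /(_ ord0)]; case: (s ord0) => //; rewrite det2xx eqxx.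
Qed.

Lemma chart_act g A : gauge_ok g -> chart A -> chart (act g A).
Proof.
move=> /gauge_okP[]; rewrite unitmxE unitfE => g1 g2 _ /chartP[h1 h2 h3 h4].
by apply/chartP; split=> [| | |l]; rewrite det2_act !mulf_neq0.
Qed.

Lemma ratio_neq0 A B i j : det2 A i j != 0 -> det2 B i j != 0 -> ratio A B i j != 0.
Proof. by move=> a b; rewrite mulf_neq0// invr_eq0. Qed.

Lemma ratio_act g A B i j : ratio (act g A) B i j =
  ratio A B i j / (\det g.1 * g.2 i * g.2 j).
Proof. by rewrite /ratio det2_act invfM; ring. Qed.

(** The transport from [act g A] to [B], composed with [g], is the transport from [A] to [B]. Hence
    moving [A] by its transport to a fixed [B] gives a normal form that is constant on orbits, from
    which local sections are built. *)
Lemma transport_invariant g A B : gauge_ok g -> chart A -> chart B ->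
  act (transport (act g A) B) (act g A) = act (transport A B) A.
Proof.
move=> /gauge_okP[]; rewrite unitmxE unitfE => g1 g2 g20 cA cB.
have [A0p A0q Apq Al] := chartP _ cA; have [B0p B0q Bpq Bl] := chartP _ cB.
have sc l : transport_scal (act g A) B l * g.2 l = transport_scal A B l.
  rewrite /transport_scal /transport_det !ratio_act g20.
  move: (g1) (g2 l) (g2 p) (g2 q) => d0 l0 p0 q0.
  have r0p := ratio_neq0 A0p B0p; have r0q := ratio_neq0 A0q B0q.
  have rpq := ratio_neq0 Apq Bpq.
  case: ifP => _; field; rewrite ?d0 ?l0 ?p0 ?q0 ?r0p ?r0q ?rpq //.
have pc : transport_scal A B p != 0.
  rewrite /transport_scal (chart_p cA) /transport_det.
  by rewrite !mulf_neq0 ?invr_eq0 ?mulf_neq0 ?invr_eq0 ?ratio_neq0.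
have scp : transport_scal (act g A) B p = transport_scal A B p / g.2 p.
  by rewrite -sc mulfK.
rewrite actM; congr (act (_, _) A); last by apply/funext => l; exact: sc.
apply/matrixP => a b; rewrite mxE big_ord_recl big_ord1.
have -> : lift ord0 ord0 = 1 :> 'I_2 by exact/val_inj.
rewrite /= !transport_mxE scp det2_act g20.
rewrite det_mx2 in g1; rewrite det_mx2.
have cE j a' := act_coord g A j a'; move: (act g A) cE => gA cE.
by have [->|->] := ord2_cases b; rewrite !perpE !cE g20 frame_change.
Qed.

Lemma transport_act g A : gauge_ok g -> chart A -> transport A (act g A) = g.
Proof.
move=> /gauge_okP[]; rewrite unitmxE unitfE => g1 g2 g20 cA.
have [A0p A0q Apq Al] := chartP _ cA.
have rE i j : det2 A i j != 0 -> ratio A (act g A) i j = \det g.1 * g.2 i * g.2 j.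
  by move=> ij; rewrite /ratio det2_act mulfK.
have tE : transport_det A (act g A) = \det g.1.
  rewrite /transport_det !rE// g20 mulr1 [\det _ * _ * (_ * _)]mulrCA.
  by rewrite mulfK// !mulf_neq0.
have sc l : transport_scal A (act g A) l = g.2 l.
  rewrite /transport_scal tE; have := Al l; case: ifP => _ ?; rewrite !rE// g20 mulr1.
    by rewrite mulrAC mulfV// mul1r.
  by rewrite mulrAC mulfV ?mul1r// mulf_neq0.
rewrite [RHS]surjective_pairing; congr (_, _); last by apply/funext.
have cE j a' := act_coord g A j a'; rewrite /transport_mx.
apply/matrixP => a b; rewrite transport_mxE sc; move: (act g A) cE => gA cE.
by have [->|->] := ord2_cases b; rewrite !perpE !cE g20 frame_act.
Qed.

Lemma transport_ok A B : chart A -> chart B -> gauge_ok (transport A B).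
Proof.
move=> cA cB.
have [A0p A0q Apq Al] := chartP _ cA; have [B0p B0q Bpq Bl] := chartP _ cB.
have sc0 l : transport_scal A B l != 0.
  rewrite /transport_scal /transport_det.
  by have := Al l; have := Bl l; case: ifP => _ ? ?; rewrite !(mulf_neq0, invr_eq0)//;
    rewrite ?ratio_neq0// ?invr_eq0 ?ratio_neq0.
apply/gauge_okP; split=> //=; last first.
  by rewrite /transport_scal (chart_0 cA) /ratio [det2 B p _]det2C [det2 A p _]det2C;
    rewrite invrN mulrNN divff// mulf_neq0// invr_eq0.
rewrite unitmxE unitfE det_mx2 !transport_mxE !perpE frame_det//.
by rewrite !mulf_neq0// invr_eq0.
Qed.

Lemma chart_near (X : topologicalType) (A : X -> rep) (x : X) : continuous A ->
  chart (A x) -> \forall y \near x, chart (A y).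
Proof.
move=> cA /chartP[h1 h2 h3 h4].
have near_neq0 i j : det2 (A x) i j != 0 -> \forall y \near x, det2 (A y) i j != 0.
  by move=> ij; have /cvgr_neq0/(_ ij) := @det2_continuous _ _ _ _ i j cA x.
near=> y; apply/chartP; split; near: y; [exact: near_neq0..|].
by apply: filter_forall => l; exact: near_neq0.
Unshelve. all: by end_near. Qed.

Lemma transport_cvg (X : topologicalType) (A B : X -> rep) (x : X) :
  continuous A -> continuous B -> chart (A x) -> chart (B x) ->
  transport (A y) (B y) @[y --> x] --> transport (A x) (B x).
Proof.
move=> cA cB chA chB.
have [A0p A0q Apq Al] := chartP _ chA; have [B0p B0q Bpq Bl] := chartP _ chB.
have ratioC i j : det2 (A x) i j != 0 ->
    ratio (A y) (B y) i j @[y --> x] --> ratio (A x) (B x) i j.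
  move=> ij; apply: cvgM; first exact: det2_continuous.
  by apply: cvgV => //; exact: det2_continuous.
have detC : transport_det (A y) (B y) @[y --> x] --> transport_det (A x) (B x).
  apply: cvgM; first by apply: cvgM; exact: ratioC.
  by apply: cvgV; [exact: ratio_neq0|exact: ratioC].
have det0 : transport_det (A x) (B x) != 0.
  by rewrite !(mulf_neq0, invr_eq0)// ?ratio_neq0.
have scC l : transport_scal (A y) (B y) l @[y --> x] --> transport_scal (A x) (B x) l.
  have := Al l; rewrite /transport_scal; case: ifP => _ ?.
    by apply: cvgM; [exact: ratioC|exact: cvgV].
  by apply: cvgM; [exact: ratioC|apply: cvgV; [exact: ratio_neq0|exact: ratioC]].
apply: gauge_cvg; last by apply: ptws_cvg => l; exact: scC.
have perpC (D : X -> rep) j b : continuous D ->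
    perp (D y j) ord0 b @[y --> x] --> perp (D x j) ord0 b.
  move=> cD; have [->|->] := ord2_cases b; rewrite !perpE.
    by under eq_fun do rewrite perpE; exact: rep_coord_continuous.
  by under eq_fun do rewrite perpE; apply: cvgN; exact: rep_coord_continuous.
apply: mx_cvg => a b.
have -> : (fun y => (transport (A y) (B y)).1 a b) = (fun y => transport_mx (A y) (B y) a b) by [].
rewrite [in X in _ --> X]/transport [in X in _ --> X]/= transport_mxE.
under eq_fun do rewrite transport_mxE.
have [_ sc0 _] := gauge_okP _ (transport_ok chA chB).
have D0C : (det2 (A y) ord0 p)^-1 @[y --> x] --> (det2 (A x) ord0 p)^-1.
  by apply: cvgV; [exact: A0p|exact: det2_continuous].
have coordC j : B y j a ord0 @[y --> x] --> B x j a ord0.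
  exact: rep_coord_continuous.
have sVC : (transport_scal (A y) (B y) p)^-1 @[y --> x] --> (transport_scal (A x) (B x) p)^-1.
  by apply: cvgV; [exact: sc0|exact: scC].
exact: (cvgM (cvgB (cvgM (coordC ord0) (perpC A p b cA))
  (cvgM (cvgM (coordC p) sVC) (perpC A ord0 b cA))) D0C).
Qed.

End Chart.

Lemma continuous_gauge (X : topologicalType) (g : X -> gauge) :
  continuous (fun x => (g x).1) -> (forall j, continuous (fun x => (g x).2 j)) ->
  continuous g.
Proof.
move=> c1 c2 x; apply: gauge_cvg; first exact: c1.
by apply: ptws_cvg => j; exact: c2.
Qed.

Lemma gauge_coord_continuous (X : topologicalType) (g : X -> gauge) : continuous g ->
  continuous (fun x => (g x).1) /\ forall j, continuous (fun x => (g x).2 j).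
Proof.
move=> cg; split=> [x|j].
  exact: (@continuous_comp X gauge 'M[C]_2 g fst x (cg x) (@cvg_fst _ _ _ _ _)).
apply: (@ptws_coord_continuous X 'I_k.+1 C (fun x => (g x).2)) => x.
exact: (@continuous_comp X gauge {ptws 'I_k.+1 -> C} g snd x (cg x) (@cvg_snd _ _ _ _ _)).
Qed.

Lemma act_cvg (T : Type) (F : set_system T) {FF : Filter F} (g : T -> gauge)
    (A : T -> rep) (g0 : gauge) (A0 : rep) :
  g x @[x --> F] --> g0 -> A x @[x --> F] --> A0 ->
  act (g x) (A x) @[x --> F] --> act g0 A0.
Proof.
move=> cg cA.
have c1 a b : (g x).1 a b @[x --> F] --> g0.1 a b.
  have cab : continuous (fun h : gauge => h.1 a b).
    apply: mx_coord_continuous => h.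
    exact: (@cvg_fst 'M[C]_2 {ptws 'I_k.+1 -> C}).
  exact: (continuous_cvg _ (cab g0) cg).
have c2 j : (g x).2 j @[x --> F] --> g0.2 j.
  have cj : continuous (fun h : gauge => h.2 j).
    apply: (@ptws_coord_continuous gauge 'I_k.+1 C (fun h => h.2)) => h.
    exact: (@cvg_snd 'M[C]_2 {ptws 'I_k.+1 -> C}).
  exact: (continuous_cvg _ (cj g0) cg).
have cid_ : continuous (fun B : rep => B) by move=> ?; exact: cvg_id.
have c3 j a : A x j a ord0 @[x --> F] --> A0 j a ord0.
  exact: (continuous_cvg _ (@rep_coord_continuous _ _ _ _ j a ord0 cid_ A0) cA).
apply: ptws_cvg => j; apply: mx_cvg => a b; rewrite (ord1 b) act_coord.
under eq_fun do rewrite act_coord.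
exact: (cvgM (c2 j) (cvgD (cvgM (c1 a 0) (c3 j 0)) (cvgM (c1 a 1) (c3 j 1)))).
Qed.

Lemma act_continuous (X : topologicalType) (g : X -> gauge) (A : X -> rep) :
  continuous g -> continuous A -> continuous (fun x => act (g x) (A x)).
Proof. by move=> cg cA x; apply: act_cvg; [exact: cg|exact: cA]. Qed.

Lemma act_nondegenerate (alpha : 'I_k.+2 -> R) g A : gauge_ok g ->
  nondegenerate alpha A -> nondegenerate alpha (act g A).
Proof.
move=> /gauge_okP[g1 g2 _] [A0 AJ]; split=> [j|J /AJ[i [j [iJ jJ ij]]]].
  rewrite scaler_eq0 negb_or g2 /=; apply: contra (A0 j) => /eqP gA.
  by have := mulKmx g1 (A j); rewrite gA mulmx0 => <-.
by exists i, j; split=> //; rewrite det2_act !mulf_neq0// -unitfE -unitmxE.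
Qed.

Section Freeness.
Variable alpha : 'I_k.+2 -> R.
Hypothesis alpha_lt0 : forall j : 'I_k.+1, alpha (outer j) < 0.
Hypothesis alpha0E : alpha ord0 = - (2^-1 * \sum_(j < k.+1) alpha (outer j)).

(** The vectors proportional to [A i] form a short set, of weight less than half the total, so two
    such sets never cover all vertices: for any [i] and [j] some [A l] is independent of both. This
    yields [p], then [q]. A vector proportional to [A ord0] is a nonzero multiple of it, hence
    independent of [A p]. *)
Lemma chart_exists A : nondegenerate alpha A -> exists p q s, chart p q s A.
Proof.
move=> [A0 AJ].
have thin i : ~~ (alpha ord0 <= \sum_(j in [set j | det2 A i j == 0]%SET) - alpha (outer j)).
  apply/negP => /AJ[j [l [+ +]]]; rewrite !inE => /eqP ij /eqP il /negP; apply.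
  have [c Aj] := det2_colinear (A0 i) ij; have [d Al] := det2_colinear (A0 i) il.
  by apply/eqP; rewrite /det2 Aj Al !mxE; ring.
have sumE : \sum_(j < k.+1) - alpha (outer j) = 2 * alpha ord0.
  by rewrite sumrN alpha0E; lra.
have pos (j : 'I_k.+1) : 0 <= - alpha (outer j) by rewrite oppr_ge0 ltW.
have escape i j : exists l, det2 A i l != 0 /\ det2 A j l != 0.
  apply: contrapT => nl.
  have := thin i; have := thin j; rewrite -!ltNge => tj ti.
  have : \sum_(l < k.+1) - alpha (outer l) <=
      \sum_(l in [set l | det2 A i l == 0]%SET) - alpha (outer l) +
      \sum_(l in [set l | det2 A j l == 0]%SET) - alpha (outer l).
    rewrite [X in _ <= X + _]big_mkcond [X in _ <= _ + X]big_mkcond -big_split/=.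
    apply: ler_sum => l _; rewrite !inE.
    have [il|il] := eqVneq (det2 A i l) 0; first by rewrite lerDl; case: ifP.
    have [jl|jl] := eqVneq (det2 A j l) 0; first by rewrite add0r.
    by case: nl; exists l.
  by rewrite sumE; lra.
have [p [A0p _]] := escape ord0 ord0; have [q [A0q Apq]] := escape ord0 p.
exists p, q, (fun l => det2 A ord0 l != 0); apply/chartP; split=> // l.
case: ifPn => //; rewrite negbK => /eqP A0l.
have [c Al] := det2_colinear (A0 ord0) A0l.
have c0 : c != 0.
  by apply: contra (A0 l) => /eqP c0; rewrite Al c0 scale0r.
have -> : det2 A p l = - c * det2 A ord0 p by rewrite /det2 Al !mxE; ring.
by rewrite mulf_neq0// oppr_eq0.
Qed.

Lemma act_inj A g h : nondegenerate alpha A -> gauge_ok g -> gauge_ok h ->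
  act g A = act h A -> g = h.
Proof.
move=> /chart_exists[p [q [s cA]]] okg okh gh.
by rewrite -(transport_act okg cA) gh (transport_act okh cA).
Qed.

(* Near [x], the unique [g] with [B = act g A] is given by [transport]. *)
Lemma gauge_difference (X : topologicalType) (A B : X -> rep) :
  continuous A -> continuous B -> (forall x, nondegenerate alpha (A x)) ->
  (forall x, gauge_equiv (A x) (B x)) ->
  exists g : X -> gauge, [/\ continuous g, forall x, gauge_ok (g x) &
    forall x, B x = act (g x) (A x)].
Proof.
move=> cA cB ndA AB.
have /choice[g gP] : forall x, exists g, gauge_ok g /\ B x = act g (A x).
  by move=> x; exact: gauge_equivP.
exists g; split=> [x|x|x]; [|by case: (gP x)|by case: (gP x)].
have [p [q [s cAx]]] := chart_exists (ndA x).
have gE y : chart p q s (A y) -> g y = transport p q s (A y) (B y).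
  by have [ok ->] := gP y; move/(transport_act ok).
have cBx : chart p q s (B x) by have [ok ->] := gP x; exact: chart_act.
rewrite /continuous_at gE//.
apply: cvg_trans (transport_cvg cA cB cAx cBx).
apply: near_eq_cvg; apply: filterS (chart_near cA cAx) => y cAy.
by rewrite gE.
Qed.

End Freeness.
End Gauge.

(** * Local sections over the moduli space *)

Section Moduli.
Context {R : realType} {k : nat} (alpha : 'I_k.+2 -> R).
Local Notation C := R[i].
Local Notation E := (stable_rep alpha).
Local Notation M := (moduli_space alpha).
Hypothesis alpha_lt0 : forall j : 'I_k.+1, alpha (outer j) < 0.
Hypothesis alpha0E : alpha ord0 = - (2^-1 * \sum_(j < k.+1) alpha (outer j)).

Definition stable_elt (A : quiver_rep R k.+1) (stA : stable alpha A) : E :=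
  exist _ A (mem_set stA).

Definition orbit_class (A : E) : M := \pi_M A.

Lemma orbit_class_continuous : continuous orbit_class.
Proof. exact: pi_continuous. Qed.

Lemma orbit_classK (b : M) : orbit_class (repr b) = b.
Proof. exact: reprK. Qed.

Lemma orbit_classP (A B : E) :
  orbit_class A = orbit_class B <-> gauge_equiv (val A) (val B).
Proof. by split=> [/eqmodP/asboolP//|AB]; apply/eqmodP/asboolP. Qed.

Lemma stable_rep_nondegenerate (A : E) : nondegenerate alpha (val A).
Proof. by apply/stableP => //; exact: set_mem (valP A). Qed.

Lemma act_stable_rep (X : topologicalType) (g : X -> @gauge R k) (A : X -> E) :
  continuous g -> continuous A -> (forall x, gauge_ok (g x)) ->
  exists B : X -> E, [/\ continuous B, forall x, val (B x) = act (g x) (val (A x)) &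
    forall x, orbit_class (B x) = orbit_class (A x)].
Proof.
move=> cg cA ok.
have st x : stable alpha (act (g x) (val (A x))).
  apply/stableP => //; apply: act_nondegenerate => //.
  exact: stable_rep_nondegenerate.
exists (fun x => stable_elt (st x)); split=> [|//|x].
  by apply: set_type_continuous; apply: act_continuous => //; exact: val_continuous.
by apply/esym/orbit_classP; exact: gauge_equiv_act.
Qed.

Lemma stable_rep_difference (X : topologicalType) (A B : X -> E) :
  continuous A -> continuous B -> (forall x, orbit_class (A x) = orbit_class (B x)) ->
  exists g : X -> @gauge R k, [/\ continuous g, forall x, gauge_ok (g x) &
    forall x, val (B x) = act (g x) (val (A x))].
Proof.
move=> cA cB AB; apply: (gauge_difference alpha_lt0 alpha0E);
  [exact: val_continuous|exact: val_continuous|move=> x; exact: stable_rep_nondegenerate|].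
by move=> x; apply/orbit_classP.
Qed.

(** On the chart around the representative of [b0], the section is the normal form
    [N A = act (transport p q s A A0) A]. It is continuous upstairs and constant on orbits, so it
    descends to the moduli space. *)
Lemma local_section (b0 : M) : exists (V : set M) (sigma : M -> E),
  [/\ open V, V b0, forall b, V b -> {for b, continuous sigma} &
      forall b, V b -> orbit_class (sigma b) = b].
Proof.
pose A0 := val (repr b0).
have [p [q [s cA0]]] := chart_exists alpha_lt0 alpha0E (stable_rep_nondegenerate (repr b0)).
(* Although [V] is phrased with representatives, the chart is invariant under the group, so the
   preimage of [V] is the whole chart. *)
pose V : set M := [set b | chart p q s (val (repr b))].
have repr_chart (A : E) : V (orbit_class A) <-> chart p q s (val A).
  have /orbit_classP/gauge_equivP[g [ok AE]] := orbit_classK (orbit_class A).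
  have /orbit_classP/gauge_equivP[h [okh AE']] := esym (orbit_classK (orbit_class A)).
  by rewrite /V /=; split=> cA; [rewrite AE|rewrite AE']; exact: chart_act.
have chart_open : open [set A : E | chart p q s (val A)].
  rewrite openE => A /= cA; apply: (chart_near _ cA).
  by apply: val_continuous => ?; exact: cvg_id.
have st (A : E) : chart p q s (val A) -> stable alpha (act (transport p q s (val A) A0) (val A)).
  move=> cA; apply/stableP => //; apply: act_nondegenerate.
    exact: transport_ok.
  exact: stable_rep_nondegenerate.
(* Outside the chart the value [A] is a dummy; no continuity is claimed there. *)
pose N (A : E) : E := if pselect (chart p q s (val A)) is left cA
  then stable_elt (st A cA) else A.
have NE (A : E) : chart p q s (val A) -> val (N A) = act (transport p q s (val A) A0) (val A).
  by rewrite /N; case: pselect.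
have Npi (A : E) : chart p q s (val A) -> N (repr (orbit_class A)) = N A.
  move=> cA; have /orbit_classP/gauge_equivP[g [ok AE]] := esym (orbit_classK (orbit_class A)).
  apply/val_inj; rewrite !NE//; last by rewrite AE; exact: chart_act.
  by rewrite AE transport_invariant.
have Ncont (A : E) : chart p q s (val A) -> {for A, continuous N}.
  move=> cA; rewrite /prop_for /continuous_at.
  have vc : continuous (fun B : E => val B) by apply: val_continuous => ?; exact: cvg_id.
  move=> W; rewrite nbhsE => -[_ [[W' oW' <-] NW]] WW.
  have : act (transport p q s (val B) A0) (val B) @[B --> A] --> val (N A).
    rewrite NE//; have cc : continuous (fun _ : E => A0) by exact: cst_continuous.
    exact: (act_cvg (FF := nbhs_filter A)
      (@transport_cvg R k p q s E (fun B : E => val B) (fun=> A0) A vc cc cA cA0) (vc A)).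
  move=> /(_ W' (open_nbhs_nbhs (conj oW' NW))).
  rewrite /nbhs /= => H; have cH : nbhs A [set B : E | chart p q s (val B)].
    by apply: open_nbhs_nbhs; split.
  apply: (filterS (Filter := nbhs_filter A)) (filterI (Filter := nbhs_filter A) H cH) => B [/= WB cB]; apply: WW => /=.
  by rewrite set_valE NE.
exists V, (N \o repr); split.
- rewrite /open /= /quotient_open (_ : _ @^-1` V = [set A : E | chart p q s (val A)])//.
  by apply/seteqP; split=> A /= /repr_chart.
- exact: cA0.
(* The map [repr] has no continuity of its own. Openness is checked upstairs in the quotient
   topology, where [Npi] removes [repr]. *)
- move=> b Vb W; rewrite nbhsE => -[W' [oW' NW]] WW.
  pose U : set M := V `&` [set b' | W' (N (repr b'))].
  suff oU : open U.
    have : nbhs b U by apply: open_nbhs_nbhs; split.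
    by apply: (filterS (Filter := nbhs_filter b)) => b' [_ ?]; exact: WW.
  rewrite /open /= /quotient_open openE => A [/repr_chart cA /=].
  rewrite -/(orbit_class A) Npi// => WNA.
  have := Ncont A cA W' (open_nbhs_nbhs (conj oW' WNA)).
  rewrite /nbhs /= /interior => H.
  have cH : nbhs A [set B : E | chart p q s (val B)] by apply: open_nbhs_nbhs; split.
  apply: (filterS (Filter := nbhs_filter A)) (filterI (Filter := nbhs_filter A) H cH) => B [/= WB cB]; split; first exact/repr_chart.
  by rewrite /= -/(orbit_class B) Npi.
- move=> b Vb /=; rewrite -[RHS]orbit_classK; apply/esym/orbit_classP.
  by rewrite NE//; apply: gauge_equiv_act; exact: transport_ok.
Qed.

End Moduli.

(** * Lifting maps on cubes to stable representations *)

Section CubeLifting.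
Context {R : realType} {k : nat} (alpha : 'I_k.+2 -> R).
Local Notation E := (stable_rep alpha).
Local Notation M := (moduli_space alpha).
Hypothesis alpha_lt0 : forall j : 'I_k.+1, alpha (outer j) < 0.
Hypothesis alpha0E : alpha ord0 = - (2^-1 * \sum_(j < k.+1) alpha (outer j)).
Variables (m : nat) (f : 'rV[R]_m -> M).
Hypothesis cf : continuous f.
Implicit Types a b t : 'rV[R]_m.

Definition liftable a b := exists F : 'rV[R]_m -> E,
  continuous F /\ forall t, box a b t -> orbit_class (F t) = f t.

Definition set_coord b i (c : R) : 'rV[R]_m :=
  \row_j (if j == i then c else b ord0 j).

(** On the common face the two lifts differ by a continuous gauge-valued map. Retracting the space
    onto that face extends this map everywhere, and acting by it on the second lift makes the two
    agree on the face. *)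
Lemma liftable_glue a b i c : (forall j, a ord0 j <= b ord0 j) ->
  a ord0 i <= c <= b ord0 i ->
  liftable a (set_coord b i c) -> liftable (set_coord a i c) b -> liftable a b.
Proof.
set a' := set_coord a i c; set b' := set_coord b i c.
move=> ab /andP[ac cb] [F1 [cF1 f1]] [F2 [cF2 f2]].
have ab' j : a ord0 j <= b' ord0 j by rewrite mxE; case: eqP => [->|].
have a'b j : a' ord0 j <= b ord0 j by rewrite mxE; case: eqP => [->|].
have a'b' j : a' ord0 j <= b' ord0 j by rewrite !mxE; case: eqP.
have ccl (x y : 'rV[R]_m) : continuous (box_clamp x y) by exact: box_clamp_continuous.
have comp_c (F : 'rV[R]_m -> E) x y : continuous F -> continuous (F \o box_clamp x y).
  by move=> cF t; apply: continuous_comp; [exact: ccl|exact: cF].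
have face1 t : box a b' (box_clamp a' b' t).
  move=> j; have := box_clamp_in t a'b' j => /andP[+ ->]; rewrite andbT.
  by apply: le_trans; rewrite mxE; case: eqP => [->|].
have face2 t : box a' b (box_clamp a' b' t).
  move=> j; have := box_clamp_in t a'b' j => /andP[-> /=] /le_trans; apply.
  by rewrite mxE; case: eqP => [->|].
(* The box from [a'] to [b'] is the common face; clamping to it makes [g] total. *)
have [|g [cg ok gE]] := stable_rep_difference alpha_lt0 alpha0E
    (comp_c F2 a' b' cF2) (comp_c F1 a' b' cF1).
  by move=> t /=; rewrite f1 ?f2.
have [F3 [cF3 F3E f3]] := act_stable_rep alpha_lt0 alpha0E cg (comp_c F2 a' b cF2) ok.
exists (fun t => if t ord0 i <= c then F1 (box_clamp a b' t) else F3 t); split.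
  apply: if_continuous => //; [exact: coord_continuous|exact: comp_c|].
  move=> t tc; apply/val_inj; rewrite F3E /=.
  (* On the hyperplane where the coordinate [i] equals [c], clamping to the upper box is clamping to
     the common face. *)
  have -> : box_clamp a' b t = box_clamp a' b' t.
    apply/rowP => j; rewrite !mxE; case: eqP => [->|//].
    by rewrite tc minxx (min_idPr cb) maxxx.
  rewrite -gE /=; congr (val (F1 _)).
  apply/rowP => j; rewrite !mxE; case: eqP => [->|//].
  by rewrite tc minxx maxxx (max_idPr ac).
move=> t tab; case: leP => tc.
  have tb : box a b' t.
    by move=> j; have := tab j; rewrite mxE; case: eqP => [->/andP[-> _]|].
  by rewrite box_clamp_id// f1.
have ta : box a' b t.
  by move=> j; have := tab j; rewrite mxE; case: eqP => [->/andP[_ ->]|//]; rewrite (ltW tc).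
by rewrite f3 /= box_clamp_id// f2.
Qed.

Definition small_boxes_liftable (r : R) := forall a b, cube R m a -> cube R m b ->
  (forall i, a ord0 i <= b ord0 i) -> (forall i, b ord0 i - a ord0 i <= r) ->
  liftable a b.

Lemma set_coord_cube a i c : cube R m a -> 0 <= c <= 1 -> cube R m (set_coord a i c).
Proof. by move=> ca c01 j; rewrite mxE; case: eqP. Qed.

(** Boxes are bisected in one direction at a time; the induction is on the number [s] of directions
    in which the width may be as large as [2 * r]. *)
Lemma small_boxes_double r : small_boxes_liftable r -> small_boxes_liftable (2 * r).
Proof.
move=> Hr.
suff H (s : nat) : (s <= m)%N -> forall a b, cube R m a -> cube R m b ->
    (forall i, a ord0 i <= b ord0 i) ->
    (forall i : 'I_m, b ord0 i - a ord0 i <= if (i < s)%N then 2 * r else r) ->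
    liftable a b.
  by move=> a b ca cb ab abr; apply: (H m) => // i; rewrite ltn_ord.
elim: s => [_|s IH sm] a b ca cb ab abr; first exact: Hr.
pose i := Ordinal sm; pose c := (a ord0 i + b ord0 i) / 2.
have ri := abr i; rewrite ltnSn in ri.
have c_bounds : a ord0 i <= c <= b ord0 i by have := ab i; rewrite /c; lra.
have c01 : 0 <= c <= 1 by have := ca i; have := cb i; move: c_bounds; lra.
apply: (liftable_glue ab c_bounds).
  apply: IH; rewrite ?(ltnW sm)//; first exact: set_coord_cube.
    by move=> j; rewrite mxE; case: eqP => [->|//]; case/andP: c_bounds.
  move=> j; rewrite mxE; case: eqP => [->|/eqP ji].
    by rewrite ltnn /c; move: ri; lra.
  by have := abr j; rewrite ltnS leq_eqVlt (_ : (j == s :> nat) = false)//; apply/negbTE.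
apply: IH; rewrite ?(ltnW sm)//; first exact: set_coord_cube.
  by move=> j; rewrite mxE; case: eqP => [->|//]; case/andP: c_bounds.
move=> j; rewrite mxE; case: eqP => [->|/eqP ji].
  by rewrite ltnn /c; move: ri; lra.
by have := abr j; rewrite ltnS leq_eqVlt (_ : (j == s :> nat) = false)//; apply/negbTE.
Qed.

(** A Lebesgue number argument: each point has a ball mapped into the domain of a local section. A
    box of width below half the radius that meets the ball of half the radius lies in the full ball,
    where the section supplies the lift. *)
Lemma small_boxes_exist : exists2 r : R, 0 < r & small_boxes_liftable r.
Proof.
have /compact_near_coveringP cov := @cube_compact R m.
pose P (r : R) t := 0 < r /\ forall a b, box a b t -> (forall i, a ord0 i <= b ord0 i) ->
  (forall i, b ord0 i - a ord0 i <= r) -> liftable a b.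
have : (0^'+ : set_system R) [set r | cube R m `<=` P r].
  apply: (cov R (0^'+) P) => t0 _.
  have [V [sigma [oV Vt cs sV]]] := local_section alpha_lt0 alpha0E (f t0).
  have : nbhs t0 (f @^-1` V) by apply: cf; exact: open_nbhs_nbhs.
  move=> /nbhs_ballP[r /= r0 rV].
  have r20 : 0 < r / 2 by rewrite divr_gt0.
  exists (ball t0 (r / 2), [set e | 0 < e < r / 2]).
    split=> /=; first exact: nbhsx_ballx.
    by near=> e; apply/andP; split; near: e; [exact: nbhs_right_gt|exact: nbhs_right_lt].
  move=> [t e] /= [ht /andP[e0 er]]; split=> // a b abt ab abe.
  have inV u : box a b u -> V (f u).
    move=> abu; apply: rV; rewrite [r]splitr; apply: ball_triangle ht _.
    rewrite -ball_normE /=; apply: le_lt_trans er; apply: mx_norm_le; first exact: ltW.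
    move=> i j; rewrite (ord1 i) !mxE ler_norml.
    by have := abt j; have := abu j; have := abe j; lra.
  exists (fun u => sigma (f (box_clamp a b u))); split.
    move=> u; apply: (continuous_comp (f := fun u => f (box_clamp a b u)) (g := sigma)).
      by apply: continuous_comp; [exact: box_clamp_continuous|exact: cf].
    by apply: cs; apply: inV; exact: box_clamp_in.
  by move=> u abu; rewrite box_clamp_id// sV//; exact: inV.
move=> /filter_ex[r Pr]; exists (if 0 < r then r else 1); first by case: ifPn.
move=> a b ca cb ab abr; have [r0 H] := Pr a ca; rewrite r0 in abr.
by apply: H => // i; rewrite lexx ab.
Unshelve. all: by end_near. Qed.

Lemma cube_lift : exists F : 'rV[R]_m -> E,
  continuous F /\ forall t, cube R m t -> orbit_class (F t) = f t.
Proof.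
have [r r0 Hr] := small_boxes_exist.
have H N : small_boxes_liftable (2 ^+ N * r).
  elim: N => [|N IH]; first by rewrite expr0 mul1r.
  by rewrite exprS -mulrA; exact: small_boxes_double.
have [N HN] : exists N, 1 <= 2 ^+ N * r.
  pose N := (Num.truncn r^-1).+1; exists N.
  rewrite -ler_pdivrMr// mul1r; apply: (@le_trans _ _ N%:R); first exact/ltW/truncnS_gt.
  by rewrite -natrX ler_nat ltnW// ltn_expl.
have [||||F [cF fF]] := H N 0 (const_mx 1).
- by move=> i; rewrite mxE lexx ler01.
- by move=> i; rewrite mxE lexx ler01.
- by move=> i; rewrite !mxE.
- by move=> i; rewrite !mxE subr0.
by exists F; split=> // t ct; apply: fF => i; rewrite !mxE.
Qed.

End CubeLifting.

(** * Retraction of the cube onto all its faces but one *)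

Section Retraction.
Context {R : realType} {m : nat}.
Implicit Types t : 'rV[R]_m.+1.

(** The union of all faces except the one where the last coordinate is 1, which will be called the
    top face. *)
Definition horn : set 'rV[R]_m.+1 := [set t | cube R m.+1 t /\
  ((exists i, t ord0 i = 0) \/ exists2 i, i != ord_max & t ord0 i = 1)].

Definition centred t : 'rV[R]_m.+1 :=
  \row_i (if i == ord_max then 0 else 2 * t ord0 i - 1).

(** Along the ray from the centre of projection through [t], displacements are multiplied by
    [2 / dilation t]. The bottom face is reached when the dilation is [2 - t ord0 ord_max], the
    first side face when it is twice the norm of [centred t]; the maximum selects the face met
    first. *)
Definition dilation t : R := Num.max (2 * `|centred t|) (2 - t ord0 ord_max).

(* The projection of the cube to the horn from the point at height 2 above the
  centre of the cube. *)
Definition horn_projection t : 'rV[R]_m.+1 :=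
  \row_i (if i == ord_max then 2 - 2 * (2 - t ord0 i) / dilation t
          else centred t ord0 i / dilation t + 2^-1).

Definition horn_retraction t := horn_projection (clamp t).

Lemma dilation_ge1 t : cube R m.+1 t -> 1 <= dilation t.
Proof. by move=> ct; rewrite le_max; have := ct ord_max; lra. Qed.

Lemma horn_retraction_continuous : continuous horn_retraction.
Proof.
pose c := @clamp_continuous R m.+1.
have cx i : continuous (fun t : 'rV[R]_m.+1 => clamp t ord0 i).
  exact: mx_coord_continuous.
have ccst (x : R) : continuous (fun t : 'rV[R]_m.+1 => x) by exact: cst_continuous.
have ccen : continuous (fun t : 'rV[R]_m.+1 => centred (clamp t)).
  apply: continuous_row => i; under eq_fun do rewrite mxE.
  case: eqP => _; first exact: ccst.
  by apply: (@subr_fun_continuous _ R R) => //; apply: mulr_fun_continuous.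
have cdil : continuous (fun t : 'rV[R]_m.+1 => dilation (clamp t)).
  apply: maxr_continuous; last by apply: (@subr_fun_continuous _ R R).
  apply: mulr_fun_continuous => // t.
  by apply: continuous_comp; [exact: ccen|exact: norm_continuous].
have cinv : continuous (fun t : 'rV[R]_m.+1 => (dilation (clamp t))^-1).
  apply: invr_fun_continuous => // t; rewrite gt_eqF//.
  by apply: lt_le_trans (dilation_ge1 (clamp_cube t)).
apply: continuous_row => i; under eq_fun do rewrite mxE.
case: eqP => _.
  apply: (@subr_fun_continuous _ R R) => //; apply: mulr_fun_continuous => //.
  apply: mulr_fun_continuous => //.
  by apply: (@subr_fun_continuous _ R R).
apply: (@addr_fun_continuous _ R R) => //; apply: mulr_fun_continuous => //.
exact: mx_coord_continuous.
Qed.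

Lemma centred_norm t : cube R m.+1 t -> `|centred t| <= 1.
Proof.
move=> ct; apply: mx_norm_le => // i j; rewrite mxE; case: eqP => _.
  by rewrite normr0.
by have := ct j; rewrite ler_norml; lra.
Qed.

Lemma horn_projectionE t i : horn_projection t ord0 i =
  if i == ord_max then 2 - 2 * (2 - t ord0 i) / dilation t
  else centred t ord0 i / dilation t + 2^-1.
Proof. by rewrite mxE. Qed.

Lemma horn_projection_horn t : cube R m.+1 t -> horn (horn_projection t).
Proof.
move=> ct; have d1 := dilation_ge1 ct; have d0 : 0 < dilation t by lra.
have h1 : 2 * `|centred t| <= dilation t by rewrite le_max lexx.
have h2 : 2 - t ord0 ord_max <= dilation t by rewrite le_max lexx orbT.
have cN := centred_norm ct; have ctm := ct ord_max.
(* Since [|centred t| <= 1 <= 2 - t ord0 ord_max], the displacement factor is large enough for the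
   last coordinate of the projection to be at most 1. *)
have h3 : dilation t <= 2 * (2 - t ord0 ord_max) by rewrite ge_max; lra.
split.
  move=> i; rewrite horn_projectionE; case: eqP => [->|_].
    have : (2 - t ord0 ord_max) / dilation t <= 1 by rewrite ler_pdivrMr// mul1r.
    have : 2^-1 <= (2 - t ord0 ord_max) / dilation t by rewrite ler_pdivlMr//; lra.
    by rewrite -mulrA; lra.
  have : `|centred t ord0 i / dilation t| <= 2^-1.
    rewrite normrM normfV (gtr0_norm d0) ler_pdivrMr//.
    by have := mx_norm_entry (centred t) ord0 i; lra.
  by rewrite ler_norml; lra.
case: (leP (2 * `|centred t|) (2 - t ord0 ord_max)) => h.
  left; exists ord_max; rewrite horn_projectionE eqxx /dilation (max_idPr h).
  by rewrite mulfK ?subrr//; lra.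
have dE : dilation t = 2 * `|centred t| by rewrite /dilation (max_idPl (ltW h)).
have N0 : `|centred t| != 0 by rewrite gt_eqF//; move: d0; rewrite dE; lra.
(* A coordinate attaining the norm tells which side face is hit; its sign distinguishes the faces 1
   and 0. *)
have [[i0 i]] := mx_norm_neq0 N0; rewrite /= (ord1 i0) => Ni.
have im : i != ord_max.
  by apply: contra_neq N0 => im; rewrite [LHS]Ni mxE im eqxx normr0.
have {}Ni : `|centred t| = `|centred t ord0 i| by [].
have [ge0|lt0] := leP 0 (centred t ord0 i).
  right; exists i => //; rewrite horn_projectionE (negbTE im) dE.
  rewrite Ni ger0_norm// invfM mulrCA mulfV ?mulr1; first lra.
  by move: N0; rewrite Ni ger0_norm.
left; exists i; rewrite horn_projectionE (negbTE im) dE.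
rewrite Ni ltr0_norm// invfM mulrCA invrN mulrN mulfV; first lra.
by rewrite lt_eqF.
Qed.

(** On the horn the dilation equals 2, so the ray is followed exactly up to [t]. *)
Lemma horn_projection_id t : horn t -> horn_projection t = t.
Proof.
move=> [ct tJ]; have cN := centred_norm ct; have ctm := ct ord_max.
suff d2 : dilation t = 2.
  apply/rowP => i; rewrite horn_projectionE d2; case: eqP => [->|/eqP im].
    by lra.
  by rewrite mxE (negbTE im); lra.
apply/eqP; rewrite eq_le ge_max le_max; apply/andP; split; first lra.
have entry i : i != ord_max -> `|2 * t ord0 i - 1| <= `|centred t|.
  by move=> im; have := mx_norm_entry (centred t) ord0 i; rewrite mxE (negbTE im).
case: tJ => [[i ti]|[i im ti]].
  have [im|im] := eqVneq i ord_max; first by move: ti; rewrite im => ->; rewrite subr0 lexx orbT.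
  by have := entry i im; rewrite ti mulr0 sub0r normrN1; lra.
by have := entry i im; rewrite ti (_ : 2 * 1 - 1 = 1) ?normr1; lra.
Qed.

Lemma horn_retraction_horn t : horn (horn_retraction t).
Proof. by apply: horn_projection_horn; exact: clamp_cube. Qed.

Lemma horn_retraction_id t : horn t -> horn_retraction t = t.
Proof.
by move=> Jt; rewrite /horn_retraction clamp_id ?horn_projection_id//; case: Jt.
Qed.

End Retraction.

(** * Lifts with prescribed values on all faces but one *)

Section RelativeLifting.
Context {R : realType} {k : nat} (alpha : 'I_k.+2 -> R).
Local Notation E := (stable_rep alpha).
Local Notation M := (moduli_space alpha).
Hypothesis alpha_lt0 : forall j : 'I_k.+1, alpha (outer j) < 0.
Hypothesis alpha0E : alpha ord0 = - (2^-1 * \sum_(j < k.+1) alpha (outer j)).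

(** Any lift [F0], restricted along the retraction, has the same orbits as [Phi]; acting on [F0] by
    the resulting gauge-valued map keeps it a lift and gives it the values of [Phi] on the horn. *)
Lemma relative_lift m (f : 'rV[R]_m.+1 -> M) (Phi : 'rV[R]_m.+1 -> E) :
  continuous f -> continuous Phi ->
  (forall t, orbit_class (Phi t) = f (horn_retraction t)) ->
  exists F : 'rV[R]_m.+1 -> E, [/\ continuous F,
    forall t, cube R m.+1 t -> orbit_class (F t) = f t &
    forall t, horn t -> F t = Phi t].
Proof.
move=> cf cPhi Phif; have [F0 [cF0 F0f]] := cube_lift alpha_lt0 alpha0E cf.
have cF0r : continuous (F0 \o horn_retraction).
  by move=> t; apply: continuous_comp; [exact: horn_retraction_continuous|exact: cF0].
have [|g [cg ok gE]] := stable_rep_difference alpha_lt0 alpha0E cF0r cPhi.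
  by move=> t /=; rewrite Phif F0f//; case: (horn_retraction_horn t).
have [F [cF FE Ff]] := act_stable_rep alpha_lt0 alpha0E cg cF0 ok.
exists F; split=> // t; first by move=> ct; rewrite Ff F0f.
by move=> Jt; apply/val_inj; rewrite FE gE /= horn_retraction_id.
Qed.

End RelativeLifting.

(** * Deformation of the gauge group onto its unitary part *)

Lemma convex_gt0 (F : numFieldType) (s x : F) : 0 <= s <= 1 -> 0 < x ->
  0 < 1 - s + s * x.
Proof.
move=> /andP[s0 s1] x0; have [->|s_neq1] := eqVneq s 1; first by rewrite subrr add0r mul1r.
by rewrite ltr_pwDl ?mulr_ge0 ?(ltW x0)// subr_gt0 lt_neqAle s_neq1.
Qed.

(** Here [a'] and [b'] stand for the conjugates of the first row, [N] for its norm and [n] for the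
    modulus of the determinant [D]. The determinant along the segment from a matrix to its
    orthonormalisation is [D] times two factors which are positive for [s] in the unit interval. *)
Lemma polar_det (F : fieldType) (a b c d a' b' N n s : F) :
  N != 0 -> n != 0 -> N ^+ 2 = a * a' + b * b' ->
  let D := a * d - b * c in let e := D / n in
  ((1 - s) * a + s * (a / N)) * ((1 - s) * d + s * (a' * e / N)) -
  ((1 - s) * b + s * (b / N)) * ((1 - s) * c + s * (- b' * e / N)) =
  (1 - s + s * N^-1) * (1 - s + s * (N / n)) * D.
Proof.
move=> N0 n0 N2 /=; set D := a * d - b * c; set e := D / n.
have e1 : (a * a' + b * b') * e / N = N * e by rewrite -N2; field.
transitivity ((1 - s + s * N^-1) * ((1 - s) * D + s * ((a * a' + b * b') * e / N))).
  by rewrite /D; ring.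
by rewrite e1 /e; ring.
Qed.

(** The four entries of [V V^* = 1] for the orthonormalised matrix [V], with primes for conjugates
    and [e] the phase of the determinant. *)
Lemma polar_orthonormal (F : fieldType) (a b a' b' e e' N : F) :
  N != 0 -> N ^+ 2 = a * a' + b * b' -> e * e' = 1 ->
  [/\ a / N * (a' / N) + b / N * (b' / N) = 1,
      a / N * (- b * e' / N) + b / N * (a * e' / N) = 0,
      - b' * e / N * (a' / N) + a' * e / N * (b' / N) = 0 &
      - b' * e / N * (- b * e' / N) + a' * e / N * (a * e' / N) = 1].
Proof.
move=> N0 N2 ee; have N20 : N ^+ 2 != 0 by rewrite expf_neq0.
split; [|by ring|by ring|].
  transitivity ((a * a' + b * b') / N ^+ 2); first by field.
  by rewrite -N2 mulfV.
transitivity ((a * a' + b * b') * (e * e') / N ^+ 2); first by field.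
by rewrite ee mulr1 -N2 mulfV.
Qed.

Section Polar.
Context {R : realType} {k : nat}.
Local Notation C := R[i].
Local Notation U := (unitary_product R k.+1).
Local Notation gauge := (@gauge R k).

Definition row_norm (M : 'M[C]_2) : R :=
  Num.sqrt (complex.Re (`|M 0 0| ^+ 2 + `|M 0 1| ^+ 2)).

(* The Gram-Schmidt orthonormalisation of the rows; the second row is a unit
  vector orthogonal to the first one, and is determined by the phase of the
  determinant. *)
Definition unitary_part (M : 'M[C]_2) : 'M[C]_2 :=
  let N := (row_norm M)%:C%C in let e := \det M / `|\det M| in
  \matrix_(i, j) (if i == 0 then M 0 j / N
                  else if j == 0 then - (M 0 1)^* * e / N else (M 0 0)^* * e / N).

Lemma unitary_partE M : [/\ unitary_part M 0 0 = M 0 0 / (row_norm M)%:C%C,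
  unitary_part M 0 1 = M 0 1 / (row_norm M)%:C%C,
  unitary_part M 1 0 = - (M 0 1)^* * (\det M / `|\det M|) / (row_norm M)%:C%C &
  unitary_part M 1 1 = (M 0 0)^* * (\det M / `|\det M|) / (row_norm M)%:C%C].
Proof. by split; rewrite mxE. Qed.

Lemma row_norm_sqr M :
  (row_norm M)%:C%C ^+ 2 = M 0 0 * (M 0 0)^* + M 0 1 * (M 0 1)^*.
Proof.
rewrite -!normCK -rmorphXn /= sqr_sqrtr.
  by rewrite RRe_real// rpredD// ger0_real// exprn_ge0.
by rewrite -lecR RRe_real ?addr_ge0 ?exprn_ge0// rpredD// ger0_real// exprn_ge0.
Qed.

Lemma row_norm_neq0 M : M \in unitmx -> (row_norm M)%:C%C != 0.
Proof.
rewrite unitmxE unitfE det_mx2 => D0; apply: contraNneq D0 => N0.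
have := row_norm_sqr M; rewrite N0 expr0n -!normCK => /esym/eqP.
rewrite paddr_eq0 ?exprn_ge0// !sqrf_eq0 !normr_eq0 => /andP[/eqP -> /eqP ->].
by rewrite !mul0r subrr.
Qed.

Lemma row_norm_gt0 M : M \in unitmx -> 0 < (row_norm M)%:C%C.
Proof. by move=> /row_norm_neq0 N0; rewrite lt_neqAle eq_sym N0 lecR sqrtr_ge0. Qed.

Lemma unitary2P (M : 'M[C]_2) : reflect
  [/\ M 0 0 * (M 0 0)^* + M 0 1 * (M 0 1)^* = 1,
      M 0 0 * (M 1 0)^* + M 0 1 * (M 1 1)^* = 0,
      M 1 0 * (M 0 0)^* + M 1 1 * (M 0 1)^* = 0 &
      M 1 0 * (M 1 0)^* + M 1 1 * (M 1 1)^* = 1] (M \is unitarymx).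
Proof.
have E i j : (M *m (M ^t*)%sesqui) i j = M i 0 * (M j 0)^* + M i 1 * (M j 1)^*.
  rewrite mxE big_ord_recl big_ord1.
  by have -> : lift ord0 ord0 = 1 :> 'I_2 by [exact/val_inj]; rewrite !mxE.
apply: (iffP unitarymxP) => [MM|[h1 h2 h3 h4]].
  by split; rewrite -E MM mxE.
apply/matrixP => i j; rewrite E mxE.
by have [->|->] := ord2_cases i; have [->|->] := ord2_cases j.
Qed.

Lemma conj_norm1 (z : C) : z != 0 -> (z / `|z|) * (z / `|z|)^* = 1.
Proof.
move=> z0; rewrite -normCK normf_div normr_id mulfV ?expr1n//.
by rewrite normr_eq0.
Qed.

Lemma conjc_real (x : R) : (x%:C%C)^* = x%:C%C.
Proof. by rewrite /Num.conj /= oppr0. Qed.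

Lemma unitary_part_unitary M : M \in unitmx -> unitary_part M \is unitarymx.
Proof.
move=> Mu; have N0 := row_norm_neq0 Mu; have N2 := row_norm_sqr M.
have D0 : \det M != 0 by rewrite -unitfE -unitmxE.
have ee := conj_norm1 D0.
have cJ (z : C) : (z / (row_norm M)%:C%C)^* = z^* / (row_norm M)%:C%C.
  by rewrite rmorphM fmorphV; congr (_ * _^-1); exact: conjc_real.
have cM (z w : C) : (z * w)^* = z^* * w^* by exact: rmorphM.
have cN (z : C) : (- z)^* = - z^* by exact: rmorphN.
apply/unitary2P; have [-> -> -> ->] := unitary_partE M.
rewrite !cJ !(cM _ (_ / _)) !cN !conjCK.
exact: polar_orthonormal.
Qed.

(** The first row of a unitary matrix has norm 1, and its second row is the determinant times the
    conjugate orthogonal of the first. So nothing changes, which makes the deformation constant on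
    unitary elements. *)
Lemma unitary_part_id M : M \is unitarymx -> unitary_part M = M.
Proof.
move=> /unitary2P[h1 h2 h3 h4].
have N1 : row_norm M = 1.
  rewrite /row_norm !normCK; have -> : M 0 0 * (M 0 0)^* + M 0 1 * (M 0 1)^* = 1 by [].
  by rewrite /= sqrtr1.
have DD : \det M * (\det M)^* = 1.
  rewrite det_mx2 rmorphB !rmorphM /= -[RHS]mulr1 -{1}h1 -h4.
  have := h2; have := h3.
  move: (M 0 0) (M 0 1) (M 1 0) (M 1 1) (M 0 0)^* (M 0 1)^* (M 1 0)^* (M 1 1)^*.
  move=> a b c d a' b' c' d' e1 e2.
  transitivity ((a * a' + b * b') * (c * c' + d * d') - (a * c' + b * d') * (c * a' + d * b')).
    by ring.
  by rewrite e2 mul0r subr0.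
have n1 : `|\det M| = 1.
  by apply/eqP; rewrite -(@pexpr_eq1 _ _ 2)// normCK DD.
have [E1 E2 E3 E4] := unitary_partE M.
rewrite N1 n1 !divr1 in E1 E2 E3 E4.
apply/matrixP => i j; have [->|->] := ord2_cases i; have [->|->] := ord2_cases j;
  rewrite ?E1 ?E2 ?E3 ?E4 // det_mx2; move: h1 h3.
  move: (M 0 0) (M 0 1) (M 1 0) (M 1 1) (M 0 0)^* (M 0 1)^* => a b c d a' b' e1 e2.
  transitivity ((a * a' + b * b') * c - a * (c * a' + d * b')); first by ring.
  by rewrite e1 e2 mulr0 subr0 mul1r.
move: (M 0 0) (M 0 1) (M 1 0) (M 1 1) (M 0 0)^* (M 0 1)^* => a b c d a' b' e1 e2.
transitivity ((a * a' + b * b') * d - b * (c * a' + d * b')); first by ring.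
by rewrite e1 e2 mulr0 subr0 mul1r.
Qed.

Lemma unitary_part_continuous (X : topologicalType) (M : X -> 'M[C]_2) :
  continuous M -> (forall x, M x \in unitmx) ->
  continuous (fun x => unitary_part (M x)).
Proof.
move=> cM Mu.
have cE i j : continuous (fun x => M x i j) by exact: mx_coord_continuous.
have cn (z : X -> C) : continuous z -> continuous (fun x => `|z x|).
  by move=> cz x; apply: cvg_norm; exact: cz.
have cmul (z w : X -> C) : continuous z -> continuous w -> continuous (fun x => z x * w x).
  exact: mulr_fun_continuous.
have cN : continuous (fun x => ((row_norm (M x))%:C%C)^-1 : C).
  apply: invr_fun_continuous => [x|]; first exact: row_norm_neq0.
  apply: Complex_continuous; last exact: cst_continuous.
  move=> x; apply: (@continuous_comp _ _ _ (fun x => complex.Re (`|M x 0 0| ^+ 2 + `|M x 0 1| ^+ 2)) Num.sqrt);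
    last exact: sqrt_continuous.
  apply: Re_continuous; apply: (@addr_fun_continuous _ C C);
    by apply: cmul; apply: cn.
have cD : continuous (fun x => \det (M x)).
  under eq_fun do rewrite det_mx2.
  exact: (@subr_fun_continuous X C C _ _ (cmul _ _ (cE 0 0) (cE 1 1)) (cmul _ _ (cE 0 1) (cE 1 0))).
have ce : continuous (fun x => \det (M x) / `|\det (M x)|).
  apply: (cmul _ _ cD); apply: invr_fun_continuous; last exact: cn.
  by move=> x; rewrite normr_eq0 -unitfE -unitmxE.
have cJ j : continuous (fun x => (M x 0 j)^*).
  exact: (conjc_continuous (cE 0 j)).
have cJN : continuous (fun x => - (M x 0 1)^*).
  by move=> x; apply: cvgN; exact: cJ.
apply: mx_continuous => i j.
have [->|->] := ord2_cases i; have [->|->] := ord2_cases j.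
- have -> : (fun x => unitary_part (M x) 0 0) = fun x => M x 0 0 / (row_norm (M x))%:C%C.
    by apply/funext => x; have [] := unitary_partE (M x).
  exact: (cmul _ _ (cE 0 0) cN).
- have -> : (fun x => unitary_part (M x) 0 1) = fun x => M x 0 1 / (row_norm (M x))%:C%C.
    by apply/funext => x; have [] := unitary_partE (M x).
  exact: (cmul _ _ (cE 0 1) cN).
- have -> : (fun x => unitary_part (M x) 1 0) =
      fun x => - (M x 0 1)^* * (\det (M x) / `|\det (M x)|) / (row_norm (M x))%:C%C.
    by apply/funext => x; have [] := unitary_partE (M x).
  exact: (cmul _ _ (cmul _ _ cJN ce) cN).
- have -> : (fun x => unitary_part (M x) 1 1) =
      fun x => (M x 0 0)^* * (\det (M x) / `|\det (M x)|) / (row_norm (M x))%:C%C.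
    by apply/funext => x; have [] := unitary_partE (M x).
  exact: (cmul _ _ (cmul _ _ (cJ 0) ce) cN).
Qed.

Definition gauge_deform (s : R) (g : gauge) : gauge :=
  ((1 - s%:C%C) *: g.1 + s%:C%C *: unitary_part g.1,
   fun j => (1 - s%:C%C) * g.2 j + s%:C%C * (g.2 j / `|g.2 j|)).

Lemma gauge_deform0 g : gauge_deform 0 g = g.
Proof.
rewrite /gauge_deform subr0 !scale1r scale0r addr0 [RHS]surjective_pairing.
by congr (_, _); apply/funext => j; rewrite mul1r mul0r addr0.
Qed.

(** Straight segments suffice: [polar_det] shows that the determinant along the segment is a
    positive multiple of the initial one, and each scalar is multiplied by a positive number. The
    normalised scalar stays equal to 1. *)
Lemma gauge_deform_ok s g : 0 <= s <= 1 -> gauge_ok g -> gauge_ok (gauge_deform s g).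
Proof.
move=> s01 /gauge_okP[g1 g2 g20].
have s01C : 0 <= s%:C%C <= (1 : C) by rewrite -(rmorph1 (real_complex R)) !lecR.
apply/gauge_okP; split=> /=.
- have N0 := row_norm_gt0 g1; have D0 : \det g.1 != 0 by rewrite -unitfE -unitmxE.
  have n0 : 0 < `|\det g.1| by rewrite normr_gt0.
  rewrite unitmxE unitfE det_mx2; have [E1 E2 E3 E4] := unitary_partE g.1.
  have dE i j : ((1 - s%:C%C) *: g.1 + s%:C%C *: unitary_part g.1) i j =
      (1 - s%:C%C) * g.1 i j + s%:C%C * unitary_part g.1 i j.
    by rewrite mxE [X in X + _]mxE [X in _ + X]mxE.
  rewrite !dE E1 E2 E3 E4.
  have := polar_det (g.1 1 0) (g.1 1 1) s%:C%C (lt0r_neq0 N0) (lt0r_neq0 n0) (row_norm_sqr g.1).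
  rewrite /= -det_mx2 => ->; rewrite !mulf_neq0// gt_eqF// convex_gt0//.
    by rewrite invr_gt0.
  by rewrite divr_gt0.
- move=> j; have -> : (1 - s%:C%C) * g.2 j + s%:C%C * (g.2 j / `|g.2 j|) =
    (1 - s%:C%C + s%:C%C * `|g.2 j|^-1) * g.2 j by ring.
  by rewrite mulf_neq0// gt_eqF// convex_gt0// invr_gt0 normr_gt0.
- by rewrite g20 normr1 divr1 !mulr1 subrK.
Qed.

Lemma gauge_deform_continuous (X : topologicalType) (s : X -> R) (g : X -> gauge) :
  continuous s -> continuous g -> (forall x, gauge_ok (g x)) ->
  continuous (fun x => gauge_deform (s x) (g x)).
Proof.
move=> cs cg ok.
have [cg1 cg2] := gauge_coord_continuous cg.
have csC : continuous (fun x => (s x)%:C%C : C).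
  by apply: Complex_continuous => //; exact: cst_continuous.
have c1 : continuous (fun _ : X => 1 : C) by exact: cst_continuous.
have cs1 : continuous (fun x => 1 - (s x)%:C%C : C).
  exact: (@subr_fun_continuous X C C _ _ c1 csC).
have cU : continuous (fun x => unitary_part (g x).1).
  by apply: unitary_part_continuous => // x; have /gauge_okP[] := ok x.
apply: continuous_gauge.
  have -> : (fun x => (gauge_deform (s x) (g x)).1) = fun x =>
      (1 - (s x)%:C%C) *: (g x).1 + (s x)%:C%C *: unitary_part (g x).1 by [].
  exact: (@addr_fun_continuous X C 'M[C]_2 _ _ (@scaler_fun_continuous X C 'M[C]_2 _ _ cs1 cg1)
    (@scaler_fun_continuous X C 'M[C]_2 _ _ csC cU)).
move=> j; have -> : (fun x => (gauge_deform (s x) (g x)).2 j) = fun x =>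
      (1 - (s x)%:C%C) * (g x).2 j + (s x)%:C%C * ((g x).2 j / `|(g x).2 j|) by [].
have cn : continuous (fun x => (g x).2 j / `|(g x).2 j|).
  apply: mulr_fun_continuous; first exact: cg2.
  apply: invr_fun_continuous; last by move=> x; apply: cvg_norm; exact: cg2.
  by move=> x; rewrite normr_eq0; have /gauge_okP[_ + _] := ok x; apply.
exact: (@addr_fun_continuous X C C _ _ (mulr_fun_continuous cs1 (cg2 j))
  (mulr_fun_continuous csC cn)).
Qed.

(* The factor [U(1)] of the [i]-th outer vertex acts on the vertex [lift ord0 i],
  and the vertex [ord0] is left fixed. *)
Definition gauge_of_unitary (u : U) : gauge :=
  (val u.1, fun j => if unlift ord0 j is Some i then val (u.2 i) ord0 ord0 else 1).

Lemma unitary1P (M : 'M[C]_1) : (M \is unitarymx) = (`|M ord0 ord0| == 1).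
Proof.
rewrite -(@pexpr_eq1 _ _ 2)// normCK; apply/unitarymxP/eqP => [/matrixP/(_ ord0 ord0)|h].
  by rewrite !mxE big_ord1 !mxE eqxx.
by apply/matrixP => i j; rewrite (ord1 i) (ord1 j) !mxE big_ord1 !mxE h.
Qed.

Lemma unitary_entry_norm (v : unitary_group R 1) : `|val v ord0 ord0| = 1.
Proof. by apply/eqP; rewrite -unitary1P; exact: set_mem (valP v). Qed.

Lemma gauge_of_unitary_norm u j : `|(gauge_of_unitary u).2 j| = 1.
Proof. by rewrite /=; case: unliftP => [i _|_]; rewrite ?unitary_entry_norm ?normr1. Qed.

Lemma gauge_of_unitary_ok u : gauge_ok (gauge_of_unitary u).
Proof.
apply/gauge_okP; split=> [|j|].
- by apply: unitarymx_unit; exact: set_mem (valP u.1).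
- by rewrite -normr_gt0 gauge_of_unitary_norm.
- by rewrite /= unlift_none.
Qed.

Lemma gauge_of_unitary_inj : injective gauge_of_unitary.
Proof.
move=> [u1 u2] [v1 v2] [uv1 uv2]; congr (_, _); first exact/val_inj.
apply/funext => i; apply/val_inj/matrixP => a b; rewrite (ord1 a) (ord1 b).
by have := congr1 (fun f => f (lift ord0 i)) uv2; rewrite liftK.
Qed.

Lemma gauge_of_unitary_continuous (X : topologicalType) (u : X -> U) :
  continuous u -> continuous (fun x => gauge_of_unitary (u x)).
Proof.
move=> cu.
have c1 : continuous (fun x => (u x).1).
  exact: (fun x => @continuous_comp X U _ u fst x (cu x) (@cvg_fst _ _ _ _ _)).
have c2 : continuous (fun x => (u x).2).
  exact: (fun x => @continuous_comp X U _ u snd x (cu x) (@cvg_snd _ _ _ _ _)).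
apply: continuous_gauge => [|j]; first exact: (val_continuous c1).
rewrite /=; case: unliftP => [i _|_]; last exact: cst_continuous.
apply: mx_coord_continuous; apply: val_continuous.
exact: (@ptws_coord_continuous X 'I_k (unitary_group R 1) (fun x => (u x).2) i c2).
Qed.

Lemma gauge_deform_unitary s u : gauge_deform s (gauge_of_unitary u) = gauge_of_unitary u.
Proof.
rewrite [RHS]surjective_pairing /gauge_deform; congr (_, _).
  rewrite unitary_part_id; last exact: set_mem (valP u.1).
  by rewrite -scalerDl subrK scale1r.
apply/funext => j; rewrite gauge_of_unitary_norm divr1 -mulrDl subrK mul1r //.
Qed.

Lemma unitary_retract (X : topologicalType) (g : X -> gauge) :
  continuous g -> (forall x, gauge_ok (g x)) ->
  exists u : X -> U, continuous u /\
    forall x, gauge_of_unitary (u x) = gauge_deform 1 (g x).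
Proof.
move=> cg ok; have cd : continuous (fun x => gauge_deform 1 (g x)).
  by apply: gauge_deform_continuous => //; exact: cst_continuous.
have [c1 c2] := gauge_coord_continuous cd.
have dE x : gauge_deform 1 (g x) = (unitary_part (g x).1, fun j => (g x).2 j / `|(g x).2 j|).
  rewrite /gauge_deform subrr scale0r add0r scale1r; congr (_, _); apply/funext => j.
  by rewrite mul0r add0r mul1r.
have u1 x : unitary_group R 2 (gauge_deform 1 (g x)).1.
  by rewrite dE; apply: unitary_part_unitary; have /gauge_okP[] := ok x.
have u2 x i : unitary_group R 1 (const_mx ((gauge_deform 1 (g x)).2 (lift ord0 i))).
  rewrite dE /unitary_group /= unitary1P mxE normf_div normr_id mulfV//.
  by rewrite normr_eq0; have /gauge_okP[_ + _] := ok x; apply.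
pose v1 x : unitary_group R 2 := exist _ (gauge_deform 1 (g x)).1 (mem_set (u1 x)).
pose v2 x : {ptws 'I_k -> unitary_group R 1} :=
  fun i => exist _ (const_mx ((gauge_deform 1 (g x)).2 (lift ord0 i))) (mem_set (u2 x i)).
exists (fun x => (v1 x, v2 x)); split.
  have cv1 : continuous v1 by apply: set_type_continuous; exact: c1.
  have cv2 : continuous v2.
    apply: ptws_continuous => i; apply: set_type_continuous.
    apply: mx_continuous => a b; under eq_fun do rewrite /= mxE; exact: c2.
  by move=> x; exact: (cvg_pair (cv1 x) (cv2 x)).
move=> x; rewrite [RHS]surjective_pairing; congr (_, _).
apply/funext => j; case: unliftP => [i ->|->]; first by rewrite /= mxE.
have s1 : 0 <= (1 : R) <= 1 by rewrite ler01 lexx.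
by have /gauge_okP[_ _ /esym] := gauge_deform_ok s1 (ok x).
Qed.

End Polar.

(** * The connecting map *)

Section RowCoordinates.
Context {R : realType}.

(** The added first coordinate serves as a homotopy parameter; the last coordinate added by
    [rcons_row] is the one transverse to the top face used by the connecting map. *)
Definition cons_row d (s : R) (t : 'rV[R]_d) : 'rV[R]_d.+1 :=
  \row_i (if unlift ord0 i is Some j then t ord0 j else s).
Definition tail_row d (w : 'rV[R]_d.+1) : 'rV[R]_d := \row_i w ord0 (lift ord0 i).
Definition rcons_row d (t : 'rV[R]_d) (s : R) : 'rV[R]_d.+1 :=
  \row_i (if unlift ord_max i is Some j then t ord0 j else s).
Definition init_row d (w : 'rV[R]_d.+1) : 'rV[R]_d := \row_i w ord0 (lift ord_max i).

Lemma cons_rowK d s (t : 'rV[R]_d) : tail_row (cons_row s t) = t.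
Proof. by apply/rowP => i; rewrite !mxE liftK. Qed.

Lemma cons_row0 d s (t : 'rV[R]_d) : cons_row s t ord0 ord0 = s.
Proof. by rewrite mxE unlift_none. Qed.

Lemma rcons_rowK d s (t : 'rV[R]_d) : init_row (rcons_row t s) = t.
Proof. by apply/rowP => i; rewrite !mxE liftK. Qed.

Lemma rcons_row_max d s (t : 'rV[R]_d) : rcons_row t s ord0 ord_max = s.
Proof. by rewrite mxE unlift_none. Qed.

Lemma init_rowK d (w : 'rV[R]_d.+1) : rcons_row (init_row w) (w ord0 ord_max) = w.
Proof. by apply/rowP => i; rewrite !mxE; case: unliftP => [j ->|->]; rewrite ?mxE. Qed.

Lemma tail_row_max d (w : 'rV[R]_d.+2) : tail_row w ord0 ord_max = w ord0 ord_max.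
Proof. by rewrite mxE; congr (w _ _); exact/val_inj. Qed.

Lemma cons_row_continuous (X : topologicalType) d (s : X -> R) (t : X -> 'rV[R]_d) :
  continuous s -> continuous t -> continuous (fun x => cons_row (s x) (t x)).
Proof.
move=> cs ct; apply: continuous_row => i; under eq_fun do rewrite mxE.
by case: unliftP => // j _; exact: mx_coord_continuous.
Qed.

Lemma rcons_row_continuous (X : topologicalType) d (t : X -> 'rV[R]_d) (s : X -> R) :
  continuous t -> continuous s -> continuous (fun x => rcons_row (t x) (s x)).
Proof.
move=> ct cs; apply: continuous_row => i; under eq_fun do rewrite mxE.
by case: unliftP => // j _; exact: mx_coord_continuous.
Qed.

Lemma tail_row_continuous (X : topologicalType) d (w : X -> 'rV[R]_d.+1) :
  continuous w -> continuous (fun x => tail_row (w x)).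
Proof.
move=> cw; apply: continuous_row => i; under eq_fun do rewrite mxE.
exact: mx_coord_continuous.
Qed.

Lemma init_row_continuous (X : topologicalType) d (w : X -> 'rV[R]_d.+1) :
  continuous w -> continuous (fun x => init_row (w x)).
Proof.
move=> cw; apply: continuous_row => i; under eq_fun do rewrite mxE.
exact: mx_coord_continuous.
Qed.

Lemma cube_tail d (w : 'rV[R]_d.+1) : cube R d.+1 w -> cube R d (tail_row w).
Proof. by move=> cw i; rewrite mxE. Qed.

Lemma cube_init d (w : 'rV[R]_d.+1) : cube R d.+1 w -> cube R d (init_row w).
Proof. by move=> cw i; rewrite mxE. Qed.

Lemma cube_cons d s (t : 'rV[R]_d) : 0 <= s <= 1 -> cube R d t ->
  cube R d.+1 (cons_row s t).
Proof. by move=> s01 ct i; rewrite mxE; case: unliftP. Qed.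

Lemma cube_rcons d s (t : 'rV[R]_d) : 0 <= s <= 1 -> cube R d t ->
  cube R d.+1 (rcons_row t s).
Proof. by move=> s01 ct i; rewrite mxE; case: unliftP. Qed.

Lemma horn_boundary d (t : 'rV[R]_d.+1) : horn t -> cube_boundary R d.+1 t.
Proof.
move=> [ct tJ]; split=> //.
by case: tJ => [ [i ti] | [i _ ti] ]; exists i; [left|right].
Qed.

Lemma horn_init d (t : 'rV[R]_d.+1) :
  horn t -> t ord0 ord_max = 0 \/ cube_boundary R d (init_row t).
Proof.
move=> [ct tJ]; have ci := cube_init ct.
case: tJ => [[ i ]|[i im]]; case: (unliftP ord_max i) => [j ->|iE] ti.
- by right; split=> //; exists j; left; rewrite mxE.
- by left; rewrite -iE.
- by right; split=> //; exists j; right; rewrite mxE.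
- by rewrite iE eqxx in im.
Qed.

Lemma init_horn d (t : 'rV[R]_d.+1) :
  cube R d.+1 t -> cube_boundary R d (init_row t) -> horn t.
Proof.
move=> ct [_ [ i ]]; rewrite mxE => ti; split=> //; case: ti => ti; [left; exists (lift ord_max i)|right; exists (lift ord_max i)] => //.
by rewrite eq_sym neq_lift.
Qed.

Lemma boundary_cases d (t : 'rV[R]_d.+1) :
  cube_boundary R d.+1 t -> t ord0 ord_max = 1 \/ horn t.
Proof.
move=> [ct [i [ti|ti]]]; first by right; split=> //; left; exists i.
by have [im|im] := eqVneq i ord_max; [left; rewrite -im|right; split=> //; right; exists i].
Qed.

Lemma horn_tail d (w : 'rV[R]_d.+2) :
  horn w -> [\/ w ord0 ord0 = 0, w ord0 ord0 = 1 | horn (tail_row w)].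
Proof.
move=> [cw wJ]; have ct := cube_tail cw.
case: wJ => [[ i ]|[i im]]; case: (unliftP ord0 i) => [j iE|->] wi.
- by constructor 3; split=> //; left; exists j; rewrite mxE -iE.
- by constructor 1.
- constructor 3; split=> //; right; exists j; last by rewrite mxE -iE.
  by apply: contra im => /eqP jm; rewrite iE jm; apply/eqP/val_inj.
- by constructor 2.
Qed.

Lemma tail_horn d (w : 'rV[R]_d.+2) : cube R d.+2 w -> horn (tail_row w) -> horn w.
Proof.
move=> cw [_ []]; first by move=> [ i ]; rewrite mxE => wi; split=> //; left; exists (lift ord0 i).
by move=> [i im]; rewrite mxE => wi; split=> //; right; exists (lift ord0 i).
Qed.

Lemma horn_ord0 d (w : 'rV[R]_d.+2) : cube R d.+2 w ->
  w ord0 ord0 = 0 \/ w ord0 ord0 = 1 -> horn w.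
Proof. by move=> cw [w0|w1]; split=> //; [left|right]; exists ord0. Qed.

Lemma half_facts : [/\ (0 : R) <= 2^-1, (0 : R) <> 2^-1, (1 : R) <> 2^-1 &
  ((1 : R) <= 2^-1) = false].
Proof. by split; [lra|lra|lra|apply/negbTE; lra]. Qed.

End RowCoordinates.

Lemma spheroid_clamp_continuous (R : realType) d (X : topologicalType) (x : X)
  (f : spheroid R d X x) : continuous (f \o clamp).
Proof. by apply: within_cube_clamp; exact: spheroid_continuous. Qed.

Section Connecting.
Context {R : realType} {k : nat} (alpha : 'I_k.+2 -> R).
Local Notation E := (stable_rep alpha).
Local Notation M := (moduli_space alpha).
Local Notation U := (unitary_product R k.+1).
Hypothesis alpha_lt0 : forall j : 'I_k.+1, alpha (outer j) < 0.
Hypothesis alpha0E : alpha ord0 = - (2^-1 * \sum_(j < k.+1) alpha (outer j)).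
Hypothesis k_gt0 : (1 < k.+1)%N.
Hypothesis short2 : level_strictly_short alpha 2.
Variables (x : M) (u : U).

Let A0 : E := repr x.
Let e0 : quiver_rep R k.+1 := val A0.

Lemma base_class : orbit_class A0 = x.
Proof. exact: orbit_classK. Qed.

Lemma unitary_lift (X : topologicalType) (v : X -> U) : continuous v ->
  exists F : X -> E, [/\ continuous F,
    forall z, val (F z) = act (gauge_of_unitary (v z)) e0 &
    forall z, orbit_class (F z) = x].
Proof.
move=> cv; have [|||F [cF FE Fx]] := @act_stable_rep _ _ _ alpha_lt0 alpha0E X
    (fun z => gauge_of_unitary (v z)) (fun=> A0).
- exact: gauge_of_unitary_continuous.
- exact: cst_continuous.
- by move=> z; exact: gauge_of_unitary_ok.
by exists F; split=> // z; rewrite Fx base_class.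
Qed.

Lemma base_diff (X : topologicalType) (F : X -> E) : continuous F ->
  (forall z, orbit_class (F z) = x) ->
  exists g : X -> @gauge R k, [/\ continuous g, forall z, gauge_ok (g z) &
    forall z, val (F z) = act (g z) e0].
Proof.
move=> cF Fx; apply: (stable_rep_difference alpha_lt0 alpha0E (A := fun=> A0)) => //.
  exact: cst_continuous.
by move=> z; rewrite Fx base_class.
Qed.

Lemma base_inj g h : gauge_ok g -> gauge_ok h -> act g e0 = act h e0 -> g = h.
Proof.
by apply: (act_inj alpha_lt0 alpha0E); exact: stable_rep_nondegenerate.
Qed.

Definition translate_base (v : U) := act (gauge_of_unitary v) e0.

(** A relation, because neither the lift nor its restriction to the top face is unique. The horn is
    sent to the translate of the base representation by [u], which allows an arbitrary base point of
    the unitary group. *)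
Definition connects d (f : spheroid R d.+1 M x) (gamma : spheroid R d U u) :=
  exists F : 'rV[R]_d.+1 -> E, [/\ continuous F,
    forall t, cube R d.+1 t -> orbit_class (F t) = f t,
    forall t, cube R d.+1 t -> t ord0 ord_max = 1 ->
      val (F t) = translate_base (gamma (init_row t)) &
    forall t, horn t -> val (F t) = translate_base u].

Lemma connects_cst d : connects (cst_spheroid R d.+1 x) (cst_spheroid R d u).
Proof.
have [F [cF FE Fx]] := @unitary_lift 'rV[R]_d.+1 (fun=> u) (@cst_continuous _ _ u).
by exists F; split=> // t _; rewrite Fx.
Qed.

(** A lift that is constant on the horn gives a map [g] into the gauge group on the top face, which
    is not yet unitary. The deformation of [g] is spread along the last coordinate and applied to
    the lift: nothing changes at height 0, and the unitary values appear at height 1. *)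
Lemma connects_exists d (f : spheroid R d.+1 M x) : exists gamma, connects f gamma.
Proof.
have cf : continuous (f \o clamp) by exact: spheroid_clamp_continuous.
have [Phi [cPhi PhiE Phix]] := @unitary_lift 'rV[R]_d.+1 (fun=> u) (@cst_continuous _ _ u).
have Phif (t : 'rV[R]_d.+1) : orbit_class (Phi t) = (f \o clamp) (horn_retraction t).
  have Jt : horn (horn_retraction t) by exact: horn_retraction_horn.
  rewrite Phix /=.
  by rewrite clamp_id; [rewrite spheroid_boundary//; exact: horn_boundary|case: Jt].
have [F [cF Ff FPhi]] := relative_lift alpha_lt0 alpha0E cf cPhi Phif.
pose L (t : 'rV[R]_d) := rcons_row (clamp t) 1.
have cL : continuous L.
  by apply: rcons_row_continuous; [exact: clamp_continuous|exact: cst_continuous].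
have Lcube t : cube R d.+1 (L t).
  by apply: cube_rcons; [rewrite ler01 lexx|exact: clamp_cube].
have cFL : continuous (F \o L).
  by move=> t; apply: continuous_comp; [exact: cL|exact: cF].
have [|g [cg gok gE]] := base_diff cFL.
  move=> t; rewrite /= Ff//= clamp_id// spheroid_boundary//; split=> //.
  by exists ord_max; right; rewrite rcons_row_max.
have FL t : cube R d.+1 t -> t ord0 ord_max = 1 -> val (F t) = act (g (init_row t)) e0.
  move=> ct t1; rewrite -gE /= /L clamp_id; last exact: cube_init.
  by rewrite -t1 init_rowK.
have gb t : cube_boundary R d t -> g t = gauge_of_unitary u.
  move=> bt; have [ct _] := bt; apply: base_inj => //; first exact: gauge_of_unitary_ok.
  have -> : act (g t) e0 = val (F (L t)) by rewrite -gE.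
  rewrite FPhi ?PhiE//; apply: init_horn => //.
  by rewrite rcons_rowK clamp_id.
have [gamma0 [cgamma0 gamma0E]] := unitary_retract cg gok.
have gamma0b t : cube_boundary R d t -> gamma0 t = u.
  by move=> bt; apply: gauge_of_unitary_inj; rewrite gamma0E gb// gauge_deform_unitary.
pose gamma : spheroid R d U u :=
  @Spheroid R d U u gamma0 (continuous_subspaceT cgamma0) gamma0b.
pose s (t : 'rV[R]_d.+1) := clamp t ord0 ord_max.
have cs : continuous s by apply: mx_coord_continuous; exact: clamp_continuous.
have cgi : continuous (fun t : 'rV[R]_d.+1 => g (init_row t)).
  move=> t; apply: continuous_comp; last exact: cg.
  by apply: init_row_continuous => ?; exact: cvg_id.
have cA0 : continuous (fun _ : 'rV[R]_d.+1 => A0) by exact: cst_continuous.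
have [|A1 [cA1 A1E A1x]] := act_stable_rep alpha_lt0 alpha0E cgi cA0; first by [].
have cdi := gauge_deform_continuous cs cgi (fun t => gok _).
have [|B1 [cB1 B1E B1x]] := act_stable_rep alpha_lt0 alpha0E cdi cA0.
  by move=> t; apply: gauge_deform_ok => //; exact: clamp_cube.
(* The gauge element [rho t] takes [g] to its deformation at height [s t]; it is found as the
   difference of the two translates of the base representation. *)
have [|rho [crho rhook rhoE]] := stable_rep_difference alpha_lt0 alpha0E cA1 cB1.
  by move=> t; rewrite A1x B1x.
have [G [cG GE Gx]] := act_stable_rep alpha_lt0 alpha0E crho cF rhook.
exists gamma, G; split=> //.
- by move=> t ct; rewrite Gx Ff//= clamp_id.
- move=> t ct t1; rewrite GE FL// -A1E -rhoE B1E /s clamp_id// t1.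
  by rewrite /translate_base gamma0E.
- move=> t Jt; have [ct _] := Jt.
  (* On the horn either the height is 0 or [g] has the unitary value of [u], which the deformation
     fixes. By freeness [rho] is then trivial. *)
  have AB : val (B1 t) = val (A1 t).
    rewrite A1E B1E; congr (act _ _); rewrite /s clamp_id//.
    by case: (horn_init Jt) => [->|/gb ->]; rewrite ?gauge_deform0 ?gauge_deform_unitary.
  have -> : val (G t) = val (F t).
    rewrite GE (_ : rho t = gauge1) ?act1//.
    apply: (act_inj alpha_lt0 alpha0E (stable_rep_nondegenerate alpha_lt0 alpha0E (A1 t))) => //.
      exact: gauge1_ok.
    by rewrite -rhoE AB act1.
  by rewrite FPhi// PhiE.
Qed.

Lemma translate_base_continuous (X : topologicalType) (v : X -> U) :
  continuous v -> continuous (fun z => translate_base (v z)).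
Proof.
move=> cv; apply: act_continuous; first exact: gauge_of_unitary_continuous.
exact: cst_continuous.
Qed.

Lemma translate_base_stable v : stable alpha (translate_base v).
Proof.
apply/stableP => //; apply: act_nondegenerate; first exact: gauge_of_unitary_ok.
exact: stable_rep_nondegenerate.
Qed.

Lemma translate_base_class (A : E) v : val A = translate_base v -> orbit_class A = x.
Proof.
move=> Av; rewrite -base_class; apply/esym/orbit_classP; rewrite Av.
exact/gauge_equiv_act/gauge_of_unitary_ok.
Qed.

(** The map sending the horn to the translate by [u] and the top face to the translates by [gamma]
    has stable values on the boundary of a cube of dimension [d + 1 <= 3]. An extension projects to
    the desired spheroid. *)
Lemma connects_onto d (gamma : spheroid R d U u) : (d < 3)%N ->
  exists f, connects f gamma.
Proof.
move=> d3; have cg : continuous (gamma \o clamp) by exact: spheroid_clamp_continuous.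
pose W v : 'M[R]_(k.+1, 2 + 2) := real_of_rep (translate_base v).
have WK v : rep_of_real (W v) = translate_base v by exact: real_of_repK.
(* The interpolation takes place in the real vector space of all representations; only its boundary
   values need be stable. *)
pose fhat (t : 'rV[R]_d.+1) := W u + t ord0 ord_max *: (W ((gamma \o clamp) (init_row t)) - W u).
have cW : continuous (fun t : 'rV[R]_d.+1 => W ((gamma \o clamp) (init_row t))).
  apply: real_of_rep_continuous; apply: translate_base_continuous => t.
  apply: (@continuous_comp _ _ _ (@init_row R d) (gamma \o clamp)); last exact: cg.
  by apply: init_row_continuous => ?; exact: cvg_id.
have cWu : continuous (fun _ : 'rV[R]_d.+1 => W u) by exact: cst_continuous.
have cf : continuous fhat.
  have cl : continuous (fun t : 'rV[R]_d.+1 => t ord0 ord_max) by exact: coord_continuous.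
  exact: (@addr_fun_continuous _ R 'M[R]_(k.+1, 2 + 2) _ _ cWu
    (@scaler_fun_continuous _ R 'M[R]_(k.+1, 2 + 2) _ _ cl
      (@subr_fun_continuous _ R 'M[R]_(k.+1, 2 + 2) _ _ cW cWu))).
have fJ t : horn t -> fhat t = W u.
  move=> Jt; rewrite /fhat; case: (horn_init Jt) => [->|bt]; first by rewrite scale0r addr0.
  have [ct _] := bt.
  by rewrite /= clamp_id// spheroid_boundary// subrr scaler0 addr0.
have f1 t : cube R d.+1 t -> t ord0 ord_max = 1 -> fhat t = W (gamma (init_row t)).
  move=> ct t1; have aux (a b : 'M[R]_(k.+1, 2 + 2)) : a + (b - a) = b by rewrite addrC subrK.
  rewrite /fhat t1 scale1r aux; congr (W _).
  by rewrite /= clamp_id//; exact: cube_init.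
have fst t : cube_boundary R d.+1 t -> stable alpha (rep_of_real (fhat t)).
  move=> bt; have [ct _] := bt; case: (boundary_cases bt) => [t1|Jt].
    by rewrite f1// WK; exact: translate_base_stable.
  by rewrite fJ// WK; exact: translate_base_stable.
have [F [cF FE]] := @stable_extension R k.+1 alpha 2 d.+1 fhat isT alpha_lt0 alpha0E
  k_gt0 short2 d3 d3 cf fst.
have FJ t : horn t -> val (F t) = translate_base u.
  by move=> Jt; rewrite FE ?fJ//; exact: horn_boundary.
have F1 t : cube R d.+1 t -> t ord0 ord_max = 1 -> val (F t) = translate_base (gamma (init_row t)).
  by move=> ct t1; rewrite FE ?f1//; split=> //; exists ord_max; right.
have cqF : continuous (fun t => orbit_class (F t)).
  by move=> t; apply: continuous_comp; [exact: cF|exact: orbit_class_continuous].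
have qFb t : cube_boundary R d.+1 t -> orbit_class (F t) = x.
  move=> bt; have [ct _] := bt; case: (boundary_cases bt) => [t1|Jt].
    exact: (translate_base_class (F1 t ct t1)).
  exact: (translate_base_class (FJ t Jt)).
by exists (@Spheroid R d.+1 M x _ (continuous_subspaceT cqF) qFb), F.
Qed.

Lemma within_cylinder_clamp (Y : topologicalType) d (H : R * 'rV[R]_d -> Y) :
  {within cylinder R d, continuous H} ->
  continuous (fun w : 'rV[R]_d.+1 => H (clamp w ord0 ord0, tail_row (clamp w))).
Proof.
move=> cH; apply/continuous_subspace_setT.
apply: (@within_comp _ _ _ setT (cylinder R d)
  (fun w : 'rV[R]_d.+1 => (clamp w ord0 ord0, tail_row (clamp w))) H _ _ cH).
  apply: continuous_pairing; first by apply: mx_coord_continuous; exact: clamp_continuous.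
  by apply: tail_row_continuous; exact: clamp_continuous.
by move=> w _; split=> /=; [exact: clamp_cube|apply: cube_tail; exact: clamp_cube].
Qed.

(** The homotopy is lifted over a cube of dimension [d + 2] with [F] and [F'] prescribed at its two
    ends and the translate by [u] on the remaining faces of the horn. The top face then carries a
    homotopy from [gamma] to [gamma']. For [f = f'] this shows that the class of [gamma] depends
    only on [f]. *)
Lemma connects_homotopic d (f f' : spheroid R d.+1 M x) (gamma gamma' : spheroid R d U u) :
  connects f gamma -> connects f' gamma' -> homotopic f f' -> homotopic gamma gamma'.
Proof.
move=> [F [cF Ff F1 FJ]] [F' [cF' F'f F'1 F'J]] [H [cH H0 H1 Hb]].
have [h0 h0' h1' h1] := @half_facts R.
have cHg := within_cylinder_clamp cH.
set Hg := fun w => H _ in cHg.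
pose r (w : 'rV[R]_d.+2) := horn_retraction w.
have cr : continuous r by exact: horn_retraction_continuous.
have Jr w : horn (r w) by exact: horn_retraction_horn.
have ctr : continuous (fun w => tail_row (r w)) by exact: tail_row_continuous.
(* A point of the horn with first coordinate [1 / 2] lies on a face where [F] and [F'] are both the
   translate by [u], so the two branches match. *)
pose Phi w := if r w ord0 ord0 <= 2^-1 then F (tail_row (r w)) else F' (tail_row (r w)).
have cPhi : continuous Phi.
  apply: if_continuous; first exact: mx_coord_continuous.
  - by move=> w; apply: continuous_comp; [exact: ctr|exact: cF].
  - by move=> w; apply: continuous_comp; [exact: ctr|exact: cF'].
  move=> w w12; apply/val_inj.
  case: (horn_tail (Jr w)) => [w0|w1|Jw]; [by move: w12; rewrite w0|by move: w12; rewrite w1|].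
  by rewrite FJ// F'J.
have HgE w : cube R d.+2 w -> Hg w = H (w ord0 ord0, tail_row w).
  by move=> cw; rewrite /Hg clamp_id.
have Phix w : orbit_class (Phi w) = Hg (r w).
  have [cw _] := Jr w; rewrite HgE// /Phi; have ctw := cube_tail cw.
  case: (horn_tail (Jr w)) => [w0|w1|Jw].
  - by rewrite w0 h0 Ff// H0.
  - by rewrite w1 h1 F'f// H1.
  rewrite Hb//; last exact: horn_boundary.
  by case: ifP => _; rewrite ?Ff ?F'f// spheroid_boundary//; exact: horn_boundary.
have [L [cL LH LPhi]] := relative_lift alpha_lt0 alpha0E cHg cPhi Phix.
(* A parametrisation of the top face by the homotopy parameter and the point of the cube. *)
pose P (st : R * 'rV[R]_d) := clamp (cons_row st.1 (rcons_row st.2 1)).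
have cP : continuous P.
  have cc : continuous (fun st : R * 'rV[R]_d => cons_row st.1 (rcons_row st.2 1)).
    apply: cons_row_continuous; first by move=> ?; exact: cvg_fst.
    by apply: rcons_row_continuous; [move=> ?; exact: cvg_snd|exact: cst_continuous].
  by move=> st; apply: continuous_comp; [exact: cc|exact: clamp_continuous].
have cLP : continuous (L \o P) by move=> st; apply: continuous_comp; [exact: cP|exact: cL].
have Pcube st : cube R d.+2 (P st) by exact: clamp_cube.
have P1 st : tail_row (P st) ord0 ord_max = 1.
  rewrite tail_row_max /P !mxE; case: unliftP => [j jE|/(congr1 val)//].
  have -> : j = ord_max.
    by apply/val_inj; have := congr1 (@nat_of_ord _) jE; rewrite lift0 => -[].
  by rewrite rcons_row_max minxx max_r.
have [|g [cg gok gE]] := base_diff cLP.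
  move=> st /=; rewrite LH// HgE// Hb//; first exact: Pcube.
  by split; [exact: cube_tail|exists ord_max; right].
have [v [cv vE]] := unitary_retract cg gok.
have key st w : val (L (P st)) = translate_base w -> v st = w.
  move=> LPw; apply: gauge_of_unitary_inj; rewrite vE.
  rewrite (_ : g st = gauge_of_unitary w) ?gauge_deform_unitary//.
  apply: base_inj => //; first exact: gauge_of_unitary_ok.
  by rewrite -gE.
have PE s t : 0 <= s <= 1 -> cube R d t -> P (s, t) = cons_row s (rcons_row t 1).
  by move=> s01 ct; rewrite /P clamp_id//; apply: cube_cons => //; apply: cube_rcons => //; rewrite ler01 lexx.
have rid w : horn w -> r w = w by exact: horn_retraction_id.
exists v; split.
- exact: continuous_subspaceT.
- move=> t ct; have s01 : 0 <= (0 : R) <= 1 by rewrite lexx ler01.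
  apply: key; have Jw : horn (P (0, t)).
    by apply: horn_ord0 => //; left; rewrite PE// cons_row0.
  rewrite LPhi// /Phi rid// PE// cons_row0 cons_rowK h0.
  rewrite F1 ?rcons_rowK ?rcons_row_max//.
  by apply: cube_rcons => //; rewrite ler01 lexx.
- move=> t ct; have s01 : 0 <= (1 : R) <= 1 by rewrite lexx ler01.
  apply: key; have Jw : horn (P (1, t)).
    by apply: horn_ord0 => //; right; rewrite PE// cons_row0.
  rewrite LPhi// /Phi rid// PE// cons_row0 cons_rowK h1.
  rewrite F'1 ?rcons_rowK ?rcons_row_max//.
  by apply: cube_rcons => //; rewrite ler01 lexx.
- move=> s t s01 bt; have [ct _] := bt; apply: key.
  have Jt : horn (tail_row (P (s, t))).
    apply: init_horn; first exact: cube_tail.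
    by rewrite PE// cons_rowK rcons_rowK.
  have Jw : horn (P (s, t)) by exact: tail_horn.
  by rewrite LPhi// /Phi rid//; case: ifP => _; rewrite ?FJ ?F'J.
Qed.

(** On the boundary of a cube of dimension [d + 2 <= 3], the two lifts at the ends, the translates
    by the homotopy [h] on the top face and the translate by [u] elsewhere fit together. Extending
    this map and projecting it gives the homotopy. *)
Lemma homotopic_of_connects d (f f' : spheroid R d.+1 M x) (gamma gamma' : spheroid R d U u) :
  (d < 2)%N -> connects f gamma -> connects f' gamma' -> homotopic gamma gamma' ->
  homotopic f f'.
Proof.
move=> d2 [F [cF Ff F1 FJ]] [F' [cF' F'f F'1 F'J]] [h [ch h0 h1 hb]].
pose V := 'M[R]_(k.+1, 2 + 2).
have addKC (a b : V) : a + (b - a) = b by rewrite [LHS]addrC subrK.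
have addBB (a b c : V) : a + c + (b - a - c) = b.
  by rewrite -[b - a - c]addrA -opprD addKC.
pose W v : V := real_of_rep (translate_base v).
have WK v : rep_of_real (W v) = translate_base v by exact: real_of_repK.
pose tl (w : 'rV[R]_d.+2) := tail_row w; pose it w := init_row (tl w).
have cid_ : continuous (fun w : 'rV[R]_d.+2 => w) by move=> ?; exact: cvg_id.
have ctl : continuous tl by exact: tail_row_continuous.
have cit : continuous it by exact: init_row_continuous.
have cs : continuous (fun w : 'rV[R]_d.+2 => w ord0 ord0) by exact: coord_continuous.
have cl : continuous (fun w : 'rV[R]_d.+2 => w ord0 ord_max) by exact: coord_continuous.
pose VF (w : 'rV[R]_d.+2) : V := real_of_rep (val (F (tl w))); pose VF' (w : 'rV[R]_d.+2) : V := real_of_rep (val (F' (tl w))).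
pose Wg w : V := W ((gamma \o clamp) (it w)); pose Wg' w : V := W ((gamma' \o clamp) (it w)).
have chg := within_cylinder_clamp ch; set hg := fun v => h _ in chg.
pose Wh (w : 'rV[R]_d.+2) : V := W (hg (cons_row (w ord0 ord0) (it w))).
have cVF : continuous VF.
  apply: real_of_rep_continuous; apply: val_continuous => w.
  by apply: continuous_comp; [exact: ctl|exact: cF].
have cVF' : continuous VF'.
  apply: real_of_rep_continuous; apply: val_continuous => w.
  by apply: continuous_comp; [exact: ctl|exact: cF'].
have cWof (v : 'rV[R]_d.+2 -> U) : continuous v -> continuous (fun w => W (v w)).
  by move=> cv; apply: real_of_rep_continuous; exact: translate_base_continuous.
have cWg : continuous Wg.
  apply: cWof => w; apply: (@continuous_comp _ _ _ it (gamma \o clamp)); first exact: cit.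
  exact: spheroid_clamp_continuous.
have cWg' : continuous Wg'.
  apply: cWof => w; apply: (@continuous_comp _ _ _ it (gamma' \o clamp)); first exact: cit.
  exact: spheroid_clamp_continuous.
have cWh : continuous Wh.
  apply: cWof => w; apply: continuous_comp; last exact: chg.
  exact: cons_row_continuous.
(* Transfinite interpolation: the affine blend of the two lifts in the first coordinate is
   corrected, proportionally to the last one, by the difference between [h] and the blend of [gamma]
   and [gamma']. This difference vanishes at both ends. *)
pose fhat (w : 'rV[R]_d.+2) : V := VF w + w ord0 ord0 *: (VF' w - VF w) +
  w ord0 ord_max *: (Wh w - Wg w - w ord0 ord0 *: (Wg' w - Wg w)).
have cadd (a b : 'rV[R]_d.+2 -> V) : continuous a -> continuous b -> continuous (fun w => a w + b w).
  exact: (@addr_fun_continuous _ R V).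
have csub (a b : 'rV[R]_d.+2 -> V) : continuous a -> continuous b -> continuous (fun w => a w - b w).
  exact: (@subr_fun_continuous _ R V).
have cscale (c : 'rV[R]_d.+2 -> R) (b : 'rV[R]_d.+2 -> V) : continuous c -> continuous b ->
    continuous (fun w => c w *: b w).
  exact: (@scaler_fun_continuous _ R V).
have cf : continuous fhat.
  exact: (cadd _ _ (cadd _ _ cVF (cscale _ _ cs (csub _ _ cVF' cVF)))
    (cscale _ _ cl (csub _ _ (csub _ _ cWh cWg) (cscale _ _ cs (csub _ _ cWg' cWg))))).
have WhE w : cube R d.+2 w -> Wh w = W (h (w ord0 ord0, it w)).
  move=> cw; rewrite /Wh /hg clamp_id ?cons_row0 ?cons_rowK//.
  by apply: cube_cons => //; apply: cube_init; exact: cube_tail.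
have WgE w : cube R d.+2 w -> (Wg w = W (gamma (it w))) * (Wg' w = W (gamma' (it w))).
  by move=> cw; rewrite /Wg /Wg' /= clamp_id//; apply: cube_init; exact: cube_tail.
have f0 w : cube R d.+2 w -> w ord0 ord0 = 0 -> fhat w = VF w.
  move=> cw w0; have ci := cube_init (cube_tail cw).
  by rewrite /fhat (WhE w cw) !(WgE w cw) w0 (h0 _ ci) !scale0r addr0 subr0 subrr scaler0 addr0.
have f1 w : cube R d.+2 w -> w ord0 ord0 = 1 -> fhat w = VF' w.
  move=> cw w1; have ci := cube_init (cube_tail cw).
  by rewrite /fhat (WhE w cw) !(WgE w cw) w1 (h1 _ ci) !scale1r addKC subrr scaler0 addr0.
have fJ w : cube R d.+2 w -> horn (tl w) -> fhat w = W u.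
  move=> cw Jt; have VFu : VF w = W u by rewrite /VF FJ.
  have VF'u : VF' w = W u by rewrite /VF' F'J.
  rewrite /fhat VFu VF'u subrr scaler0 addr0.
  case: (horn_init Jt) => [|bt]; first by rewrite tail_row_max => ->; rewrite scale0r addr0.
  by rewrite (WhE w cw) !(WgE w cw) hb// !spheroid_boundary// !subrr scaler0 subrr scaler0 addr0.
have fl w : cube R d.+2 w -> w ord0 ord_max = 1 -> fhat w = W (h (w ord0 ord0, it w)).
  move=> cw w1; have ct := cube_tail cw; have t1 : tl w ord0 ord_max = 1 by rewrite tail_row_max.
  have VFE : VF w = W (gamma (it w)) by rewrite /VF (F1 _ ct t1).
  have VF'E : VF' w = W (gamma' (it w)) by rewrite /VF' (F'1 _ ct t1).
  rewrite /fhat w1 scale1r VFE VF'E (WhE w cw) !(WgE w cw).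
  exact: addBB.
have fst w : cube_boundary R d.+2 w -> stable alpha (rep_of_real (fhat w)).
  move=> bw; have [cw _] := bw; case: (boundary_cases bw) => [w1|Jw].
    by rewrite fl// WK; exact: translate_base_stable.
  case: (horn_tail Jw) => [w0|w1|Jt].
  - by rewrite f0// real_of_repK; exact: set_mem (valP (F (tl w))).
  - by rewrite f1// real_of_repK; exact: set_mem (valP (F' (tl w))).
  - by rewrite fJ// WK; exact: translate_base_stable.
have [G [cG GE]] := @stable_extension R k.+1 alpha 2 d.+2 fhat isT alpha_lt0 alpha0E
  k_gt0 short2 d2 d2 cf fst.
have cq : continuous (fun st : R * 'rV[R]_d.+1 => orbit_class (G (cons_row st.1 st.2))).
  have cc : continuous (fun st : R * 'rV[R]_d.+1 => G (cons_row st.1 st.2)).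
    move=> st; apply: (@continuous_comp _ _ _ (fun st : R * 'rV[R]_d.+1 => cons_row st.1 st.2) G);
      last exact: cG.
    by apply: cons_row_continuous => ?; [exact: cvg_fst|exact: cvg_snd].
  by move=> st; apply: continuous_comp; [exact: cc|exact: orbit_class_continuous].
exists (fun st => orbit_class (G (cons_row st.1 st.2))); split.
- exact: continuous_subspaceT.
- move=> t ct /=; have cw : cube R d.+2 (cons_row 0 t).
    by apply: cube_cons => //; rewrite lexx ler01.
  have bw : cube_boundary R d.+2 (cons_row 0 t).
    by split=> //; exists ord0; left; rewrite cons_row0.
  rewrite -Ff//; congr orbit_class; apply/val_inj.
  by rewrite GE// f0 ?cons_row0// real_of_repK /tl cons_rowK.
- move=> t ct /=; have cw : cube R d.+2 (cons_row 1 t).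
    by apply: cube_cons => //; rewrite lexx ler01.
  have bw : cube_boundary R d.+2 (cons_row 1 t).
    by split=> //; exists ord0; right; rewrite cons_row0.
  rewrite -F'f//; congr orbit_class; apply/val_inj.
  by rewrite GE// f1 ?cons_row0// real_of_repK /tl cons_rowK.
- move=> s t s01 bt /=; have [ct [i ti]] := bt.
  have cw : cube R d.+2 (cons_row s t) by exact: cube_cons.
  have bw : cube_boundary R d.+2 (cons_row s t).
    by split=> //; exists (lift ord0 i); rewrite mxE liftK.
  case: (boundary_cases bt) => [t1|Jt].
    apply: (@translate_base_class _ (h (s, it (cons_row s t)))).
    rewrite GE// fl ?WK ?cons_row0//.
    by rewrite -tail_row_max cons_rowK.
  apply: (@translate_base_class _ u); rewrite GE// fJ ?WK//.
  by rewrite /tl cons_rowK.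
Qed.

(** The second clause records more than bijectivity: the value at any class can be computed from any
    connected pair, which is how the unit and the product are handled. *)
Lemma connecting_bijection d : (d < 2)%N ->
  exists phi : homotopy_group R d.+1 M x -> homotopy_group R d U u, bijective phi /\
    forall f gamma, connects f gamma ->
      phi (\pi_(homotopy_group R d.+1 M x) f) = \pi_(homotopy_group R d U u) gamma.
Proof.
move=> d2; have /choice[c cP] : forall a : homotopy_group R d.+1 M x,
    exists gamma, connects (repr a) gamma by move=> a; exact: connects_exists.
pose phi a := \pi_(homotopy_group R d U u) (c a).
have phiE f gamma : connects f gamma -> phi (\pi f) = \pi_(homotopy_group R d U u) gamma.
  move=> fg; apply/eq_homotopy_class; apply: connects_homotopic (cP _) fg _.
  by apply/eq_homotopy_class; rewrite reprK.
have phi_inj : injective phi.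
  move=> a b /eq_homotopy_class ab; rewrite -(reprK a) -(reprK b).
  by apply/eq_homotopy_class; exact: homotopic_of_connects d2 (cP a) (cP b) ab.
have /choice[psi psiP] : forall b, exists a, phi a = b.
  move=> b; have [f fb] := connects_onto (repr b) (leqW d2).
  by exists (\pi f); rewrite (phiE _ _ fb) reprK.
exists phi; split=> //; exists psi => // a.
by apply: phi_inj; rewrite psiP.
Qed.

Lemma init_double d b (t : 'rV[R]_d.+2) : init_row (Defs.double b t) = Defs.double b (init_row t).
Proof.
apply/rowP => i; rewrite !mxE.
have -> : (lift ord_max i == ord0) = (i == ord0).
  apply/eqP/eqP => [h|->]; apply/val_inj; last exact: lift_max.
  by have := congr1 (@nat_of_ord _) h; rewrite lift_max.
by case: eqP => // _; congr (2 * t _ _ - b); exact/val_inj.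
Qed.

Lemma double_max d b (t : 'rV[R]_d.+2) : Defs.double b t ord0 ord_max = t ord0 ord_max.
Proof. by rewrite mxE. Qed.

(** Concatenation acts on the first coordinate and the connecting map uses the last; in dimension at
    least 2 they are different. The two lifts can be juxtaposed because both are the translate by
    [u] where they meet. *)
Lemma connects_concat d (f g : spheroid R d.+2 M x) (gamma delta : spheroid R d.+1 U u) :
  connects f gamma -> connects g delta -> connects (concat f g) (concat gamma delta).
Proof.
move=> [F [cF Ff F1 FJ]] [G [cG Gg G1 GJ]].
have cc b : continuous (fun t : 'rV[R]_d.+2 => clamp (Defs.double b t)).
  by move=> t; apply: continuous_comp; [exact: double_continuous|exact: clamp_continuous].
have half (t : 'rV[R]_d.+2) : cube R d.+2 t ->
    if t ord0 ord0 <= 2^-1 then 0 <= 2 * t ord0 ord0 - 0 <= 1 else 0 <= 2 * t ord0 ord0 - 1 <= 1.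
  by move=> /(_ ord0) t01; case: leP => t12; lra.
have dhorn b (t : 'rV[R]_d.+2) : b = 0 \/ b = 1 -> horn t ->
    0 <= 2 * t ord0 ord0 - b <= 1 -> horn (Defs.double b t).
  move=> b01 [ct tJ] tb; split; first exact: double_cube.
  case: tJ => [[ i ti]|[i im ti]]; have [i0|i0] := eqVneq i ord0.
  - left; exists ord0; rewrite mxE eqxx; move: tb; rewrite -i0 ti.
    by case: b01 => ->; lra.
  - by left; exists i; rewrite mxE (negbTE i0).
  - right; exists ord0 => //; rewrite mxE eqxx; move: tb; rewrite -i0 ti.
    by case: b01 => ->; lra.
  - by right; exists i => //; rewrite mxE (negbTE i0).
exists (fun t : 'rV[R]_d.+2 => if t ord0 ord0 <= 2^-1 then F (clamp (Defs.double 0 t)) else G (clamp (Defs.double 1 t))).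
split.
- apply: if_continuous; first exact: coord_continuous.
  + by move=> t; apply: continuous_comp; [exact: cc|exact: cF].
  + by move=> t; apply: continuous_comp; [exact: cc|exact: cG].
  + move=> t t12; apply/val_inj; rewrite FJ ?GJ//; apply: horn_ord0; try exact: clamp_cube.
      by left; rewrite !mxE eqxx t12 mulfV ?pnatr_eq0// subrr min_r ?ler01// maxxx.
    by right; rewrite !mxE eqxx t12 mulfV ?pnatr_eq0// subr0 minxx max_r.
- move=> t ct; have := half t ct; rewrite /= /concat_fun /Defs.glue /=.
  case: leP => _ hb; have cd := double_cube ct hb; rewrite clamp_id//.
    by rewrite Ff.
  by rewrite Gg.
- move=> t ct t1; have := half t ct; rewrite /= /concat_fun /Defs.glue /=.
  have -> : init_row t ord0 ord0 = t ord0 ord0 by rewrite mxE; congr (t _ _); exact/val_inj.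
  case: leP => _ hb; have cd := double_cube ct hb; rewrite clamp_id//.
    by rewrite F1 ?double_max// init_double.
  by rewrite G1 ?double_max// init_double.
- move=> t Jt; have [ct _] := Jt; have := half t ct.
  case: leP => _ hb; have cd := double_cube ct hb; rewrite clamp_id//.
    by rewrite FJ//; apply: dhorn => //; left.
  by rewrite GJ//; apply: dhorn => //; right.
Qed.

End Connecting.

(** * Homotopy groups of the space of stable representations *)

Lemma path_connected_connected (R : realType) (X : topologicalType) :
  path_connected R X -> connected [set: X].
Proof.
move=> [[x0 _] pc].
have i0 : `[0, 1]%classic (0 : R) by rewrite /= in_itv /= lexx ler01.
have i1 : `[0, 1]%classic (1 : R) by rewrite /= in_itv /= lexx ler01.
have /choice[p pP] : forall y, exists p : R -> X,
  [/\ {within `[0, 1]%classic, continuous p}, p 0 = x0 & p 1 = y] by move=> y; exact: pc.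
have -> : [set: X] = \bigcup_(y in [set: X]) (p y @` `[0, 1]%classic).
  apply/seteqP; split=> // y _; exists y => //; have [_ _ p1] := pP y.
  by exists 1.
apply: bigcup_connected.
  by exists x0 => y _; have [_ p0 _] := pP y;  exists 0.
move=> y _; have [cp _ _] := pP y; apply: connected_continuous_connected => //.
exact: segment_connected.
Qed.

Section StableHomotopy.
Context {R : realType} {n : nat} (alpha : 'I_n.+1 -> R) (l : nat).
Local Notation E := (stable_rep alpha).
Hypothesis n_gt0 : (0 < n)%N.
Hypothesis alpha_lt0 : forall j : 'I_n, alpha (outer j) < 0.
Hypothesis alpha0E : alpha ord0 = - (2^-1 * \sum_(j < n) alpha (outer j)).
Hypothesis l_gt0 : (0 < l)%N.
Hypothesis l_le_n : (l <= n)%N.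
Hypothesis short : level_strictly_short alpha l.

(** The extension property in dimension 0 gives a point, and in dimension 1 a path between two given
    points. *)
Lemma stable_path_connected : path_connected R E.
Proof.
split.
  have l2 : (0 < 2 * l)%N by rewrite muln_gt0.
  have c0 : continuous (fun _ : 'rV[R]_0 => 0 : 'M[R]_(n, 2 + 2)) by exact: cst_continuous.
  have [|F _] := @stable_extension R n alpha l 0 _ n_gt0 alpha_lt0 alpha0E
    l_le_n short isT l2 c0; last by exists (F 0).
  by move=> t [_ [[]]].
move=> A B; pose V := 'M[R]_(n, 2 + 2).
pose a : V := real_of_rep (val A); pose b : V := real_of_rep (val B).
pose f (t : 'rV[R]_1) : V := a + t ord0 ord0 *: (b - a).
have cf : continuous f.
  have c0 : continuous (fun t : 'rV[R]_1 => t ord0 ord0) by exact: coord_continuous.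
  have cc (c : V) : continuous (fun _ : 'rV[R]_1 => c) by exact: cst_continuous.
  exact: (@addr_fun_continuous _ R V _ _ (cc a) (@scaler_fun_continuous _ R V _ _ c0 (cc (b - a)))).
have f0 (t : 'rV[R]_1) : t ord0 ord0 = 0 -> f t = a by move=> t0; rewrite /f t0 scale0r addr0.
have f1 (t : 'rV[R]_1) : t ord0 ord0 = 1 -> f t = b.
  by move=> t1; rewrite /f t1 scale1r [LHS]addrC subrK.
have fst t : cube_boundary R 1 t -> stable alpha (rep_of_real (f t)).
  move=> [_ [ i ]]; rewrite (ord1 i) => -[t0|t1].
    by rewrite f0// real_of_repK; exact: set_mem (valP A).
  by rewrite f1// real_of_repK; exact: set_mem (valP B).
have [F [cF FE]] := @stable_extension R n alpha l 1 f n_gt0 alpha_lt0 alpha0E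
    l_le_n short isT (leq_mul (leqnn 2) l_gt0) cf fst.
have bd (s : R) : s = 0 \/ s = 1 -> cube_boundary R 1 (const_mx s).
  move=> s01; split; last by exists ord0; rewrite mxE.
  by move=> i; rewrite mxE; case: s01 => ->; rewrite lexx ler01.
exists (fun s => F (const_mx s)); split.
- apply: continuous_subspaceT => s.
  apply: (@continuous_comp _ _ _ (fun s : R => const_mx s : 'rV[R]_1) F); last exact: cF.
  apply: mx_continuous => i j; under eq_fun do rewrite mxE.
  by move=> ?; exact: cvg_id.
- by apply/val_inj; rewrite FE ?f0 ?mxE// ?real_of_repK//; apply: bd; left.
- by apply/val_inj; rewrite FE ?f1 ?mxE// ?real_of_repK//; apply: bd; right.
Qed.

(** A nullhomotopy of a spheroid of dimension [d] is an extension from the boundary of a cube of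
    dimension [d + 1]: the spheroid at time 0 and the base point on all other faces. *)
Lemma stable_homotopy_trivial d : (d < 3)%N -> (d.+1 < 2 * l)%N ->
  homotopy_group_trivial R d E.
Proof.
case: d => [_ _|d d3 dl]; first exact: stable_path_connected.
move=> x q; rewrite -(reprK q); set f := repr q.
apply/eq_homotopy_class; pose V := 'M[R]_(n, 2 + 2).
have cfc : continuous (f \o clamp) by exact: spheroid_clamp_continuous.
pose a (w : 'rV[R]_d.+2) : V := real_of_rep (val ((f \o clamp) (tail_row w))).
pose b : V := real_of_rep (val x).
pose fhat (w : 'rV[R]_d.+2) : V := a w + w ord0 ord0 *: (b - a w).
have ca : continuous a.
  apply: real_of_rep_continuous; apply: val_continuous => w.
  apply: (@continuous_comp _ _ _ (@tail_row R d.+1) (f \o clamp)); last exact: cfc.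
  by apply: tail_row_continuous => ?; exact: cvg_id.
have cf : continuous fhat.
  have c0 : continuous (fun t : 'rV[R]_d.+2 => t ord0 ord0) by exact: coord_continuous.
  have cb : continuous (fun _ : 'rV[R]_d.+2 => b) by exact: cst_continuous.
  exact: (@addr_fun_continuous _ R V _ _ ca (@scaler_fun_continuous _ R V _ _ c0
    (@subr_fun_continuous _ R V _ _ cb ca))).
have f0 (w : 'rV[R]_d.+2) : cube R d.+2 w -> w ord0 ord0 = 0 -> fhat w = real_of_rep (val (f (tail_row w))).
  move=> cw w0; rewrite /fhat w0 scale0r addr0 /a /= clamp_id//.
  exact: cube_tail.
have f1 (w : 'rV[R]_d.+2) : w ord0 ord0 = 1 -> fhat w = b.
  by move=> w1; rewrite /fhat w1 scale1r [LHS]addrC subrK.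
have fb w : cube_boundary R d.+1 (tail_row w) -> fhat w = b.
  move=> bt; have [ct _] := bt; have ab : a w = b.
    by rewrite /a /= clamp_id// spheroid_boundary.
  by rewrite /fhat ab subrr scaler0 addr0.
have cases w : cube_boundary R d.+2 w ->
    [\/ w ord0 ord0 = 0, w ord0 ord0 = 1 | cube_boundary R d.+1 (tail_row w)].
  move=> [cw [ i ]]; case: (unliftP ord0 i) => [j ->|->] wi.
    by constructor 3; split; [exact: cube_tail|exists j; rewrite mxE].
  by case: wi => ?; [constructor 1|constructor 2].
have fst w : cube_boundary R d.+2 w -> stable alpha (rep_of_real (fhat w)).
  move=> bw; have [cw _] := bw; case: (cases w bw) => [w0|w1|bt].
  - by rewrite f0// real_of_repK; exact: set_mem (valP (f (tail_row w))).
  - by rewrite f1// real_of_repK; exact: set_mem (valP x).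
  - by rewrite fb// real_of_repK; exact: set_mem (valP x).
have [F [cF FE]] := @stable_extension R n alpha l d.+2 fhat n_gt0 alpha_lt0 alpha0E
    l_le_n short d3 dl cf fst.
exists (fun st => F (cons_row st.1 st.2)); split.
- apply: continuous_subspaceT => st.
  apply: (@continuous_comp _ _ _ (fun st : R * 'rV[R]_d.+1 => cons_row st.1 st.2) F);
    last exact: cF.
  by apply: cons_row_continuous => ?; [exact: cvg_fst|exact: cvg_snd].
- move=> t ct; have cw : cube R d.+2 (cons_row 0 t).
    by apply: cube_cons => //; rewrite lexx ler01.
  apply/val_inj; rewrite /= FE.
    by rewrite f0 ?cons_row0// real_of_repK cons_rowK.
  by split=> //; exists ord0; left; rewrite cons_row0.
- move=> t ct; have cw : cube R d.+2 (cons_row 1 t).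
    by apply: cube_cons => //; rewrite lexx ler01.
  apply/val_inj; rewrite /= FE.
    by rewrite f1 ?cons_row0// real_of_repK.
  by split=> //; exists ord0; right; rewrite cons_row0.
- move=> s t s01 bt; have [ct [i ti]] := bt; apply/val_inj; rewrite /= FE.
    by rewrite fb ?cons_rowK// real_of_repK.
  split; first exact: cube_cons.
  by exists (lift ord0 i); rewrite mxE liftK.
Qed.

End StableHomotopy.

Theorem theorem4p5 (R : realType) (n : nat) (alpha : 'I_n.+1 -> R) :
  (2 <= n)%N ->
  (forall j : 'I_n, alpha (outer j) < 0) ->
  alpha ord0 = - (2^-1 * \sum_(j < n) alpha (outer j)) ->
  (level_strictly_short alpha 2 ->
     (forall j : nat, (j <= 2)%N ->
        homotopy_group_trivial R j (stable_rep alpha)) /\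
     (forall (x : moduli_space alpha) (u : unitary_product R n),
        (exists phi : homotopy_group R 1 (moduli_space alpha) x ->
                      homotopy_group R 0 (unitary_product R n) u,
           bijective phi /\ phi homotopy_one = homotopy_one) /\
        (exists phi : homotopy_group R 2 (moduli_space alpha) x ->
                      homotopy_group R 1 (unitary_product R n) u,
           bijective phi /\
           {morph phi : a b / homotopy_mul a b >-> homotopy_mul a b}))) /\
  (level_strictly_short alpha 1 ->
     connected [set: moduli_space alpha] /\
     connected [set: stable_rep alpha]).
Proof.
(* The gauge group is normalised at an outer vertex, so the number of outer vertices is written as a
   successor. *)
case: n alpha => [//|k] alpha n2 alpha_lt0 alpha0E; split=> [short2|short1].
  split=> [j j2|x u].
    by apply: (stable_homotopy_trivial (l := 2)).
  have bij := connecting_bijection alpha_lt0 alpha0E n2 short2 x u.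
  split.
    have [phi [phi_bij phiE]] := bij 0%N isT; exists phi; split=> //.
    by apply: phiE; exact: connects_cst.
  have [phi [phi_bij phiE]] := bij 1%N isT; exists phi; split=> // a b.
  rewrite -(reprK a) -(reprK b) homotopy_mulE.
  have [gamma ag] := connects_exists alpha_lt0 alpha0E u (repr a).
  have [delta bd] := connects_exists alpha_lt0 alpha0E u (repr b).
  rewrite (phiE _ _ ag) (phiE _ _ bd) homotopy_mulE.
  by apply: phiE; exact: connects_concat.
have pc : path_connected R (stable_rep alpha).
  exact: (stable_path_connected (l := 1) _ alpha_lt0 alpha0E _ (ltnW n2) short1).
split; last exact: path_connected_connected pc.
(* The moduli space is the continuous image of the stable representations. *)
have -> : [set: moduli_space alpha] = @orbit_class R k alpha @` [set: stable_rep alpha].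
  by apply/seteqP; split=> // b _; exists (repr b) => //; exact: orbit_classK.
apply: connected_continuous_connected; first exact: path_connected_connected pc.
by apply: continuous_subspaceT; exact: orbit_class_continuous.
Qed.
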